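(* Let $a<b$, $\tau>0$, and let $W\in C^3(\mathbb{R})$ satisfy $W(\pm1)=W'(\pm1)=0$, $W''(\pm1)>0$ and $W(u)>0$ for $u\neq\pm1$; set $\lambda:=\min\{W''(1),W''(-1)\}$ and $c_0:=\int_{-1}^1\sqrt{2W(s)}\,ds$. Let $v:[a,b]\to\{-1,+1\}$ be piecewise constant with exactly $N$ jumps at $a<h_1<\dots<h_N<b$, and $r>0$ such that the intervals $(h_i-r,h_i+r)$ are pairwise disjoint, $a\le h_1-r$, $h_N+r\le b$; let $A\in(0,r\sqrt{2\lambda})$ and $f:(0,+\infty)\to(0,+\infty)$. For each $\varepsilon>0$ let $u^\varepsilon$, with $(u^\varepsilon,u^\varepsilon_t)\in C([0,T],H^3(a,b)\times H^1(a,b))$ for every $T>0$, solve $$\tau u_{tt}+u_t=(-\varepsilon^2u_{xx}+W'(u))_{xx}$$ on $(a,b)$ with $u(a,t)=\pm1$, $u(b,t)=\pm1$, $u_{xx}(a,t)=u_{xx}(b,t)=0$ for all $t\ge0$, and initial data $u^\varepsilon(\cdot,0)=u^\varepsilon_0$, $u^\varepsilon_t(\cdot,0)=u^\varepsilon_1$ satisfying $\lim_{\varepsilon\to0}\|u_0^\varepsilon-v\|_{L^1(a,b)}=0$ and $E_\varepsilon[u_0^\varepsilon,\bar u_1^\varepsilon]\le Nc_0+1/f(\varepsilon)$ for all sufficiently small $\varepsilon>0$. Let $T_\varepsilon:=\min\{f(\varepsilon),\exp(A/\varepsilon)\}$. Then $$\sup_{0\le t\le T_\varepsilon}\|\bar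 u^\varepsilon(\cdot,t)-\bar v\|_{L^1(a,b)}\to0\quad\text{as }\varepsilon\to0,$$ and for every $\eta\in(0,1)$, $$\sup_{0\le t\le \varepsilon^\eta T_\varepsilon}\|u^\varepsilon(\cdot,t)-v\|_{L^1(a,b)}\to0\quad\text{as }\varepsilon\to0.$$
   Context: For $g\in L^1(a,b)$ (possibly depending on $t$), $\bar g(x):=\int_a^x g(y)\,dy-\frac{1}{b-a}\int_a^b\int_a^y g(\eta)\,d\eta\,dy$; $\bar u^\varepsilon(\cdot,t)$, $\bar u_1^\varepsilon$, $\bar v$ denote this transform applied to $u^\varepsilon(\cdot,t)$, $u_1^\varepsilon$, $v$. $E_\varepsilon[u,w]:=\frac{\tau}{2\varepsilon}\|w\|_{L^2(a,b)}^2+\int_a^b\left[\frac{\varepsilon}{2}u_x^2+\frac{W(u)}{\varepsilon}\right]dx$. The boundary values $\pm1$ at $a$ and $b$ are fixed constants. *)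

(* Defs.v *)
From HB Require Import structures.
From mathcomp Require Import all_boot all_order all_algebra.
From mathcomp Require Import all_classical all_reals all_analysis.
Set Implicit Arguments. Unset Strict Implicit. Unset Printing Implicit Defensive.
Import Order.TTheory GRing.Theory Num.Theory.
Import numFieldNormedType.Exports.
Local Open Scope classical_set_scope.
Local Open Scope ring_scope.

Section Defs.
Variable R : realType.
Local Notation mu := (@lebesgue_measure R).

Definition C3 (W : R -> R) : Prop :=
  [/\ (forall x, derivable W x 1), (forall x, derivable (derive1 W) x 1),
      (forall x, derivable (derive1n 2 W) x 1) & continuous (derive1n 3 W)].

Definition smooth (phi : R -> R) : Prop :=
  forall (n : nat) (x : R), derivable (derive1n n phi) x 1.

Definition test_fn (a b : R) (phi : R -> R) : Prop :=
  smooth phi /\ exists c d : R, [/\ a < c, c <= d, d < b &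
    forall x, x < c \/ d < x -> phi x = 0].

Definition L2 (a b : R) (f : R -> R) : Prop :=
  measurable_fun `]a, b[ f /\ mu.-integrable `]a, b[ (fun x => (f x ^+ 2)%:E).

Definition weak_deriv (a b : R) (f g : R -> R) : Prop :=
  forall phi, test_fn a b phi ->
    \int[mu]_(x in `]a, b[) (f x * derive1 phi x) =
    - \int[mu]_(x in `]a, b[) (g x * phi x).

Definition L2_cont (a b T : R) (F : R -> R -> R) : Prop :=
  forall t0, 0 <= t0 <= T ->
    (fun t => (\int[mu]_(x in `]a, b[) ((F t x - F t0 x) ^+ 2)%:E)%E)
      @ (within `[0, T] (nbhs t0)) --> 0%:E.

(* (u, ut) in C([0,T], H^3(a,b) x H^1(a,b)), with the weak x-derivatives
   ux, uxx, uxxx of u and utx of ut; functions are indexed (t, x). *)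
Definition reg_H3H1 (a b T : R) (u ux uxx uxxx ut utx : R -> R -> R) : Prop :=
  [/\ (forall t, 0 <= t <= T ->
         [/\ L2 a b (u t), L2 a b (ux t), L2 a b (uxx t), L2 a b (uxxx t) &
             L2 a b (ut t) /\ L2 a b (utx t)]),
      (forall t, 0 <= t <= T ->
         [/\ weak_deriv a b (u t) (ux t), weak_deriv a b (ux t) (uxx t),
             weak_deriv a b (uxx t) (uxxx t) & weak_deriv a b (ut t) (utx t)]) &
      [/\ L2_cont a b T u, L2_cont a b T ux, L2_cont a b T uxx,
          L2_cont a b T uxxx & L2_cont a b T ut /\ L2_cont a b T utx]].

Definition bar (a b : R) (g : R -> R) (x : R) : R :=
  \int[mu]_(y in `[a, x]) g y -
  (b - a)^-1 * \int[mu]_(y in `[a, b]) (\int[mu]_(z in `[a, y]) g z).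

(* E_eps[u, w], with ux the (weak) derivative of u *)
Definition energy (tau eps : R) (W : R -> R) (a b : R) (u ux w : R -> R) : \bar R :=
  ((tau / (2 * eps))%:E * (\int[mu]_(x in `]a, b[) ((w x) ^+ 2)%:E)
   + \int[mu]_(x in `]a, b[) (eps / 2 * (ux x) ^+ 2 + W (u x) / eps)%:E)%E.

Definition L1dist (a b : R) (f g : R -> R) : \bar R :=
  (\int[mu]_(x in `]a, b[) (`|f x - g x|)%:E)%E.

Definition ext_pts (a b : R) (N : nat) (h : nat -> R) (i : nat) : R :=
  if i == 0%N then a else if (i <= N)%N then h i else b.

Definition pw_const_jumps (a b : R) (N : nat) (h : nat -> R) (v : R -> R) : Prop :=
  [/\ [/\ a < h 1%N, (forall i, (1 <= i < N)%N -> h i < h i.+1) & h N < b],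
      (forall x, a <= x <= b -> v x = 1 \/ v x = -1),
      (forall i, (i <= N)%N -> forall x y,
          ext_pts a b N h i < x < ext_pts a b N h i.+1 ->
          ext_pts a b N h i < y < ext_pts a b N h i.+1 -> v x = v y) &
      (forall i, (1 <= i <= N)%N -> forall x y,
          ext_pts a b N h i.-1 < x < h i -> h i < y < ext_pts a b N h i.+1 ->
          v x <> v y)].

End Defs.

(* Main.v *)
(**
Let [w] be the zero-mean primitive of [u_t].  Then [bar u] moves with velocity [w], and the
equation makes [e E] decrease with rate [-|w|^2], so that in L2
  [|bar u(t) - bar u(0)|^2 <= t e (E(0) - E(t))].
As long as [bar u] is L2-close to [bar v], the function [u] has to come near both wells next to
every jump of [v], and then [E >= N c0 - C exp (- A / e)]: a layer costs [c0] up to the distance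
of its end values to the wells, and what is missing is paid, up to an exponentially small part,
by the energy on the rest of [(h_i - r, h_i + r)], by a Riccati inequality for the remaining
energy.  Together with the bound on [E(0)] this leaves a displacement of order [sqrt e] until
[min (f e) (exp (A / e))], and by continuity in time [bar u] never leaves the neighbourhood of
[bar v].  For [u] itself, integrate by parts:
  [|u(t) - u(0)|^2 = - <bar u(t) - bar u(0), u_x(t) - u_x(0)>],
where [u_x = O(1 / sqrt e)]; the factor [e^eta] in the time compensates this loss.
*)

(* The equation is known only in weak form, against smooth functions of compact support, and [u_tt]
   is not given as a function, so the energy cannot be differentiated by the chain rule. Two devices
   replace it. First, derivatives of test functions approximate every [bar g] in L2. Hence, after
   one integration in space, [tau w + bar u] has time derivative [(- e^2 u_xx + W'(u))_x] against
   all these functions, with an error uniform in them because that right-hand side is continuous in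
   time. Second, an energy increment is written exactly as increments paired with sums, and its
   first-order expansion needs only such weak derivatives. Boundary terms never appear: [u_xx] and
   [W'(u)] vanish at both ends, and the fixed boundary values give [u_x(t) - u_x(s)] zero mean. The
   exponential rate comes from an inequality [c Phi <= W] near a well, [Phi] being the weighted
   distance to it. The choice [c = sqrt (lambda / 2)] turns the condition on [A] into [A < 2 c r],
   and [r - A / (2 c)] is the distance from a jump within which [u] must be found near the wells. *)
Require Import Defs.
From HB Require Import structures.
From mathcomp Require Import all_boot all_order all_algebra.
From mathcomp Require Import all_classical all_reals all_analysis.
From mathcomp Require Import measurable_realfun.
From mathcomp Require Import ring lra.
Import Order.TTheory GRing.Theory Num.Theory.
Import numFieldNormedType.Exports.
Local Open Scope classical_set_scope.
Local Open Scope ring_scope.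

Set Implicit Arguments. Unset Strict Implicit. Unset Printing Implicit Defensive.

(** * Square integrable functions on an interval *)

Section L2calc.
Variables (R : realType) (a b : R).
Local Notation mu := (@lebesgue_measure R).
Implicit Types (f g h : R -> R) (c : R).

(** The closed interval suits continuity up to the boundary. The statement integrates over the open
    one, with the same values since the endpoints are null. *)
Definition intg f := mu.-integrable `[a, b] (EFin \o f).
Definition Iab f : R := \int[mu]_(x in `[a, b]) f x.
Definition meas f := measurable_fun `[a, b] f.
Definition sqi f := meas f /\ intg (fun x => f x ^+ 2).

Lemma intg_meas f : intg f -> meas f.
Proof. by case/integrableP => /measurable_EFinP. Qed.

Lemma sqi_meas f : sqi f -> meas f. Proof. by case. Qed.

Lemma measB f g : meas f -> meas g -> meas (f - g).
Proof. by move=> mf mg; have := measurable_funB mf mg; exact. Qed.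

Lemma intgD f g : intg f -> intg g -> intg (f + g).
Proof. by move=> If Ig; have := integrableD _ If Ig; exact. Qed.

Lemma intgB f g : intg f -> intg g -> intg (f - g).
Proof. by move=> If Ig; have := integrableB _ If Ig; exact. Qed.

Lemma intgZ c f : intg f -> intg (fun x => c * f x).
Proof. by move=> If; have := integrableZl _ c If; exact. Qed.

Lemma le_intg f g : meas f -> (forall x, x \in `[a, b] -> `|f x| <= g x) -> intg g -> intg f.
Proof.
move=> mf fg; apply: le_integrable => //; first exact/measurable_EFinP.
by move=> x /= xab; rewrite lee_fin (le_trans (fg _ xab))// ler_norm.
Qed.

Lemma continuous_intg f : {within `[a, b], continuous f} -> intg f.
Proof. by apply: continuous_compact_integrable; exact: segment_compact. Qed.

Lemma intg_cst c : intg (cst c).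
Proof. by apply: continuous_intg => x; exact: cvg_cst. Qed.

Lemma intgM f g : sqi f -> sqi g -> intg (f * g).
Proof.
move=> [mf If] [mg Ig]; apply: (@le_intg _ ((fun x => f x ^+ 2) + (fun x => g x ^+ 2))); last exact: intgD.
- exact: measurable_funM.
- move=> x _; rewrite -[(f * g) x]/(f x * g x) -[(_ + _) x]/(f x ^+ 2 + g x ^+ 2).
  by rewrite ler_norml; apply/andP; split; nra.
Qed.

Lemma sqi_intg f : sqi f -> intg f.
Proof.
move=> [mf If]; apply: (@le_intg _ ((fun x => f x ^+ 2) + cst 1)) => //.
- by move=> x _; rewrite !fctE /= ler_norml; apply/andP; split; nra.
- by apply: intgD => //; exact: intg_cst.
Qed.

Lemma sqi_bounded f (K : R) : meas f -> (forall x, x \in `[a, b] -> `|f x| <= K) -> sqi f.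
Proof.
move=> mf fK; split => //; apply: (@le_intg _ (cst (K ^+ 2))); last exact: intg_cst.
- exact: measurable_funX.
- by move=> x /fK fxK; rewrite ger0_norm ?sqr_ge0// -(real_normK (num_real (f x))) lerXn2r// ?nnegrE// (le_trans _ fxK).
Qed.

Lemma sqiMb f g (K : R) : meas f -> (forall x, x \in `[a, b] -> `|f x| <= K) -> sqi g -> sqi (f * g).
Proof.
move=> mf fK [mg Ig]; split; first exact: measurable_funM.
apply: (@le_intg _ (fun x => K ^+ 2 * g x ^+ 2)); last exact: intgZ.
- by apply: measurable_funX; exact: measurable_funM.
- move=> x /fK fxK; rewrite ger0_norm ?sqr_ge0// exprMn ler_wpM2r ?sqr_ge0//.
  by rewrite -(real_normK (num_real (f x))) lerXn2r// ?nnegrE// (le_trans _ fxK).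
Qed.

Lemma sqiZ c f : sqi f -> sqi (fun x => c * f x).
Proof. by apply: (@sqiMb (cst c) f `|c|); [exact: measurable_cst | ]. Qed.

Lemma sqiD f g : sqi f -> sqi g -> sqi (f + g).
Proof.
move=> sf sg; split; first by apply: measurable_funD; exact: sqi_meas.
have -> : (fun x => (f + g) x ^+ 2) = ((fun x => f x ^+ 2) + (fun x => 2 * (f * g) x)) + (fun x => g x ^+ 2).
  by apply: funext => x; rewrite !fctE; ring.
by apply: intgD; [apply: intgD; [exact: sf.2|apply: intgZ; exact: intgM]|exact: sg.2].
Qed.

Lemma sqiN f : sqi f -> sqi (- f).
Proof. by move=> /(sqiZ (-1)); congr sqi; apply: funext => x; rewrite mulN1r. Qed.

Lemma sqiB f g : sqi f -> sqi g -> sqi (f - g).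
Proof. by move=> sf sg; apply: sqiD => //; exact: sqiN. Qed.

Lemma continuous_sqi f : {within `[a, b], continuous f} -> sqi f.
Proof.
move=> cf; split; first by apply: intg_meas; exact: continuous_intg.
by apply: continuous_intg => x; apply: (@continuousM _ (subspace `[a, b])); exact: cf.
Qed.

Lemma IabD f g : intg f -> intg g -> Iab (f + g) = Iab f + Iab g.
Proof. by move=> If Ig; rewrite /Iab -RintegralD. Qed.

Lemma IabB f g : intg f -> intg g -> Iab (f - g) = Iab f - Iab g.
Proof. by move=> If Ig; rewrite /Iab -RintegralB. Qed.

Lemma IabZ c f : intg f -> Iab (fun x => c * f x) = c * Iab f.
Proof. by move=> If; rewrite /Iab RintegralZl. Qed.

Lemma IabN f : intg f -> Iab (- f) = - Iab f.
Proof.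
move=> If; rewrite -[RHS]mulN1r -IabZ//; congr Iab.
by apply: funext => x; rewrite mulN1r.
Qed.

Lemma eq_Iab f g : (forall x, x \in `[a, b] -> f x = g x) -> Iab f = Iab g.
Proof. by move=> fg; apply: eq_Rintegral => x; rewrite inE => /fg. Qed.

Lemma le_Iab f g : intg f -> intg g -> (forall x, x \in `[a, b] -> f x <= g x) -> Iab f <= Iab g.
Proof. by move=> If Ig fg; apply: le_Rintegral. Qed.

Lemma Iab_ge0 f : (forall x, x \in `[a, b] -> 0 <= f x) -> 0 <= Iab f.
Proof. by move=> f0; apply: Rintegral_ge0. Qed.

Lemma Iab_cst c : a <= b -> Iab (cst c) = c * (b - a).
Proof.
move=> ab; rewrite /Iab Rintegral_cst//= lebesgue_measure_itv /= lte_fin.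
by have [//|] := ltP a b; move=> ba; rewrite (_ : b - a = 0) //; apply/eqP; rewrite subr_eq0 eq_le ab ba.
Qed.

Definition ip f g := Iab (f * g).
Definition nn f := Num.sqrt (ip f f).

Lemma ipC f g : ip f g = ip g f. Proof. by rewrite /ip mulrC. Qed.

Lemma ipDl f g h : sqi f -> sqi g -> sqi h -> ip (f + g) h = ip f h + ip g h.
Proof. by move=> sf sg sh; rewrite /ip mulrDl IabD//; exact: intgM. Qed.

Lemma ipBl f g h : sqi f -> sqi g -> sqi h -> ip (f - g) h = ip f h - ip g h.
Proof. by move=> sf sg sh; rewrite /ip mulrBl IabB//; exact: intgM. Qed.

Lemma ipDr f g h : sqi f -> sqi g -> sqi h -> ip h (f + g) = ip h f + ip h g.
Proof. by move=> *; rewrite ipC ipDl// !(ipC h). Qed.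

Lemma ipBr f g h : sqi f -> sqi g -> sqi h -> ip h (f - g) = ip h f - ip h g.
Proof. by move=> *; rewrite ipC ipBl// !(ipC h). Qed.

Lemma ipZl c f g : sqi f -> sqi g -> ip (fun x => c * f x) g = c * ip f g.
Proof.
move=> sf sg; rewrite /ip -IabZ; last exact: intgM.
by congr Iab; apply: funext => x; rewrite !fctE mulrA.
Qed.

Lemma ipZr c f g : sqi f -> sqi g -> ip f (fun x => c * g x) = c * ip f g.
Proof. by move=> *; rewrite ipC ipZl// ipC. Qed.

Lemma ipNl f g : sqi f -> sqi g -> ip (- f) g = - ip f g.
Proof. by move=> sf sg; rewrite /ip mulNr IabN//; exact: intgM. Qed.

Lemma ipNr f g : sqi f -> sqi g -> ip f (- g) = - ip f g.
Proof. by move=> *; rewrite ipC ipNl// ipC. Qed.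

Lemma ip_ge0 f : 0 <= ip f f.
Proof. by apply: Iab_ge0 => x _; rewrite fctE -expr2 sqr_ge0. Qed.

Lemma nn_ge0 f : 0 <= nn f. Proof. exact: sqrtr_ge0. Qed.

Lemma nn_sqr f : nn f ^+ 2 = ip f f. Proof. by rewrite sqr_sqrtr// ip_ge0. Qed.

Lemma cauchy_schwarz f g : sqi f -> sqi g -> `|ip f g| <= nn f * nn g.
Proof.
move=> sf sg.
have H (t : R) : 0 <= ip f f - 2 * t * ip f g + t ^+ 2 * ip g g.
  have stg : sqi (fun x => t * g x) by exact: sqiZ.
  have := ip_ge0 (f - (fun x => t * g x)).
  rewrite ipBl ?ipBr//; last exact: sqiB.
  by rewrite !ipZl// !ipZr// (ipC g f); move/le_trans; apply; lra.
have gg := ip_ge0 g; have ff := ip_ge0 f.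
rewrite -(@ler_pXn2r _ 2)// ?nnegrE ?mulr_ge0 ?nn_ge0//.
rewrite exprMn !nn_sqr real_normK ?num_real//.
move: gg; rewrite le_eqVlt => /predU1P[g0|gg].
  rewrite -g0 mulr0; suff -> : ip f g = 0 by rewrite expr0n.
  apply/eqP/negPn/negP => fg0.
  (* With [ip g g = 0] the quadratic is affine in [t]; at this [t] it equals [-1]. *)
  have := H ((ip f f + 1) / (2 * ip f g)); rewrite -g0 mulr0 addr0.
  rewrite (_ : 2 * _ * _ = ip f f + 1); first by lra.
  by field.
have := H (ip f g / ip g g); move/(mulr_ge0 (ltW gg)).
rewrite (_ : ip g g * _ = ip f f * ip g g - ip f g ^+ 2); first by lra.
by field; rewrite gt_eqF.
Qed.

Lemma ip_le f g : sqi f -> sqi g -> ip f g <= nn f * nn g.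
Proof. by move=> sf sg; apply: le_trans (cauchy_schwarz sf sg); exact: ler_norm. Qed.

Lemma nnD f g : sqi f -> sqi g -> nn (f + g) <= nn f + nn g.
Proof.
move=> sf sg; rewrite -(@ler_pXn2r _ 2)// ?nnegrE ?addr_ge0 ?nn_ge0//.
rewrite sqrrD !nn_sqr ipDl ?ipDr//; last exact: sqiD.
by have := ip_le sf sg; rewrite (ipC g f); lra.
Qed.

Lemma nnZ c f : sqi f -> nn (fun x => c * f x) = `|c| * nn f.
Proof.
move=> sf; rewrite /nn ipZl//; last exact: sqiZ.
by rewrite ipZr// mulrA -expr2 sqrtrM ?sqr_ge0// sqrtr_sqr.
Qed.

Lemma nnN f : sqi f -> nn (- f) = nn f.
Proof. by move=> sf; rewrite /nn ipNl ?ipNr ?opprK//; exact: sqiN. Qed.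

Lemma nnB f g : sqi f -> sqi g -> nn (f - g) <= nn f + nn g.
Proof. by move=> sf sg; rewrite -(nnN sg); apply: nnD => //; exact: sqiN. Qed.

Lemma nnBC f g : nn (f - g) = nn (g - f).
Proof. by rewrite /nn /ip -(opprB g f) mulrNN. Qed.

Lemma nn_le_add f g : sqi f -> sqi g -> nn f <= nn g + nn (f - g).
Proof. by move=> sf sg; rewrite -{1}(subrK g f) addrC; apply: nnD => //; exact: sqiB. Qed.

Lemma nn_bounded f (K : R) : a <= b -> 0 <= K -> meas f ->
  (forall x, x \in `[a, b] -> `|f x| <= K) -> nn f <= K * Num.sqrt (b - a).
Proof.
move=> ab K0 mf fK; rewrite -(@ler_pXn2r _ 2)// ?nnegrE ?mulr_ge0 ?nn_ge0 ?sqrtr_ge0//.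
rewrite nn_sqr exprMn sqr_sqrtr ?subr_ge0// -Iab_cst//.
have sf := sqi_bounded mf fK.
apply: le_Iab; [exact: intgM|exact: intg_cst|].
move=> x /fK fxK; rewrite fctE -expr2 -(real_normK (num_real (f x))) /= lerXn2r// ?nnegrE//.
Qed.

Lemma nnMb f g (K : R) : 0 <= K -> meas f -> (forall x, x \in `[a, b] -> `|f x| <= K) -> sqi g ->
  nn (f * g) <= K * nn g.
Proof.
move=> K0 mf fK sg; have sfg := sqiMb mf fK sg.
rewrite -(@ler_pXn2r _ 2)// ?nnegrE ?mulr_ge0 ?nn_ge0//.
rewrite nn_sqr exprMn nn_sqr -IabZ; last exact: intgM.
apply: le_Iab; [exact: intgM|apply: intgZ; exact: intgM|].
move=> x /fK fxK; rewrite !fctE -!expr2 exprMn ler_wpM2r ?sqr_ge0//.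
by rewrite -(real_normK (num_real (f x))) lerXn2r// ?nnegrE.
Qed.

Lemma Iab_norm_le f : a <= b -> sqi f -> Iab (fun x => `|f x|) <= Num.sqrt (b - a) * nn f.
Proof.
move=> ab sf.
have snf : sqi (fun x => `|f x|).
  split; first by apply: measurableT_comp => //; exact: sqi_meas.
  by under eq_fun do rewrite real_normK ?num_real//; exact: sf.2.
have s1 : sqi (cst 1) by apply: (@sqi_bounded _ 1) => [|x _]; [exact: measurable_cst|rewrite normr1].
have := ip_le s1 snf.
have -> : ip (cst 1) (fun x => `|f x|) = Iab (fun x => `|f x|).
  by congr Iab; apply: funext => x; rewrite !fctE mul1r.
congr (_ <= _ * _).
  by rewrite /nn /ip (_ : cst 1 * cst 1 = cst 1) ?Iab_cst ?mul1r//; apply: funext => x; rewrite !fctE mul1r.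
rewrite /nn; congr (Num.sqrt (Iab _)); apply: funext => x; rewrite !fctE -!expr2 real_normK ?num_real//.
Qed.

Lemma norm_Iab f : intg f -> `|Iab f| <= Iab (fun x => `|f x|).
Proof. by move=> If; exact: le_normr_Rintegral. Qed.

Lemma intg_norm f : intg f -> intg (fun x => `|f x|).
Proof. by move=> If; have := integrable_norm If; exact. Qed.

Lemma meas_oo f : meas f -> measurable_fun `]a, b[ f.
Proof. by apply: measurable_funS => //; exact: subset_itv_oo_cc. Qed.

Lemma Iab_oo f : meas f -> \int[mu]_(x in `]a, b[) f x = Iab f.
Proof.
move=> mf; rewrite /Iab /Rintegral [in RHS]integral_itv_bndoo//.
by apply/measurable_EFinP; exact: meas_oo.
Qed.

Lemma ipE f g : ip f g = Iab (f * g). Proof. by []. Qed.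

End L2calc.

(** * Primitives *)

Section primitives.
Variables (R : realType) (a b : R).
Hypothesis ab : a < b.
Local Notation mu := (@lebesgue_measure R).
Implicit Types (f g h F G : R -> R) (c x y K : R).
Local Notation intg := (intg a b).
Local Notation Iab := (Iab a b).
Local Notation meas := (meas a b).

Definition prim (f : R -> R) (x : R) : R := \int[mu]_(y in `[a, x]) f y.

Lemma intgMb f g K : meas f -> (forall x, x \in `[a, b] -> `|f x| <= K) -> intg g -> intg (f * g).
Proof.
move=> mf fK Ig; apply: (@le_intg _ _ _ _ (fun x => K * `|g x|)).
- by apply: measurable_funM => //; exact: intg_meas Ig.
- by move=> x /fK fxK; rewrite fctE normrM ler_wpM2r.
- by apply: intgZ; exact: intg_norm.
Qed.

Lemma norm_Iab_bound f g K : meas f -> (forall x, x \in `[a, b] -> `|f x| <= K) -> intg g ->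
  `|Iab (f * g)| <= K * Iab (fun x => `|g x|).
Proof.
move=> mf fK Ig; apply: le_trans (norm_Iab _) _; first exact: intgMb fK Ig.
rewrite -IabZ; last exact: intg_norm.
apply: le_Iab; [apply: intg_norm; exact: intgMb fK Ig|apply: intgZ; exact: intg_norm|].
by move=> x /fK fxK; rewrite fctE normrM ler_wpM2r.
Qed.

Lemma intg_sub f x : intg f -> x <= b -> mu.-integrable `[a, x] (EFin \o f).
Proof. by move=> If xb; apply: integrableS If => //; apply: subset_itvl; rewrite bnd_simp. Qed.

Lemma primE_a f : prim f a = 0.
Proof. by rewrite /prim set_itv1 Rintegral_set1. Qed.

Lemma primE_b f : prim f b = Iab f. Proof. by []. Qed.

Lemma prim_continuous f : intg f -> {within `[a, b], continuous (prim f)}.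
Proof. by move=> If; apply: parameterized_integral_continuous => //; exact: ltW. Qed.

Lemma primD f g x : intg f -> intg g -> x <= b -> prim (f + g) x = prim f x + prim g x.
Proof. by move=> If Ig xb; rewrite /prim -RintegralD//; exact: intg_sub. Qed.

Lemma primB f g x : intg f -> intg g -> x <= b -> prim (f - g) x = prim f x - prim g x.
Proof. by move=> If Ig xb; rewrite /prim -RintegralB//; exact: intg_sub. Qed.

Lemma primZ c f x : intg f -> x <= b -> prim (fun y => c * f y) x = c * prim f x.
Proof. by move=> If xb; rewrite /prim RintegralZl//; exact: intg_sub. Qed.

Lemma prim_norm f x : intg f -> x <= b -> `|prim f x| <= Iab (fun y => `|f y|).
Proof.
move=> If xb; apply: le_trans (le_normr_Rintegral _ (intg_sub If xb)) _ => //.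
apply: fine_le.
- apply: integrable_fin_num => //; have := intg_sub (intg_norm If) xb; exact.
- by apply: integrable_fin_num => //; have := intg_norm If; exact.
- apply: ge0_subset_integral => //; first by apply/measurable_EFinP; apply: measurableT_comp => //; exact: intg_meas If.
  by apply: subset_itvl; rewrite bnd_simp.
Qed.

Lemma prim_diff f x y : intg f -> a <= x -> x <= y -> y <= b ->
  prim f y - prim f x = \int[mu]_(z in `]x, y]) f z.
Proof. by move=> If ax xy yb; rewrite /prim Rintegral_itvB//=; [exact: intg_sub|rewrite bnd_simp..]. Qed.

Lemma prim_is_derive f x : intg f -> x \in `]a, b[ -> {for x, continuous f} ->
  is_derive x 1 (prim f) (f x).
Proof.
move=> If; rewrite in_itv => /andP[ax xb] cf.
have [] := @continuous_FTC1_closed R f a x b xb If ax cf.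
by move=> d1 d2; apply: DeriveDef; rewrite -?derive1E.
Qed.

Lemma within_continuous_in f x : {within `[a, b], continuous f} -> x \in `]a, b[ -> {for x, continuous f}.
Proof.
move=> cf xab.
have : {within `]a, b[, continuous f} by apply: continuous_subspaceW cf; exact: subset_itv_oo_cc.
by rewrite continuous_open_subspace//; apply; rewrite inE.
Qed.

Lemma LRcont f : {within `[a, b], continuous f} -> (forall x, x \in `]a, b[ -> derivable f x 1) ->
  derivable_oo_LRcontinuous f a b.
Proof. by move=> /(continuous_within_itvP _ ab)[? ? ?] df; split. Qed.

Lemma FTC2_prim (f F : R -> R) : {within `[a, b], continuous f} -> {within `[a, b], continuous F} ->
  (forall x, x \in `]a, b[ -> is_derive x 1 F (f x)) ->
  Iab f = F b - F a.
Proof.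
move=> cf cF dF; rewrite /Iab /Rintegral (@continuous_FTC2 R f F a b)//.
- by apply: LRcont => // x /dF[].
- by move=> x /dF dFx; rewrite derive1E derive_val.
Qed.

Lemma ibp_continuous f g : {within `[a, b], continuous f} -> {within `[a, b], continuous g} ->
  Iab (prim f * g) = Iab f * Iab g - Iab (f * prim g).
Proof.
move=> cf cg.
have dp h : {within `[a, b], continuous h} -> forall x, x \in `]a, b[ -> is_derive x 1 (prim h) (h x).
  by move=> ch x xab; apply: prim_is_derive => //; [exact: continuous_intg|exact: within_continuous_in].
have H h : {within `[a, b], continuous h} -> derivable_oo_LRcontinuous (prim h) a b /\ {in `]a, b[, derive1 (prim h) =1 h}.
  move=> ch; split; last by move=> x xab; have [_ <-] := dp _ ch x xab; rewrite derive1E.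
  apply: LRcont; first by apply: prim_continuous; exact: continuous_intg.
  by move=> x /(dp _ ch)[].
have := @Rintegration_by_parts R (prim f) (prim g) f g a b ab cf (H f cf).1 (H f cf).2 cg (H g cg).1 (H g cg).2.
by rewrite !primE_a mul0r subr0 !primE_b.
Qed.

Lemma L1_continuous_approx f (e : R) : intg f -> 0 < e ->
  exists2 g, continuous g & Iab (fun x => `|f x - g x|) <= e.
Proof.
move=> If e0.
have mfin : (mu `[a, b] < +oo)%E by rewrite lebesgue_measure_itv/= lte_fin ab -EFinD ltry.
have [g_ [cg Ig]] := @approximation_continuous_integrable R `[a, b] f (measurable_itv _) mfin If.
move=> /fine_cvgP[_ /cvgrPdist_le /(_ e e0)] [n _ /(_ n (leqnn n))] /=.
rewrite sub0r normrN => H; exists (g_ n) => //.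
by apply: le_trans H; exact: ler_norm.
Qed.

(** The defect [X] of the formula is bilinear and bounded by three times the product of the L1
    norms, and it vanishes on continuous functions, which are dense in L1. *)
Lemma ibp_L1 f g : intg f -> intg g ->
  Iab (prim f * g) = Iab f * Iab g - Iab (f * prim g).
Proof.
pose X f g := Iab (prim f * g) - Iab f * Iab g + Iab (f * prim g).
have mp h : intg h -> meas (prim h) by move=> Ih; apply: intg_meas; apply: continuous_intg; exact: prim_continuous.
have pn h : intg h -> forall x, x \in `[a, b] -> `|prim h x| <= Iab (fun y => `|h y|).
  by move=> Ih x; rewrite in_itv => /andP[_ xb]; exact: prim_norm.
have ipm h k : intg h -> intg k -> intg (prim h * k).
  by move=> Ih Ik; apply: intgMb (pn _ Ih) Ik; exact: mp.
have imp h k : intg h -> intg k -> intg (h * prim k) by move=> Ih Ik; rewrite mulrC; exact: ipm.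
have XBl h k l : intg h -> intg k -> intg l -> X (h - k) l = X h l - X k l.
  move=> Ih Ik Il; rewrite /X (_ : Iab (prim (h - k) * l) = Iab (prim h * l) - Iab (prim k * l)); last first.
    rewrite -IabB; [|exact: ipm..].
    by apply: eq_Iab => x; rewrite in_itv => /andP[_ xb]; rewrite !fctE primB// mulrBl.
  rewrite mulrBl IabB// IabB; [|exact: imp..].
  by move: (Iab (prim h * l)) (Iab (prim k * l)) (Iab h) (Iab (h * prim l)) => *; ring.
have XBr h k l : intg h -> intg k -> intg l -> X l (h - k) = X l h - X l k.
  move=> Ih Ik Il; rewrite /X (_ : Iab (l * prim (h - k)) = Iab (l * prim h) - Iab (l * prim k)); last first.
    rewrite -IabB; [|exact: imp..].
    by apply: eq_Iab => x; rewrite in_itv => /andP[_ xb]; rewrite !fctE primB// mulrBr.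
  rewrite mulrBr IabB// IabB; [|exact: ipm..].
  by move: (Iab (l * prim h)) (Iab (l * prim k)) (Iab h) (Iab (prim l * h)) => *; ring.
have Xle h k : intg h -> intg k -> `|X h k| <= 3 * (Iab (fun x => `|h x|) * Iab (fun x => `|k x|)).
  move=> Ih Ik; rewrite /X.
  have H1 := norm_Iab_bound (mp _ Ih) (pn _ Ih) Ik.
  have H2 := norm_Iab_bound (mp _ Ik) (pn _ Ik) Ih.
  have H3 : `|Iab h * Iab k| <= Iab (fun x => `|h x|) * Iab (fun x => `|k x|).
    by rewrite normrM ler_pM//; exact: norm_Iab.
  rewrite (mulrC h); apply: le_trans (ler_normD _ _) _.
  have := ler_normB (Iab (prim h * k)) (Iab h * Iab k).
  by lra.
move=> If Ig; suff : X f g = 0 by rewrite /X; lra.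
apply/eqP; rewrite -normr_le0; apply/ler_addgt0Pl => e e0; rewrite addr0.
pose A := Iab (fun x => `|f x|); pose B := Iab (fun x => `|g x|).
have A0 : 0 <= A by apply: Iab_ge0 => x _.
have B0 : 0 <= B by apply: Iab_ge0 => x _.
(* Replacing [f], then [g], by approximants costs at most [3 d B + 3 (A + 1) d]; the condition
   [d <= 1] bounds the norm of [f'] by [A + 1]. *)
have d0 : 0 < Num.min 1 (e / (3 * (A + B + 1))).
  by rewrite lt_min ltr01/= divr_gt0// mulr_gt0// ltr_wpDl// addr_ge0.
have [f' cf' f'e] := L1_continuous_approx If d0.
have [g' cg' g'e] := L1_continuous_approx Ig d0.
have wf' : {within `[a, b], continuous f'} by apply: continuous_subspaceT.
have wg' : {within `[a, b], continuous g'} by apply: continuous_subspaceT.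
have If' := continuous_intg wf'; have Ig' := continuous_intg wg'.
have X0 : X f' g' = 0 by rewrite /X ibp_continuous//; ring.
have -> : X f g = X (f - f') g + X f' (g - g') by rewrite XBl// XBr// X0; ring.
set d := Num.min _ _ in d0 f'e g'e.
have Af : Iab (fun x => `|f' x|) <= A + d.
  apply: (@le_trans _ _ (Iab ((fun x => `|f x|) + (fun x => `|f x - f' x|)))).
    apply: le_Iab; [exact: intg_norm| |].
      by apply: intgD; apply: intg_norm => //; exact: intgB.
    by move=> x _; rewrite fctE; have := ler_normB (f x) (f x - f' x); rewrite subKr.
  rewrite IabD; [by rewrite lerD2l|exact: intg_norm|by apply: intg_norm; exact: intgB].
have H1 := Xle (f - f') g (intgB If If') Ig.
have H2 := Xle f' (g - g') If' (intgB Ig Ig').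
apply: le_trans (ler_normD _ _) _.
have d1 : d <= 1 by rewrite /d ge_min lexx.
have de : d * (3 * (A + B + 1)) <= e.
  by rewrite -ler_pdivlMr ?mulr_gt0// ?ltr_wpDl// ?addr_ge0// /d ge_min lexx orbT.
apply: le_trans (lerD H1 H2) _; apply: le_trans de.
have E1 : Iab (fun x => `|(f - f') x|) * B <= d * B by rewrite ler_wpM2r.
have E2 : Iab (fun x => `|f' x|) * Iab (fun x => `|(g - g') x|) <= (A + 1) * d.
  by apply: ler_pM => //; [apply: Iab_ge0|apply: Iab_ge0|apply: le_trans Af _; rewrite lerD2l].
by rewrite -/B; lra.
Qed.

End primitives.

(** * Smooth functions of compact support *)

Section flat.
Variable R : realType.
Implicit Types (x y : R) (P : {poly R}).

(** Functions [P(1/x) exp(-1/x)] form a family closed under derivation, which changes [P] into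
    [X^2 (P - P')]. The case [P = 1] is the usual germ of a bump function. *)
Definition flat (P : {poly R}) (x : R) : R := if 0 < x then P.[x^-1] * expR (- x^-1) else 0.

Lemma horner_le_pow P : exists2 Kn : R * nat, 0 <= Kn.1 & forall y, 1 <= y -> `|P.[y]| <= Kn.1 * y ^+ Kn.2.
Proof.
elim/poly_ind: P => [|P c [[K n] /= K0 H]].
  by exists (0, 0%N) => //= y _; rewrite horner0 normr0 mul0r.
exists (K + `|c|, n.+1) => /=; first by rewrite addr_ge0.
move=> y y1; rewrite hornerMXaddC; apply: le_trans (ler_normD _ _) _.
have y0 : 0 <= y by apply: le_trans y1.
rewrite mulrDl normrM (ger0_norm y0) lerD//.
  by rewrite exprSr mulrA ler_wpM2r// H.
by rewrite ler_peMr// exprn_ege1.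
Qed.

(** With [y = 1/x], the exponential series beats the growth [y^n] of [P] with two powers to spare.
    The quadratic bound yields the zero derivative at the origin. *)
Lemma flat_small P : exists2 K : R, 0 <= K & forall x, `|x| <= 1 -> `|flat P x| <= K * x ^+ 2.
Proof.
have [[K n] /= K0 H] := horner_le_pow P.
exists (K * (n.+2)`!%:R); first by rewrite mulr_ge0.
move=> x x1; rewrite /flat; case: ifPn => [x0|_]; last by rewrite normr0 mulr_ge0 ?sqr_ge0// mulr_ge0.
rewrite normrM (ger0_norm (expR_ge0 _)) expRN.
have y1 : 1 <= x^-1 by rewrite invf_ge1//; rewrite (gtr0_norm x0) in x1.
have y0 : 0 < x^-1 by rewrite invr_gt0.
set y := x^-1 in y1 y0 *.
have -> : x = y^-1 by rewrite /y invrK.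
have E : y ^+ n.+2 / (n.+2)`!%:R <= expR y.
  by apply: le_trans (expR_ge1Dxn n.+1 (ltW y0)); rewrite lerDr.
rewrite ler_pdivrMr ?expR_gt0//; apply: le_trans (H _ y1) _.
rewrite [leRHS](_ : _ = K * ((n.+2)`!%:R * (y^-1 ^+ 2 * expR y))); last by rewrite !mulrA.
rewrite ler_wpM2l//.
apply: le_trans (_ : (n.+2)`!%:R * (y^-1 ^+ 2 * (y ^+ n.+2 / (n.+2)`!%:R)) <= _).
  rewrite le_eqVlt; apply/orP; left; apply/eqP.
  rewrite !exprS exprVn; field.
  by rewrite pnatr_eq0 -lt0n fact_gt0 gt_eqF.
by rewrite ler_wpM2l// ler_wpM2l// exprn_ge0// invr_ge0 ltW.
Qed.

Definition flat_der P : {poly R} := 'X^2 * (P - P^`()).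

Lemma is_derive_flat P x : is_derive x 1 (flat P) (flat (flat_der P) x).
Proof.
have [x0|x0|->] := ltgtP x 0.
- rewrite {2}/flat ltNge (ltW x0)/=.
  apply: (@near_eq_is_derive R R R (cst 0)).
  by near=> z; rewrite /flat ltNge (ltW _)//; near: z; exact: lt_nbhsl.
- rewrite {2}/flat x0.
  apply: (@near_eq_is_derive R R R (fun z => P.[z^-1] * expR (- z^-1))).
    by near=> z; rewrite /flat ifT//; near: z; exact: lt_nbhsr.
  have xn : x != 0 by rewrite gt_eqF.
  have dV : is_derive x 1 (fun z : R => z^-1) (- x ^- 2).
    by have := @is_deriveV R id x 1 1 xn _; rewrite scaler1; apply.
  have dP : is_derive x 1 (fun z => P.[z^-1]) ((P^`()).[x^-1] * (- x ^- 2)).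
    exact: (@is_derive1_comp R (horner P) (fun z => z^-1) x _ _ (is_derive_poly P x^-1) dV).
  have dE : is_derive x 1 (fun z => expR (- z^-1)) (expR (- x^-1) * (- (- x ^- 2))).
    exact: (@is_derive1_comp R expR (fun z => - z^-1) x _ _ (is_derive_expR _) (is_deriveN dV)).
  apply: is_derive_eq.
  rewrite /flat_der hornerM hornerD hornerN hornerXn /GRing.scale /=.
  by move: (expR _) P.[_] (P^`()).[_] => E p p'; field.
- have [K K0 H] := flat_small P.
  rewrite {2}/flat ltxx.
  have f0 : flat P 0 = 0 by rewrite /flat ltxx.
  suff L : (fun h : R => h^-1 *: ((flat P \o shift 0) (h *: 1) - flat P 0)) @ 0^' --> (0 : R).
    by apply: DeriveDef; [exact: cvgP L|exact: cvg_lim L].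
  apply/cvgrPdist_le => e e0; near=> h.
  rewrite f0 subr0 /= addr0 scaler1 sub0r normrN normrM.
  have h0 : h != 0 by near: h; exact: nbhs_dnbhs_neq.
  have h1 : `|h| <= 1 by near: h; apply: dnbhs0_le.
  have h2 : `|h| <= e / (K + 1) by near: h; apply: dnbhs0_le; rewrite divr_gt0// ltr_wpDl.
  rewrite normfV ler_pdivrMl ?normr_gt0//.
  apply: le_trans (H _ h1) _.
  rewrite -(real_normK (num_real h)) expr2 mulrA mulrC ler_wpM2l//.
  move: h2; rewrite ler_pdivlMr ?ltr_wpDl//; apply: le_trans.
  by rewrite mulrC ler_wpM2l// lerDl.
Unshelve. all: by end_near. Qed.

End flat.

Section smooth_generated.
Variable R : realType.
Implicit Types (f g : R -> R) (x : R).

(* Closed under derivation by construction, so that smoothness needs no iterated-derivative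
   computation; bump functions belong to it through [flat]. *)
Inductive smooth_gen : (R -> R) -> Prop :=
| sg_cst c : smooth_gen (cst c)
| sg_flat P s t : smooth_gen (fun x => flat P (s * x + t))
| sg_add f g : smooth_gen f -> smooth_gen g -> smooth_gen (f + g)
| sg_mul f g : smooth_gen f -> smooth_gen g -> smooth_gen (f * g)
| sg_prim f g : smooth_gen f -> (forall x, is_derive x 1 g (f x)) -> smooth_gen g.

Lemma is_derive_continuous (f : R -> R) (x l : R) : is_derive x 1 f l -> {for x, continuous f}.
Proof. by case=> d _; apply: differentiable_continuous; exact/derivable1_diffP. Qed.

Lemma is_derive_affine (s t x : R) : is_derive x 1 (fun z : R => s * z + t) s.
Proof.
have H : is_derive x 1 (s *: (id : R -> R) + cst t) (s *: 1 + 0).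
  exact: is_deriveD.
by move: H; rewrite addr0 /GRing.scale /= mulr1.
Qed.

Lemma smooth_gen_derive f : smooth_gen f ->
  exists2 f', smooth_gen f' & forall x, is_derive x 1 f (f' x).
Proof.
elim => {f} [c|P s t|f g _ [f' Sf' df] _ [g' Sg' dg]|f g Sf [f' Sf' df] Sg [g' Sg' dg]|f g Sf _ dg].
- by exists (cst 0); [exact: sg_cst|move=> x; exact: is_derive_cst].
- exists (cst s * (fun x => flat (flat_der P) (s * x + t))).
    by apply: sg_mul; [exact: sg_cst|exact: sg_flat].
  move=> x; rewrite fctE mulrC.
  exact: (@is_derive1_comp R (flat P) (fun z => s * z + t) x _ _ (is_derive_flat P _) (is_derive_affine s t x)).
- by exists (f' + g'); [exact: sg_add|move=> x; exact: is_deriveD].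
- exists (f * g' + g * f'); first by apply: sg_add; exact: sg_mul.
  by move=> x; exact: is_deriveM.
- by exists f.
Qed.

Lemma smooth_gen_smooth f : smooth_gen f -> smooth f.
Proof.
move=> + n; elim: n f => [|n IH] f Sf x.
  by have [f' _ /(_ x)[]] := smooth_gen_derive Sf.
have [f' Sf' df] := smooth_gen_derive Sf.
rewrite derive1Sn (_ : derive1 f = f'); first exact: IH.
by apply: funext => y; have [_ <-] := df y; rewrite derive1E.
Qed.

Lemma smooth_gen_continuous f : smooth_gen f -> continuous f.
Proof.
move=> /smooth_gen_derive[f' _ df] x.
exact: is_derive_continuous (df x).
Qed.

Lemma smooth_gen_comp_shift (c : R) f : smooth_gen f -> smooth_gen (fun x => f (x - c)).
Proof.
elim => {f} [k|P s t|f g _ Sf _ Sg|f g _ Sf _ Sg|f g _ Sf dg].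
- exact: sg_cst.
- rewrite (_ : (fun x => _) = fun x => flat P (s * x + (t - s * c))); first exact: sg_flat.
  by apply: funext => x; congr flat; ring.
- exact: sg_add Sf Sg.
- exact: sg_mul Sf Sg.
- apply: sg_prim Sf _ => x.
  have H := @is_derive1_comp R g (fun z => 1 * z + (- c)) x _ _ (dg _) (is_derive_affine 1 (- c) x).
  move: H; rewrite mulr1 mul1r; congr is_derive.
  by apply: funext => z /=; rewrite mul1r.
Qed.

(* tends to the indicator function of `]0, l[` as [n] grows *)
Definition bump (n : nat) (l x : R) : R :=
  flat 1 (n%:R * x + (- 1)) * flat 1 (- n%:R * x + (n%:R * l - 1)).

Lemma smooth_gen_bump n l : smooth_gen (bump n l).
Proof. by apply: sg_mul; exact: sg_flat. Qed.

Lemma flat1_ge0 x : 0 <= flat 1 x.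
Proof. by rewrite /flat; case: ifP => // _; rewrite hornerC mul1r expR_ge0. Qed.

Lemma flat1_le1 x : flat 1 x <= 1.
Proof.
rewrite /flat; case: ifP => // x0; rewrite hornerC mul1r expR_le1 oppr_le0 invr_ge0.
exact: ltW.
Qed.

Lemma bump_ge0 n l x : 0 <= bump n l x.
Proof. by rewrite mulr_ge0// flat1_ge0. Qed.

Lemma bump_le1 n l x : bump n l x <= 1.
Proof. by rewrite mulr_ile1 ?flat1_ge0 ?flat1_le1. Qed.

Lemma bump_eq0l n l x : n%:R * x <= 1 -> bump n l x = 0.
Proof. by move=> nx; rewrite /bump {1}/flat ltNge (_ : _ <= 0) ?mul0r// subr_le0. Qed.

Lemma bump_eq0r n l x : n%:R * (l - x) <= 1 -> bump n l x = 0.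
Proof. by move=> nx; rewrite /bump {2}/flat ltNge (_ : _ <= 0) ?mulr0//; lra. Qed.

Lemma flat1_cvg (y : R) : 0 < y -> (fun n : nat => flat 1 (n%:R * y - 1)) @ \oo --> (1 : R).
Proof.
move=> y0.
have H : (fun n : nat => expR (- (n%:R * y - 1)^-1)) @ \oo --> (1 : R).
  rewrite -[X in _ --> X]expR0; apply: continuous_cvg; first exact: continuous_expR.
  rewrite -[X in _ --> X]oppr0; apply: cvgN; apply/gtr0_cvgV0.
    near=> n; rewrite subr_gt0 -ltr_pdivrMr// mul1r.
    by near: n; exact: nbhs_infty_gtr.
  apply/cvgryPge => A; near=> n; rewrite lerBrDr -ler_pdivrMr//.
  by near: n; exact: nbhs_infty_ger.
apply: cvg_trans H; apply: near_eq_cvg; near=> n.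
rewrite /flat ifT ?hornerC ?mul1r// subr_gt0 -ltr_pdivrMr// mul1r.
by near: n; exact: nbhs_infty_gtr.
Unshelve. all: by end_near. Qed.

Lemma bump_cvg l x : 0 < x < l -> (fun n => bump n l x) @ \oo --> (1 : R).
Proof.
move=> /andP[x0 xl]; rewrite -[X in _ --> X]mulr1; apply: cvgM; first exact: flat1_cvg.
rewrite (_ : (fun n => _) = fun n : nat => flat 1 (n%:R * (l - x) - 1)).
  by apply: flat1_cvg => //; rewrite subr_gt0.
by apply: funext => n; congr flat; ring.
Qed.

(** The base point only has to lie to the left of the support; [-1] keeps [0] in the interior of the
    interval of integration, where the fundamental theorem applies. *)
Definition cumbump n l := @prim R (-1) (bump n l).

Lemma cumbump0 n l x : n%:R * x <= 1 -> cumbump n l x = 0.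
Proof.
move=> x0; rewrite /cumbump /prim (@eq_Rintegral _ _ _ _ _ (cst 0)).
  by rewrite Rintegral_cst// mul0r.
move=> y; rewrite inE/= in_itv/= => /andP[_ yx]; apply: bump_eq0l.
by apply: le_trans x0; rewrite ler_wpM2l.
Qed.

Lemma is_derive_cumbump n l x : is_derive x 1 (cumbump n l) (bump n l x).
Proof.
have [x0|x0] := ltP x 0.
  rewrite bump_eq0l; last by apply: le_trans ler01; rewrite mulr_ge0_le0// ltW.
  apply: (@near_eq_is_derive R R R (cst 0)).
  by near=> z; rewrite cumbump0// (le_trans _ ler01)// mulr_ge0_le0// ltW//; near: z; exact: lt_nbhsl.
apply: (@prim_is_derive R (-1) (x + 1)).
- by apply: continuous_intg; apply: continuous_subspaceT; exact: smooth_gen_continuous (smooth_gen_bump n l).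
- by rewrite in_itv/=; apply/andP; split; lra.
- exact: smooth_gen_continuous (smooth_gen_bump n l) x.
Unshelve. all: by end_near. Qed.

Lemma cumbump_cst n l x : l - n%:R^-1 <= x -> cumbump n l x = cumbump n l l.
Proof.
have H y z : l - n%:R^-1 <= y -> y <= z -> cumbump n l z = cumbump n l y.
  move=> ly yz.
  have [//||c cyz E] := @MVT_segment R (cumbump n l) (bump n l) y z yz.
  - by move=> w _; exact: is_derive_cumbump.
  - apply: continuous_subspaceT => w.
    exact: is_derive_continuous (is_derive_cumbump n l w).
  - apply/eqP; rewrite -subr_eq0 E bump_eq0r ?mul0r//.
    (* [0^-1] is [0], so [n = 0] is not excluded; the condition of [bump_eq0r] then reads
       [0 <= 1]. *)
    have [->|n0] := eqVneq n 0%N; first by rewrite mul0r ler01.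
    rewrite -ler_pdivlMl ?ltr0n ?lt0n// mulr1 lerBlDr -lerBlDl (le_trans ly)//.
    by move: cyz; rewrite in_itv => /andP[].
have n1 : l - n%:R^-1 <= l by rewrite gerBl invr_ge0.
by move=> lx; have [xl|/ltW xl] := leP l x; [exact: H|exact/esym/H].
Qed.

End smooth_generated.

(** * Approximation of zero-mean functions by derivatives of test functions *)

Section density.
Variables (R : realType) (a b : R).
Hypothesis ab : a < b.
Local Notation mu := (@lebesgue_measure R).
Implicit Types (f g phi psi : R -> R) (c l e x y : R).
Local Notation sqi := (sqi a b).
Local Notation Iab := (Iab a b).
Local Notation meas := (meas a b).
Local Notation nn := (nn a b).

(** Hypotheses about all test functions are applied to these only. Their derivatives are again of
    this kind, and they are rich enough for the density argument. *)
Definition test_gen psi := smooth_gen psi /\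
  exists c d : R, [/\ a < c, c <= d, d < b & forall x, x < c \/ d < x -> psi x = 0].

Lemma test_gen_fn psi : test_gen psi -> test_fn a b psi.
Proof. by case=> /smooth_gen_smooth ? ?; split. Qed.

Lemma smooth_gen_is_derive psi x : smooth_gen psi -> is_derive x 1 psi (derive1 psi x).
Proof. by move=> /smooth_gen_derive[f' _ /(_ x)[df _]]; rewrite derive1E; exact: derivableP. Qed.

Lemma smooth_gen_derive1 psi : smooth_gen psi -> smooth_gen (derive1 psi).
Proof.
move=> /smooth_gen_derive[f' Sf' df]; rewrite (_ : derive1 psi = f')//.
by apply: funext => y; have [_ <-] := df y; rewrite derive1E.
Qed.

Lemma smooth_gen_sqi psi : smooth_gen psi -> sqi psi.
Proof. by move=> S; apply: continuous_sqi; apply: continuous_subspaceT; exact: smooth_gen_continuous. Qed.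

Lemma test_gen_sqi psi : test_gen psi -> sqi (derive1 psi).
Proof. by move=> T; apply: smooth_gen_sqi; apply: smooth_gen_derive1; exact: T.1. Qed.

Lemma test_genD psi1 psi2 : test_gen psi1 -> test_gen psi2 -> test_gen (psi1 + psi2).
Proof.
move=> [S1 [c [d [ac cd db H]]]] [S2 [c' [d' [ac' cd' db' H']]]]; split; first exact: sg_add.
exists (Num.min c c'), (Num.max d d'); split.
- by rewrite lt_min ac ac'.
- by rewrite ge_min !le_max cd.
- by rewrite gt_max db db'.
- by move=> x; rewrite lt_min gt_max => xcd; rewrite fctE H ?H' ?addr0//; case: xcd => /andP[]; tauto.
Qed.

Lemma test_genZ c psi : test_gen psi -> test_gen (cst c * psi).
Proof.
move=> [S1 [c1 [d1 [ac cd db H]]]]; split; first by apply: sg_mul => //; exact: sg_cst.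
by exists c1, d1; split => // x /H; rewrite fctE => ->; rewrite mulr0.
Qed.

(* Equations tested against derivatives of test functions extend to this L2-closure, which
   contains every [bar g]. *)
Definition dtest phi := sqi phi /\
  forall e, 0 < e -> exists2 psi, test_gen psi & nn (derive1 psi - phi) <= e.

Lemma dtestD phi1 phi2 : dtest phi1 -> dtest phi2 -> dtest (phi1 + phi2).
Proof.
move=> [s1 H1] [s2 H2]; split; first exact: sqiD.
move=> e e0; have e2 : 0 < e / 2 by rewrite divr_gt0.
have [p1 T1 n1] := H1 _ e2; have [p2 T2 n2] := H2 _ e2.
exists (p1 + p2); first exact: test_genD.
have -> : derive1 (p1 + p2) = derive1 p1 + derive1 p2.
  apply: funext => x; rewrite derive1E.
  have [_ ->] := is_deriveD (smooth_gen_is_derive x T1.1) (smooth_gen_is_derive x T2.1).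
  by [].
rewrite opprD addrACA; apply: le_trans (nnD _ _) _.
- by apply: sqiB => //; exact: test_gen_sqi T1.
- by apply: sqiB => //; exact: test_gen_sqi T2.
- by lra.
Qed.

Lemma dtestZ c phi : dtest phi -> dtest (cst c * phi).
Proof.
move=> [s1 H1]; split; first exact: sqiZ.
move=> e e0; have e2 : 0 < e / (`|c| + 1) by rewrite divr_gt0// ltr_wpDl.
have [p1 T1 n1] := H1 _ e2; exists (cst c * p1); first exact: test_genZ.
have -> : derive1 (cst c * p1) = cst c * derive1 p1.
  apply: funext => x; rewrite derive1E.
  have [_ ->] := is_deriveM (is_derive_cst c x 1) (smooth_gen_is_derive x T1.1).
  by rewrite scaler0 addr0.
have s : sqi (derive1 p1 - phi).
  by apply: sqiB => //; exact: test_gen_sqi T1.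
rewrite -mulrBr (nnZ c s); move: n1; rewrite ler_pdivlMr ?ltr_wpDl// mulrC; apply: le_trans.
by rewrite ler_wpM2r ?nn_ge0// lerDl.
Qed.

Lemma Iab0E : Iab 0 = \int[mu]_(x in `[a, b]) (cst 0 x). Proof. by []. Qed.

Lemma dtest0 : dtest 0.
Proof.
have s0 : sqi 0 by apply: (@sqi_bounded _ _ _ _ 0) => [|x _]; [exact: measurable_cst|rewrite normr0].
split => // e e0; exists (cst 0).
  split; first exact: sg_cst.
  exists ((a + b) / 2), ((a + b) / 2); split => //.
  - exact: (midf_lt ab).1.
  - exact: (midf_lt ab).2.
rewrite subr0 (_ : derive1 _ = cst 0); last by apply: funext => x; rewrite derive1_cst.
by rewrite (_ : nn _ = 0) ?ltW// /nn /ip mulr0 Iab0E Rintegral_cst// mul0r sqrtr0.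
Qed.

Lemma dtest_sum (m : nat) (c : nat -> R) (F : nat -> R -> R) : (forall i, (i < m)%N -> dtest (F i)) ->
  dtest (fun x => \sum_(0 <= i < m) c i * F i x).
Proof.
elim: m => [_|m IH H].
  by under eq_fun do rewrite big_nil; exact: dtest0.
under eq_fun do rewrite big_nat_recr//=.
apply: (dtestD (phi1 := fun x => \sum_(0 <= i < m) c i * F i x) (phi2 := cst (c m) * F m)).
  by apply: IH => i im; apply: H; rewrite ltnW.
by apply: dtestZ; exact: H.
Qed.

Lemma dtest_lim phi : sqi phi ->
  (forall e, 0 < e -> exists2 phi', dtest phi' & nn (phi' - phi) <= e) -> dtest phi.
Proof.
move=> s H; split => // e e0; have e2 : 0 < e / 2 by rewrite divr_gt0.
have [phi' [s' H'] n'] := H _ e2; have [psi T npsi] := H' _ e2.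
exists psi => //; rewrite -(subrK phi' (derive1 psi)) -addrA; apply: le_trans (nnD _ _) _.
- by apply: sqiB => //; exact: test_gen_sqi T.
- exact: sqiB.
- by lra.
Qed.

(** Half-open, so that consecutive cells of equal length tile [[a, b[] and each point lies in
    exactly one of them. *)
Definition cell c l : R -> R := \1_(`[c, c + l[).

Lemma cell_meas c l : meas (cell c l).
Proof. by apply: (@measurable_funS _ _ _ _ setT) => //; exact: measurable_indic. Qed.

Lemma cell_norm c l x : `|cell c l x| <= 1.
Proof. by rewrite /cell indicE; case: (_ \in _); rewrite ?normr1 ?normr0. Qed.

Lemma cell_sqi c l : sqi (cell c l).
Proof. by apply: (@sqi_bounded _ _ _ _ 1) => [|x _]; [exact: cell_meas|exact: cell_norm]. Qed.

Lemma bump_shift_sg n c l : smooth_gen (fun x => bump n l (x - c)).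
Proof. by apply: smooth_gen_comp_shift; exact: smooth_gen_bump. Qed.

Lemma bump_L2 c l e : 0 < l -> 0 < e -> \forall n \near \oo, nn ((fun x => bump n l (x - c)) - cell c l) <= e.
Proof.
move=> l0 e0.
pose F n (x : R) : \bar R := ((bump n l (x - c) - cell c l x) ^+ 2)%:E.
have sF n : sqi ((fun x => bump n l (x - c)) - cell c l).
  by apply: sqiB; [apply: smooth_gen_sqi; exact: bump_shift_sg|exact: cell_sqi].
have [] := @dominated_convergence _ _ R mu `[a, b] (measurable_itv _) F (cst 0%E) (cst 1%:E).
- by move=> n; apply/measurable_EFinP; apply: measurable_funX; exact: (sF n).1.
- exact: measurable_cst.
(* At the left endpoint [c] the cell is 1 while every bump is 0; everywhere else the bumps converge
   to the cell. *)
- exists [set c]; split; [exact: measurable_set1|exact: lebesgue_measure_set1|].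
  move=> x /=; apply: contra_notP => /eqP xc _; rewrite /F.
  apply: cvg_EFin; first exact: nearW.
  have [xlc|cx] := ltP x c.
    rewrite (_ : (fun n => _) = cst 0); first exact: cvg_cst.
    apply: funext => n /=; rewrite bump_eq0l; last by apply: le_trans ler01; rewrite mulr_ge0_le0// subr_le0 ltW.
    by rewrite /cell indicE memNset ?subrr ?expr0n//= in_itv/= => /andP[]; lra.
  have [xcl|clx] := ltP x (c + l).
    have L : (fun n => (bump n l (x - c) - 1) ^+ 2) @ \oo --> (((1 : R) - 1) ^+ 2).
      apply: (@cvg_comp _ _ _ _ (fun z : R => (z - 1) ^+ 2)).
        by apply: bump_cvg; rewrite subr_gt0 lt_neqAle eq_sym xc cx/=; lra.
      by apply: (@continuousM _ _ (fun z : R => z - 1) (fun z : R => z - 1)) => //; apply: cvgB => //; exact: cvg_cst.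
    move: L; rewrite subrr expr0n /=; apply: cvg_trans; apply: near_eq_cvg; apply: nearW => n /=.
    by rewrite /cell indicE mem_set//= in_itv/= cx xcl.
  rewrite (_ : (fun n => _) = cst 0); first exact: cvg_cst.
  apply: funext => n /=; rewrite bump_eq0r; last by apply: le_trans ler01; rewrite mulr_ge0_le0//; lra.
  by rewrite /cell indicE memNset ?subrr ?expr0n//= in_itv/= => /andP[]; lra.
- exact: (intg_cst a b 1).
- apply: aeW => x n _; rewrite /F/= lee_fin ger0_norm ?sqr_ge0//.
  have := bump_ge0 n l (x - c); have := bump_le1 n l (x - c).
  by rewrite /cell indicE; case: (_ \in _) => /=; nra.
move=> _ _; rewrite integral0 => /fine_cvgP[_] /cvgrPdist_le /(_ _ (exprn_gt0 2 e0))[N _ H].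
exists N => // n /H /=.
rewrite sub0r normrN => K.
rewrite -(@ler_pXn2r _ 2)// ?nnegrE ?nn_ge0 ?(ltW e0)// nn_sqr.
apply: le_trans K; exact: ler_norm.
Qed.

(** Two translates of one bump have equal integrals, so the difference of their primitives vanishes
    again to the right of both and is a test function. *)
Lemma dtest_cell c c' l : a <= c -> c + l <= b -> a <= c' -> c' + l <= b -> 0 < l ->
  dtest (cell c l - cell c' l).
Proof.
move=> ac cb ac' cb' l0; split; first by apply: sqiB; exact: cell_sqi.
move=> e e0; have e2 : 0 < e / 2 by rewrite divr_gt0.
near \oo => n.
have n0 : 0 < n%:R^-1 :> R by rewrite invr_gt0; near: n; exact: nbhs_infty_gtr.
(* Each bump vanishes within [1/n] of both ends of its cell. A cell must be long enough for both
   margins, so that the bounds of the support of [psi] are in the right order. *)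
have nl : n%:R^-1 <= l / 2.
  have H : 2 / l < n%:R by near: n; exact: nbhs_infty_gtr.
  have l2 : 0 < 2 / l by rewrite divr_gt0.
  by rewrite -[l / 2]invf_div lef_pV2 ?posrE ?ltW// (lt_trans l2).
pose psi := (fun x => cumbump n l (x - c)) + cst (-1) * (fun x => cumbump n l (x - c')).
pose dpsi := (fun x => bump n l (x - c)) - (fun x => bump n l (x - c')).
have sc k : smooth_gen (fun x => cumbump n l (x - k)).
  apply: smooth_gen_comp_shift; apply: sg_prim (smooth_gen_bump n l) _.
  by move=> x; exact: is_derive_cumbump.
have dpsiE : derive1 psi = dpsi.
  apply: funext => x; rewrite derive1E.
  have D k : is_derive x 1 (fun x => cumbump n l (x - k)) (bump n l (x - k)).
    have H := @is_derive1_comp R (cumbump n l) (fun z => 1 * z + (- k)) x _ _ (is_derive_cumbump n l _) (is_derive_affine 1 (- k) x).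
    move: H; rewrite mulr1 mul1r; congr is_derive.
    by apply: funext => z /=; rewrite mul1r.
  have [_ ->] := is_deriveD (D c) (is_deriveM (is_derive_cst (-1 : R) x 1) (D c')).
  by rewrite /GRing.scale /= mulr0 addr0 mulN1r.
exists psi.
  split; first by apply: sg_add => //; apply: sg_mul => //; exact: sg_cst.
  exists (Num.min c c' + n%:R^-1), (Num.max (c + l) (c' + l) - n%:R^-1); split.
  - by rewrite (le_lt_trans (_ : a <= Num.min c c'))// ?ltrDl// le_min ac.
  - have H1 : Num.min c c' <= c by rewrite ge_min lexx.
    have H2 : c + l <= Num.max (c + l) (c' + l) by rewrite le_max lexx.
    by lra.
  - by rewrite (lt_le_trans _ (_ : Num.max (c + l) (c' + l) <= b))// ?ltrBlDr ?ltrDl// ge_max cb.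
  - move=> x [xc|xd].
    + have H k : Num.min c c' <= k -> cumbump n l (x - k) = 0.
        move=> ck; rewrite cumbump0//; have : x - k <= n%:R^-1 by lra.
        by rewrite -(ler_pM2l (x := n%:R)) ?divff ?gt_eqF//; rewrite -invr_gt0.
      by rewrite /psi !fctE !H ?mulr0 ?addr0// ge_min lexx ?orbT.
    + have H k : k + l <= Num.max (c + l) (c' + l) -> cumbump n l (x - k) = cumbump n l l.
        by move=> ck; rewrite cumbump_cst//; lra.
      by rewrite /psi !fctE !H ?mulN1r ?subrr// le_max lexx ?orbT.
rewrite dpsiE /dpsi.
have sF k : sqi ((fun x => bump n l (x - k)) - cell k l).
  by apply: sqiB; [apply: smooth_gen_sqi; exact: bump_shift_sg|exact: cell_sqi].
rewrite (_ : _ - _ = ((fun x => bump n l (x - c)) - cell c l) - ((fun x => bump n l (x - c')) - cell c' l)); last first.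
  by apply: funext => x; rewrite !fctE; ring.
have H := nnB (sF c) (sF c'); apply: (le_trans H).
rewrite [e]splitr; apply: lerD; near: n; exact: bump_L2.
Unshelve. all: by end_near. Qed.

End density.

Lemma prim_holder (R : realType) (a b : R) (g : R -> R) (x y : R) : sqi a b g -> a <= x -> x <= y -> y <= b ->
  `|prim a g y - prim a g x| <= Num.sqrt (y - x) * nn a b g.
Proof.
move=> sg ax xy yb; have Ig : intg a b g := sqi_intg sg; rewrite (prim_diff Ig)//.
have Ixy : (@lebesgue_measure R).-integrable `[x, y] (EFin \o g).
  by apply: integrableS Ig => //; apply: subset_itv; rewrite bnd_simp.
have Ioxy : (@lebesgue_measure R).-integrable `]x, y] (EFin \o g).
  by apply: integrableS Ixy => //; apply: subset_itv; rewrite bnd_simp.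
rewrite (Rintegral_itv_obnd_cbnd Ioxy).
have sxy : sqi x y g.
  split; first by apply: measurable_funS sg.1 => //; apply: subset_itv; rewrite bnd_simp.
  by apply: integrableS sg.2 => //; apply: subset_itv; rewrite bnd_simp.
apply: le_trans (norm_Iab Ixy) _; apply: le_trans (Iab_norm_le xy sxy) _.
rewrite ler_wpM2l ?sqrtr_ge0// ler_wsqrtr// /ip.
have I2 := intgM sg sg; have I2xy := intgM sxy sxy.
apply: fine_le.
- exact: integrable_fin_num I2xy.
- exact: integrable_fin_num I2.
- apply: ge0_subset_integral => //.
  + by apply/measurable_EFinP; apply: intg_meas I2.
  + by move=> z _; rewrite lee_fin !fctE -expr2 sqr_ge0.
  + by apply: subset_itv; rewrite bnd_simp.
Qed.

Section density_continuous.
Variables (R : realType) (a b : R).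
Hypothesis ab : a < b.
Local Notation mu := (@lebesgue_measure R).
Implicit Types (f g phi psi : R -> R) (c l e x y : R).
Local Notation sqi := (sqi a b).
Local Notation Iab := (Iab a b).
Local Notation intg := (intg a b).
Local Notation nn := (nn a b).

Lemma Iab_co f : intg f -> Iab f = \int[mu]_(x in `[a, b[) f x.
Proof.
move=> If; rewrite Rintegral_itv_bndo_bndc//; apply: integrableS If => //.
by apply: subset_itvl; rewrite bnd_simp.
Qed.

(** Meant for step functions made of cells: these are 0 at [b], where no approximation can be
    expected. *)
Lemma nn_bounded_o f (K : R) : 0 <= K -> sqi f ->
  (forall x, a <= x < b -> `|f x| <= K) -> nn f <= K * Num.sqrt (b - a).
Proof.
move=> K0 sf fK; rewrite -(@ler_pXn2r _ 2)// ?nnegrE ?mulr_ge0 ?nn_ge0 ?sqrtr_ge0//.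
rewrite nn_sqr exprMn sqr_sqrtr ?subr_ge0 ?(ltW ab)// -Iab_cst ?(ltW ab)//.
have I1 := intgM sf sf; have I2 : intg (cst (K ^+ 2)) by exact: intg_cst.
rewrite /ip !Iab_co//; apply: le_Rintegral => //.
- by apply: integrableS I1 => //; apply: subset_itvl; rewrite bnd_simp.
- by apply: integrableS I2 => //; apply: subset_itvl; rewrite bnd_simp.
move=> x; rewrite /= in_itv/= => /fK fxK.
by rewrite fctE -expr2 -(real_normK (num_real (f x))) lerXn2r// ?nnegrE.
Qed.

(** The approximants are the averages [c k] of [phi] over [m] equal cells. As [phi] has zero mean,
    the averages sum to zero, so subtracting the first cell from every cell changes nothing and only
    differences of cells occur. *)
Lemma dtest_uniform phi : {within `[a, b], continuous phi} -> Iab phi = 0 ->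
  (forall e, 0 < e -> exists2 d : R, 0 < d & forall x y, x \in `[a, b] -> y \in `[a, b] ->
     `|x - y| <= d -> `|phi x - phi y| <= e) ->
  dtest a b phi.
Proof.
move=> cphi phi0 unif; have Iphi := continuous_intg cphi.
apply: dtest_lim; first exact: continuous_sqi.
move=> e e0; have s0 : 0 < Num.sqrt (b - a) by rewrite sqrtr_gt0 subr_gt0.
have e'0 : 0 < e / Num.sqrt (b - a) by rewrite divr_gt0.
have [d d0 H] := unif _ e'0.
have [m] : exists m : nat, (b - a) / d < m%:R.
  by exists (Num.truncn ((b - a) / d)).+1; apply: truncnS_gt; rewrite ?num_real.
have q0 : 0 < (b - a) / d by rewrite divr_gt0// subr_gt0.
move=> md; have m0 : 0 < m%:R :> R by apply: lt_trans md.
pose L := (b - a) / m%:R; have L0 : 0 < L by rewrite divr_gt0// subr_gt0.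
have Ld : L <= d by rewrite ler_pdivrMr// mulrC -ler_pdivrMr// ltW.
have mL : m%:R * L = b - a by rewrite mulrC divfK// gt_eqF.
pose X (k : nat) := a + k%:R * L.
have XS k : X k.+1 = X k + L by rewrite /X -natr1 mulrDl mul1r addrA.
have Xa k : a <= X k by rewrite lerDl mulr_ge0// ltW.
have Xb k : (k <= m)%N -> X k <= b.
  by move=> km; rewrite /X -lerBrDl -mL ler_pM2r// ler_nat.
pose c (k : nat) := (prim a phi (X k.+1) - prim a phi (X k)) / L.
have sumc : \sum_(0 <= k < m) c k = 0.
  rewrite -mulr_suml telescope_sumr// /X mul0r addr0 mL (addrC a) subrK.
  by rewrite primE_a primE_b phi0 subr0 mul0r.
exists (fun x => \sum_(0 <= k < m) c k * (cell (X k) L - cell (X 0%N) L) x).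
  apply: dtest_sum => // i im; apply: dtest_cell => //; rewrite -?XS.
  - exact: Xb.
  - by apply: Xb; move: im; case: (m).
set step := fun x => _.
have stepE x : step x = \sum_(0 <= k < m) c k * cell (X k) L x.
  rewrite /step; under eq_bigr do rewrite !fctE mulrBr.
  by rewrite sumrB -mulr_suml sumc mul0r subr0.
have sphi := continuous_sqi cphi.
have sstep : sqi step.
  have : dtest a b step.
    apply: dtest_sum => // i im; apply: dtest_cell => //; rewrite -?XS.
    - exact: Xb.
    - by apply: Xb; move: im; case: (m).
  by case.
rewrite -[e](divfK (lt0r_neq0 s0)); apply: nn_bounded_o => //; [exact: ltW|exact: sqiB|].
move=> x /andP[ax xb].
pose j := Num.truncn ((x - a) / L).
have xa0 : 0 <= (x - a) / L by rewrite divr_ge0 ?subr_ge0// ltW.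
have /andP[j1 j2] := truncn_itv xa0; rewrite -/j in j1 j2.
rewrite ler_pdivlMr// in j1; rewrite ltr_pdivrMr// in j2.
have jm : (j < m)%N.
  by rewrite -(ltr_nat R) -(ltr_pM2r L0) mL (le_lt_trans j1)// ltrD2r.
have stepj : step x = c j.
  rewrite stepE big_mkord (bigD1 (Ordinal jm))//= [X in _ + X]big1 ?addr0; last first.
    move=> i /eqP ij; rewrite /cell indicE memNset ?mulr0//= in_itv/= -XS => /andP[i1 i2].
    apply: ij; apply: val_inj => /=; apply/eqP; rewrite eqn_leq; apply/andP; split.
    - rewrite -ltnS -(ltr_nat R) -(ltr_pM2r L0); apply: le_lt_trans j2.
      by rewrite lerBrDl.
    - rewrite -ltnS -(ltr_nat R) -(ltr_pM2r L0); apply: (le_lt_trans j1).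
      by rewrite ltrBlDl.
  rewrite /cell indicE mem_set ?mulr1//= in_itv/= -XS; apply/andP; split.
    by rewrite /X -lerBrDl.
  by rewrite /X -ltrBlDl.
have Xjj : X j < X j.+1 by rewrite XS ltrDl.
have XI z : z \in `[X j, X j.+1] -> z \in `[a, b].
  by rewrite !in_itv/= => /andP[z1 z2]; rewrite (le_trans (Xa j))//= (le_trans z2)// Xb.
have cP : {within `[X j, X j.+1], continuous (prim a phi)}.
  by apply: continuous_subspaceW (prim_continuous ab Iphi) => w /XI.
have dP w : w \in `]X j, X j.+1[ -> is_derive w 1 (prim a phi) (phi w).
  move=> wj; have wab : w \in `]a, b[.
    by move: wj; rewrite !in_itv/= => /andP[w1 w2]; rewrite (le_lt_trans (Xa j))//= (lt_le_trans w2)// Xb.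
  by apply: prim_is_derive (wab) _ => //; exact: within_continuous_in wab.
(* The average of [phi] over a cell is one of its values there. *)
have [z zj E] := MVT Xjj dP cP.
have -> : (step - phi) x = phi z - phi x.
  rewrite fctE; congr (_ - _); rewrite stepj /c E.
  by rewrite XS [X j + L]addrC addrK mulfK// gt_eqF.
apply: H.
- by apply: XI; move: zj; rewrite !in_itv/= => /andP[z1 z2]; rewrite !ltW.
- by rewrite in_itv/= ax ltW.
- apply: le_trans Ld; move: zj; rewrite in_itv/= XS /X => /andP[z1 z2].
  by move: j2; rewrite -natr1 mulrDl mul1r => j2; rewrite ler_norml; apply/andP; split; lra.
Qed.

Lemma barE g x : bar a b g x = prim a g x - (b - a)^-1 * Iab (prim a g).
Proof. by []. Qed.

Lemma bar_funE g : bar a b g = prim a g - cst ((b - a)^-1 * Iab (prim a g)).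
Proof. by []. Qed.

Lemma bar_continuous g : intg g -> {within `[a, b], continuous (bar a b g)}.
Proof.
move=> Ig x; rewrite bar_funE; apply: cvgB; last exact: cvg_cst.
exact: (prim_continuous ab Ig).
Qed.

Lemma bar_sqi g : intg g -> sqi (bar a b g).
Proof. by move=> Ig; apply: continuous_sqi; exact: bar_continuous. Qed.

Lemma Iab_bar g : intg g -> Iab (bar a b g) = 0.
Proof.
move=> Ig; rewrite bar_funE IabB; [|by apply: continuous_intg; exact: prim_continuous|exact: intg_cst].
rewrite Iab_cst ?(ltW ab)// mulrAC mulVf ?mul1r ?subrr//.
by rewrite subr_eq0 gt_eqF.
Qed.

Lemma dtest_bar g : sqi g -> dtest a b (bar a b g).
Proof.
move=> sg; have Ig := sqi_intg sg.
apply: dtest_uniform; [exact: bar_continuous|exact: Iab_bar|].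
move=> e e0.
exists ((e / (nn g + 1)) ^+ 2); first by rewrite exprn_gt0// divr_gt0// ltr_wpDl ?nn_ge0.
move=> x y.
wlog xy : x y / x <= y => [W xab yab|].
  by have [xy|/ltW yx] := leP x y; [exact: W|rewrite distrC (distrC (bar a b g x)); exact: W].
rewrite !in_itv/= => /andP[ax xb] /andP[ay yb] d.
rewrite !barE opprD addrACA subrr addr0 distrC; apply: le_trans (prim_holder sg ax xy yb) _.
rewrite distrC ger0_norm ?subr_ge0// in d.
have ng : 0 < nn g + 1 by rewrite ltr_wpDl ?nn_ge0.
have : Num.sqrt (y - x) <= e / (nn g + 1).
  by rewrite -(ger0_norm (ltW (divr_gt0 e0 ng))) -sqrtr_sqr ler_wsqrtr.
rewrite ler_pdivlMr//; apply: le_trans.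
by rewrite ler_wpM2l ?sqrtr_ge0// lerDl.
Qed.

End density_continuous.

(** * Weak derivatives *)

Section weak.
Variables (R : realType) (a b : R).
Hypothesis ab : a < b.
Local Notation mu := (@lebesgue_measure R).
Implicit Types (f g h phi psi : R -> R) (c l e x y : R).
Local Notation sqi := (sqi a b).
Local Notation Iab := (Iab a b).
Local Notation nn := (nn a b).
Local Notation ip := (ip a b).
Local Notation prim := (prim a).

Lemma nn0_ip f g : sqi f -> sqi g -> nn f = 0 -> ip f g = 0.
Proof.
move=> sf sg f0; apply/eqP; rewrite -normr_le0; apply: le_trans (cauchy_schwarz sf sg) _.
by rewrite f0 mul0r.
Qed.

Lemma continuous_nn0 f : {within `[a, b], continuous f} -> nn f = 0 ->
  forall x, x \in `[a, b] -> f x = 0.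
Proof.
move=> cf f0; have sf := continuous_sqi cf.
pose h := fun x => f x ^+ 2.
have ch : {within `[a, b], continuous h}.
  by move=> x; apply: (@continuousM _ (subspace `[a, b])); exact: cf.
have Ih : Iab (fun x => `|h x|) = 0.
  have <- : ip f f = 0 by rewrite -nn_sqr f0 expr0n.
  by congr Iab; apply: funext => x; rewrite /h ger0_norm ?sqr_ge0// expr2.
have P0 x : x \in `]a, b[ -> prim h x = 0.
  rewrite in_itv/= => /andP[ax xb]; apply/eqP; rewrite -normr_le0 -Ih.
  by apply: prim_norm; rewrite ?ltW//; exact: continuous_intg.
have foo x : x \in `]a, b[ -> f x = 0.
  move=> xab; have D := prim_is_derive (continuous_intg ch) xab (within_continuous_in ch xab).
  have D0 : is_derive x 1 (prim h) 0.
    apply: (@near_eq_is_derive R R R (cst 0)).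
    near=> z; rewrite P0//; near: z; apply: near_in_itvoo; exact: xab.
  have E : h x = 0 by case: D => _ <-; case: D0.
  by apply/eqP; rewrite -sqrf_eq0 -/(h x) E.
have [_ ca cb] := (continuous_within_itvP _ ab).1 cf.
have fa : f a = 0.
  have L : f z @[z --> a^'+] --> (0 : R).
    apply: cvg_near_cst; near=> z; rewrite foo// in_itv/=; by apply/andP; split.
  exact: (cvg_unique _ ca L).
have fb : f b = 0.
  have L : f z @[z --> b^'-] --> (0 : R).
    apply: cvg_near_cst; near=> z; rewrite foo// in_itv/=; by apply/andP; split.
  exact: (cvg_unique _ cb L).
move=> x; rewrite in_itv/= => /andP[ax xb].
move: ax; rewrite le_eqVlt => /predU1P[<-//|ax].
move: xb; rewrite le_eqVlt => /predU1P[->//|xb].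
by apply: foo; rewrite in_itv/= ax.
Unshelve. all: by end_near. Qed.

(** Lebesgue differentiation: almost everywhere [h], extended by zero, is the derivative of its
    primitive. *)
Lemma prim0_nn0 h : sqi h -> (forall x, x \in `[a, b] -> prim h x = 0) -> nn h = 0.
Proof.
move=> sh P0; have Ih := sqi_intg sh.
pose k := h \_ `[a, b].
have Ik A : measurable A -> mu.-integrable A (EFin \o k).
  move=> mA; have : mu.-integrable setT (EFin \o k).
    by rewrite /k -restrict_EFin; apply/(integrable_mkcond _ _).1.
  by move/integrableS; apply.
have loc : locally_integrable setT k.
  exact: integrable_locally.
have F0 x : x \in `]a, b[ -> \int[mu]_(t in `[a, x]) k t = 0.
  rewrite in_itv/= => /andP[ax xb]; rewrite -(P0 x); last by rewrite in_itv/= !ltW.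
  apply: eq_Rintegral => y; rewrite inE/= in_itv/= => /andP[ay yx].
  by rewrite /k patchE mem_set//= in_itv/= ay (le_trans yx)// ltW.
have H := @FTC1 R k (BLeft a) (fun y => Ik _ (measurable_itv _)) loc.
have hae : ae_eq mu [set` `]a, b[] (EFin \o (h * h)) (cst 0%E).
  have := H; apply: filterS; first exact: (ae_filter_ringOfSetsType mu).
  move=> x {}H xab.
  have axb : x \in `]a, b[ by [].
  have [] := H _; first by move: xab; rewrite /= in_itv/= => /andP[ax _]; rewrite lte_fin.
  move=> _ E; have k0 : k x = 0.
    rewrite -E derive1E; have [_ ->//] : is_derive x 1 (fun x : R => \int[mu]_(t in [set` Interval (BLeft a) (BRight x)]) k t) 0.
    apply: (@near_eq_is_derive R R R (cst 0)).
    near=> z; rewrite F0//; near: z; exact: near_in_itvoo.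
  move: k0; rewrite /k patchE mem_set; last exact: subset_itv_oo_cc.
  by rewrite /= fctE => ->; rewrite mulr0.
rewrite /nn /ip; suff -> : Iab (h * h) = 0 by rewrite sqrtr0.
have mhh := intg_meas (intgM sh sh).
have mo : measurable_fun `]a, b[ (EFin \o (h * h)).
  by apply/measurable_EFinP; apply: measurable_funS mhh => //; exact: subset_itv_oo_cc.
rewrite -Iab_oo// /Rintegral.
have -> := @ae_eq_integral _ _ _ mu [set` `]a, b[] (cst 0%E) (EFin \o (h * h)) (measurable_itv _) mo (measurable_cst _) hae.
by rewrite integral0.
Unshelve. all: by end_near. Qed.

Lemma dtest_orth h : sqi h -> (forall psi, test_gen a b psi -> ip h (derive1 psi) = 0) ->
  forall phi, dtest a b phi -> ip h phi = 0.
Proof.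
move=> sh H phi [sphi K]; apply/eqP; rewrite -normr_le0; apply/ler_addgt0Pl => e e0; rewrite addr0.
have e' : 0 < e / (nn h + 1) by rewrite divr_gt0// ltr_wpDl ?nn_ge0.
have [psi T n] := K _ e'.
have sp := test_gen_sqi T.
have -> : ip h phi = - ip h (derive1 psi - phi) by rewrite ipBr// H// sub0r opprK.
rewrite normrN; apply: le_trans (cauchy_schwarz sh (sqiB sp sphi)) _.
move: n; rewrite ler_pdivlMr ?ltr_wpDl ?nn_ge0//; apply: le_trans.
by rewrite mulrC ler_wpM2l ?nn_ge0// lerDl.
Qed.

(** Lemma of du Bois-Reymond. With [k] the mean of [h] and [g0] the primitive of [h - k],
    integration by parts gives [ip g0 g0 = - ip (h - k) (prim g0)]. Up to a constant [prim g0] is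
    [bar g0], so this vanishes; then [g0] is zero, and [h - k] with it. *)
Lemma dtest_orth_cst h : sqi h -> (forall phi, dtest a b phi -> ip h phi = 0) ->
  exists k, nn (h - cst k) = 0.
Proof.
move=> sh H; pose k := Iab h / (b - a); exists k.
have sk c : sqi (cst c) by apply: continuous_sqi => x; exact: cvg_cst.
have shk : sqi (h - cst k) by exact: sqiB.
have Ihk := sqi_intg shk.
have Ihk0 : Iab (h - cst k) = 0.
  rewrite IabB ?Iab_cst ?ltW//; [|exact: sqi_intg|exact: intg_cst].
  by rewrite /k divfK ?subrr// subr_eq0 gt_eqF.
pose g0 := prim (h - cst k).
have cg0 : {within `[a, b], continuous g0} by exact: prim_continuous.
have sg0 := continuous_sqi cg0.
have icst f c : sqi f -> ip f (cst c) = c * Iab f.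
  move=> sf; rewrite ipC /ip -IabZ; last exact: sqi_intg.
  by congr Iab.
have n0 : ip g0 g0 = 0.
  have := ibp_L1 ab Ihk (sqi_intg sg0).
  rewrite Ihk0 mul0r sub0r -/g0 => E; rewrite -[LHS]/(Iab (g0 * g0)) E.
  have sp : sqi (prim g0) by apply: continuous_sqi; apply: prim_continuous => //; exact: sqi_intg.
  have sb : sqi (bar a b g0) by apply: bar_sqi => //; exact: sqi_intg.
  have : ip (h - cst k) (bar a b g0) = 0.
    rewrite ipBl// H; last exact: dtest_bar.
    by rewrite ipC icst// Iab_bar ?mulr0 ?subrr//; exact: sqi_intg.
  by rewrite bar_funE ipBr// icst// Ihk0 mulr0 subr0 /ip => ->; rewrite oppr0.
apply: prim0_nn0 => //.
by apply: continuous_nn0 => //; rewrite /nn n0 sqrtr0.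
Qed.

Lemma test_gen_prim psi x : test_gen a b psi -> a <= x -> prim (derive1 psi) x = psi x.
Proof.
move=> [S [c [d [ac cd db H]]]]; rewrite le_eqVlt => /predU1P[<-|ax].
  by rewrite primE_a H//; left.
have := @FTC2_prim R a x ax (derive1 psi) psi.
rewrite (H a); last by left.
rewrite subr0; apply.
- by apply: continuous_subspaceT; apply: smooth_gen_continuous; exact: smooth_gen_derive1.
- by apply: continuous_subspaceT; exact: smooth_gen_continuous.
- by move=> y _; exact: smooth_gen_is_derive.
Qed.

Lemma test_gen_ibp g psi : sqi g -> test_gen a b psi ->
  ip g psi = - ip (prim g) (derive1 psi).
Proof.
move=> sg T; have sd := test_gen_sqi T.
have := ibp_L1 ab (sqi_intg sg) (sqi_intg sd).
rewrite -(primE_b a b (derive1 psi)) (test_gen_prim T (ltW ab)).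
have [_ [c [d [ac cd db H]]]] := T.
rewrite (H b); last by right.
rewrite mulr0 sub0r /ip => ->; rewrite opprK; apply: eq_Iab => x.
by rewrite in_itv/= => /andP[ax _]; rewrite !fctE test_gen_prim.
Qed.

(** [bar g] and [prim g] differ by a constant, which is orthogonal to the derivative of a test
    function. *)
Lemma test_gen_ibp_bar g psi : sqi g -> test_gen a b psi ->
  ip g psi = - ip (bar a b g) (derive1 psi).
Proof.
move=> sg T; rewrite test_gen_ibp//.
have sd := test_gen_sqi T.
have sp : sqi (prim g) by apply: continuous_sqi; apply: prim_continuous => //; exact: sqi_intg.
have sc c : sqi (cst c) by apply: continuous_sqi => x; exact: cvg_cst.
rewrite bar_funE ipBl//; set c := (X in ip (cst X)).
suff -> : ip (cst c) (derive1 psi) = 0 by rewrite subr0.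
rewrite -[LHS]/(Iab (fun x => c * derive1 psi x)) IabZ; last exact: sqi_intg.
rewrite -(primE_b a b (derive1 psi)) (test_gen_prim T (ltW ab)).
have [_ [c' [d [ac cd db H]]]] := T.
by rewrite (H b) ?mulr0//; right.
Qed.

Definition wder f g := forall psi, test_gen a b psi -> ip f (derive1 psi) = - ip g psi.

Lemma wder_prim f g : sqi f -> sqi g -> wder f g -> exists k, nn (f - (prim g + cst k)) = 0.
Proof.
move=> sf sg W.
have sp : sqi (prim g) by apply: continuous_sqi; apply: prim_continuous => //; exact: sqi_intg.
have sfp : sqi (f - prim g) by exact: sqiB.
have O : forall phi, dtest a b phi -> ip (f - prim g) phi = 0.
  apply: dtest_orth => //.
  move=> psi T; have sd := test_gen_sqi T.
  by rewrite ipBl// W// (test_gen_ibp sg T) opprK subrr.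
have [k n0] := dtest_orth_cst sfp O; exists k; by rewrite opprD addrA.
Qed.

Lemma wder_continuous f g : {within `[a, b], continuous f} -> sqi g -> wder f g ->
  forall x, x \in `[a, b] -> f x = f a + prim g x.
Proof.
move=> cf sg W; have [k n0] := wder_prim (continuous_sqi cf) sg W.
have cp : {within `[a, b], continuous (prim g)} by apply: prim_continuous => //; exact: sqi_intg.
have cd : {within `[a, b], continuous (f - (prim g + cst k))}.
  move=> x; apply: cvgB; first exact: cf.
  by apply: cvgD; [exact: cp|exact: cvg_cst].
have H x : x \in `[a, b] -> f x = prim g x + k.
  by move=> xab; apply/eqP; rewrite -subr_eq0; apply/eqP; exact: (continuous_nn0 cd n0 xab).
have fa : f a = k by rewrite H ?primE_a ?add0r// in_itv/= lexx ltW.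
by move=> x /H ->; rewrite fa addrC.
Qed.

End weak.

(** * Integration by parts and chain rule for weak derivatives *)

Section slices.
Variables (R : realType) (a b : R).
Hypothesis ab : a < b.
Implicit Types (f g h m phi psi : R -> R) (c l e x y : R).
Local Notation intg := (intg a b).
Local Notation sqi := (sqi a b).
Local Notation Iab := (Iab a b).
Local Notation nn := (nn a b).
Local Notation ip := (ip a b).
Local Notation prim := (prim a).
Local Notation wder := (wder a b).
Local Notation bar := (bar a b).

Lemma sqi_cst c : sqi (cst c).
Proof. by apply: continuous_sqi => x; exact: cvg_cst. Qed.

Lemma prim_sqi f : intg f -> sqi (prim f).
Proof. by move=> If; apply: continuous_sqi; exact: prim_continuous. Qed.

Lemma ip_cst f c : sqi f -> ip f (cst c) = c * Iab f.
Proof.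
move=> sf; rewrite ipC ipE -IabZ; last exact: sqi_intg.
by congr Iab.
Qed.

Lemma eq_ipl f g h : (forall x, x \in `[a, b] -> f x = g x) -> ip f h = ip g h.
Proof. by move=> E; apply: eq_Iab => x xab; rewrite !fctE E. Qed.

Lemma ip_nn0 f g h : sqi f -> sqi g -> sqi h -> nn (f - g) = 0 -> ip f h = ip g h.
Proof.
move=> sf sg sh n0; apply/eqP; rewrite -subr_eq0 -ipBl//; apply/eqP.
by apply: nn0_ip => //; exact: sqiB.
Qed.

Lemma prim_nn_le f x : sqi f -> x <= b -> `|prim f x| <= Num.sqrt (b - a) * nn f.
Proof.
move=> sf xb; apply: le_trans (prim_norm (sqi_intg sf) xb) _.
by apply: Iab_norm_le => //; exact: ltW.
Qed.

(** As [f] has zero mean, its primitive vanishes at both ends, and the constant by which [G] differs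
    from [prim g] is not seen either. *)
Lemma wder_ibp0 f G g : sqi f -> sqi G -> sqi g -> Iab f = 0 -> wder G g ->
  ip f G = - ip (prim f) g.
Proof.
move=> sf sG sg f0 /(wder_prim ab sG sg)[k n0].
have sp : sqi (prim g) by apply: prim_sqi; exact: sqi_intg.
rewrite ipC (ip_nn0 sG _ sf n0); last by apply: sqiD => //; exact: sqi_cst.
rewrite ipC ipDr ?ip_cst ?f0 ?mulr0 ?addr0//; last exact: sqi_cst.
have := ibp_L1 ab (sqi_intg sf) (sqi_intg sg).
by rewrite f0 mul0r sub0r !ipE => ->; rewrite opprK.
Qed.

Lemma ip_prim0_bar g m : sqi g -> sqi m -> Iab m = 0 ->
  ip g (prim m) = - ip (bar g) m.
Proof.
move=> sg sm m0; have sp : sqi (prim g) by apply: prim_sqi; exact: sqi_intg.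
rewrite bar_funE ipBl//; last exact: sqi_cst.
rewrite [ip (cst _) m]ipC ip_cst// m0 mulr0 subr0.
have := ibp_L1 ab (sqi_intg sg) (sqi_intg sm).
by rewrite m0 mulr0 sub0r !ipE => ->; rewrite opprK.
Qed.

Lemma barB f g x : intg f -> intg g -> x \in `[a, b] -> bar (f - g) x = bar f x - bar g x.
Proof.
move=> If Ig; rewrite in_itv/= => /andP[_ xb].
rewrite !barE (primB If Ig xb) [Iab (prim (f - g))](_ : _ = Iab (prim f) - Iab (prim g)).
  by move: (prim f x) (prim g x) (Iab (prim f)) (Iab (prim g)) => *; ring.
rewrite -IabB; [|by apply: continuous_intg; exact: prim_continuous..].
by apply: eq_Iab => y; rewrite in_itv/= => /andP[_ yb]; rewrite !fctE (primB If Ig yb).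
Qed.

Lemma norm_bar_le g x : intg g -> x \in `[a, b] -> `|bar g x| <= 2 * Iab (fun y => `|g y|).
Proof.
move=> Ig; rewrite in_itv/= => /andP[_ xb]; rewrite barE.
have Ip : intg (prim g) by apply: continuous_intg; exact: prim_continuous.
have H : `|(b - a)^-1 * Iab (prim g)| <= Iab (fun y => `|g y|).
  have ba : 0 < b - a by rewrite subr_gt0.
  rewrite normrM gtr0_norm ?invr_gt0// ler_pdivrMl//.
  apply: le_trans (norm_Iab Ip) _; rewrite mulrC -Iab_cst ?(ltW ab)//.
  apply: le_Iab; [exact: intg_norm|exact: intg_cst|].
  by move=> y; rewrite in_itv/= => /andP[_ yb]; exact: prim_norm.
by apply: le_trans (ler_normB _ _) _; have := prim_norm Ig xb; lra.
Qed.

(* A function with a square integrable second derivative is continuously differentiable;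
   [V] is the continuous representative of the weak derivative. *)
Lemma slice_C1 f fx fxx : {within `[a, b], continuous f} -> sqi fx -> sqi fxx ->
  wder f fx -> wder fx fxx ->
  exists2 V, {within `[a, b], continuous V} & nn (fx - V) = 0 /\
    forall x, x \in `]a, b[ -> is_derive x 1 f (V x).
Proof.
move=> cf sfx sfxx W1 W2.
have [k n0] := wder_prim ab sfx sfxx W2.
pose V := prim fxx + cst k; have cV : {within `[a, b], continuous V}.
  move=> x; apply: cvgD; last exact: cvg_cst.
  by apply: (prim_continuous ab); exact: sqi_intg.
exists V => //; split => // x xab.
have sV := continuous_sqi cV.
have E y : y \in `[a, b] -> f y = f a + prim V y.
  move=> yab; rewrite (wder_continuous ab cf sfx W1 yab); congr (_ + _).
  have yb : y <= b by move: yab; rewrite in_itv/= => /andP[].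
  apply/eqP; rewrite -subr_eq0 -(primB (b := b))//; [|exact: sqi_intg..].
  by rewrite -normr_le0; apply: le_trans (prim_nn_le (sqiB sfx sV) yb) _; rewrite n0 mulr0.
have H : is_derive x 1 (cst (f a) + prim V) (0 + V x).
  have D := prim_is_derive (sqi_intg sV) xab (within_continuous_in cV xab).
  exact: is_deriveD.
rewrite add0r in H; apply: (near_eq_is_derive _ H).
near=> z; have : z \in `]a, b[ by near: z; exact: near_in_itvoo.
by move=> zab; rewrite [RHS]E//; exact: subset_itv_oo_cc zab.
Unshelve. all: by end_near. Qed.

Lemma continuous_comp_within (F f : R -> R) : continuous F -> {within `[a, b], continuous f} ->
  {within `[a, b], continuous (F \o f)}.
Proof. by move=> cF cf x; apply: (@continuous_comp (subspace `[a, b])); [exact: cf|exact: cF]. Qed.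

Lemma continuous_itv_bounded f : {within `[a, b], continuous f} -> exists K, forall x, x \in `[a, b] -> `|f x| <= K.
Proof.
move=> cf; have cn : {within `[a, b], continuous (fun x => `|f x|)}.
  by apply: (continuous_comp_within (F := fun z : R => `|z|)) => //; exact: norm_continuous.
by have [c _ H] := EVT_max (ltW ab) cn; exists `|f c|.
Qed.

(** The classical chain rule holds for the continuous representative [V] of [fx]; since [fx - V] is
    null in L2, exchanging them does not alter the primitive. *)
Lemma prim_comp_derive (F F' : R -> R) f fx fxx x :
  (forall y, is_derive y 1 F (F' y)) -> continuous F' ->
  {within `[a, b], continuous f} -> sqi fx -> sqi fxx -> wder f fx -> wder fx fxx ->
  x \in `[a, b] -> prim ((F' \o f) * fx) x = F (f x) - F (f a).
Proof.
move=> dF cF' cf sfx sfxx W1 W2 xab.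
have [ax xb] : a <= x /\ x <= b by apply/andP; move: xab; rewrite in_itv.
have [V cV [n0 dV]] := slice_C1 cf sfx sfxx W1 W2.
have sV := continuous_sqi cV.
have cF'f := continuous_comp_within cF' cf.
have [K HK] := continuous_itv_bounded cF'f.
have mF := intg_meas (continuous_intg cF'f).
have K0 : 0 <= K by apply: le_trans (HK a _) => //; rewrite in_itv/= lexx ltW.
have cF : continuous F by move=> y; exact: is_derive_continuous (dF y).
have s1 := sqiMb mF HK sfx; have s2 := sqiMb mF HK sV.
have -> : prim ((F' \o f) * fx) x = prim ((F' \o f) * V) x.
  apply/eqP; rewrite -subr_eq0 -(primB (b := b))//; [|exact: sqi_intg..].
  rewrite -normr_le0 -mulrBr; apply: le_trans (prim_nn_le _ xb) _.
    by apply: sqiMb HK _ => //; exact: sqiB.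
  have := nnMb K0 mF HK (sqiB sfx sV); rewrite n0 mulr0 => H.
  by rewrite mulr_ge0_le0 ?sqrtr_ge0.
have cFV : {within `[a, b], continuous ((F' \o f) * V)}.
  by move=> y; apply: (@continuousM _ (subspace `[a, b])); [exact: cF'f|exact: cV].
move: ax; rewrite le_eqVlt => /predU1P[<-|ax]; first by rewrite primE_a subrr.
have sub : `[a, x]%classic `<=` `[a, b]%classic by apply: subset_itvl; rewrite bnd_simp.
apply: (@FTC2_prim R a x ax ((F' \o f) * V) (F \o f)).
- exact: continuous_subspaceW sub cFV.
- by apply: continuous_subspaceW sub _; exact: continuous_comp_within.
- move=> y; rewrite in_itv/= => /andP[ay yx].
  apply: is_derive1_comp; apply: dV; rewrite in_itv/= ay; exact: lt_le_trans xb.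
Qed.

End slices.

(** * Weak evolution equations *)

Section time_derivative.
Variables (R : realType).

Lemma is_derive_eps (f : R -> R) (s l : R) :
  (forall eta, 0 < eta -> exists2 d : R, 0 < d & forall t, `|t - s| < d ->
     `|f t - f s - (t - s) * l| <= eta * `|t - s|) ->
  is_derive s 1 f l.
Proof.
move=> H.
suff L : (fun h : R => h^-1 *: ((f \o shift s) (h *: 1) - f s)) @ 0^' --> l.
  by apply: DeriveDef; [exact: cvgP L|exact: cvg_lim L].
apply/cvgrPdist_le => eta eta0; have [d d0 K] := H _ eta0.
near=> h; rewrite /= scaler1.
have h0 : h != 0 by near: h; exact: nbhs_dnbhs_neq.
have hd : `|h + s - s| < d by rewrite addrK; near: h; exact: dnbhs0_lt.
have := K _ hd; rewrite addrK => Kh.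
have -> : l - h^-1 *: (f (h + s) - f s) = - (h^-1 * (f (h + s) - f s - h * l)).
  by rewrite /GRing.scale /=; field.
by rewrite normrN normrM normfV ler_pdivrMl ?normr_gt0// (mulrC `|h|).
Unshelve. all: by end_near. Qed.

Variables (a b : R).
Hypothesis ab : a < b.
Local Notation sqi := (sqi a b).
Local Notation nn := (nn a b).
Local Notation ip := (ip a b).
Local Notation dtest := (dtest a b).
Local Notation test_gen := (test_gen a b).

Definition time_cont (s : R) (F : R -> R -> R) := forall eta : R, 0 < eta ->
  exists2 d : R, 0 < d & forall t, 0 <= t -> `|t - s| < d -> nn (F t - F s) <= eta.

Variables (X Y : R -> R -> R).
Hypothesis sX : forall t : R, 0 <= t -> sqi (X t).
Hypothesis sY : forall t : R, 0 <= t -> sqi (Y t).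
Hypothesis cY : forall t : R, 0 < t -> time_cont t Y.
Hypothesis dX : forall psi, test_gen psi -> forall t : R, 0 < t ->
  is_derive t 1 (fun s : R => ip (X s) (derive1 psi)) (ip (Y t) (derive1 psi)).

(** For one test function the mean value theorem evaluates [Y] at a time near [s], and continuity of
    [Y] in L2 bounds the error by the norm of the function tested with. As [d] does not depend on
    that function, the bound survives the closure and applies even to functions that vary with
    [t]. *)
Lemma dtest_increment (s eta : R) : 0 < s -> 0 < eta -> exists2 d : R, 0 < d & forall t, `|t - s| < d ->
  0 < t /\ forall phi, dtest phi -> `|ip (X t - X s) phi - (t - s) * ip (Y s) phi| <= eta * `|t - s| * nn phi.
Proof.
move=> s0 eta0; have [d d0 H] := cY s0 eta0.
exists (Num.min d s); first by rewrite lt_min d0 s0.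
move=> t; rewrite lt_min => /andP[td ts].
have t0 : 0 < t by move: ts; rewrite ltr_norml => /andP[]; rewrite ltrBrDl subrr.
split => // phi [sphi K].
have tx z : Num.min s t <= z -> 0 < z.
  by apply: lt_le_trans; rewrite lt_min s0 t0.
have mvt psi : test_gen psi -> `|ip (X t - X s) (derive1 psi) - (t - s) * ip (Y s) (derive1 psi)|
    <= eta * `|t - s| * nn (derive1 psi).
  move=> T; have sd := test_gen_sqi T.
  rewrite ipBl//; [|by apply: sX; rewrite ltW..].
  have M : forall s t : R, 0 < s -> 0 < t -> s <= t -> exists2 z, z \in `[s, t] &
      ip (X t) (derive1 psi) - ip (X s) (derive1 psi) = ip (Y z) (derive1 psi) * (t - s).
    move=> s' t' s'0 t'0 st; apply: (MVT_segment (f := fun s => ip (X s) (derive1 psi)) st).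
      by move=> z; rewrite in_itv/= => /andP[sz _]; apply: dX => //; exact: lt_trans sz.
    apply/continuous_in_subspaceT => z; rewrite inE/= in_itv/= => /andP[sz _].
    have z0 := lt_le_trans s'0 sz.
    exact: is_derive_continuous (dX T z0).
  have [z [z0 zd E]] : exists z, [/\ 0 < z, `|z - s| < d &
      ip (X t) (derive1 psi) - ip (X s) (derive1 psi) = ip (Y z) (derive1 psi) * (t - s)].
    have [st|/ltW ts'] := leP s t.
      have [z] := M s t s0 t0 st; rewrite in_itv/= => /andP[sz zt] E; exists z; split => //.
        exact: lt_le_trans sz.
      by apply: le_lt_trans td; rewrite !ger0_norm ?subr_ge0// lerD2r.
    have [z] := M t s t0 s0 ts'; rewrite in_itv/= => /andP[tz zs] E; exists z; split => //.
    - exact: lt_le_trans tz.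
    - by apply: le_lt_trans td; rewrite !ler0_norm ?subr_le0// lerN2 lerD2r.
    - by rewrite -[LHS]opprB E -mulrN opprB.
  have sYz := sY (ltW z0); have sYs := sY (ltW s0).
  rewrite E mulrC -mulrBr -ipBl// normrM mulrAC (mulrC `|t - s|) ler_wpM2r//.
  apply: le_trans (cauchy_schwarz (sqiB sYz sYs) sd) _.
  by rewrite ler_wpM2r ?nn_ge0//; apply: H => //; exact: ltW.
(* [A] is the total factor with which the error [derive1 psi - phi] enters. *)
set A := nn (X t - X s) + `|t - s| * nn (Y s) + eta * `|t - s|.
have A0 : 0 <= A by rewrite !addr_ge0 ?mulr_ge0 ?nn_ge0// ltW.
apply/ler_addgt0Pl => k k0.
have k' : 0 < k / (A + 1) by rewrite divr_gt0// ltr_wpDl.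
have [psi T n] := K _ k'.
have sd := test_gen_sqi T.
have Mp := mvt _ T.
have sXX : sqi (X t - X s) by apply: sqiB; apply: sX; exact: ltW.
have sYs := sY (ltW s0).
have sdp := sqiB sd sphi.
have E g : sqi g -> ip g phi = ip g (derive1 psi) - ip g (derive1 psi - phi).
  by move=> sg; rewrite -ipBr// opprB addrC subrK.
have C1 := cauchy_schwarz sXX sdp; have C2 := cauchy_schwarz sYs sdp.
have N1 := nn_le_add sd sphi.
rewrite (E _ sXX) (E _ sYs).
have -> : ip (X t - X s) (derive1 psi) - ip (X t - X s) (derive1 psi - phi) -
   (t - s) * (ip (Y s) (derive1 psi) - ip (Y s) (derive1 psi - phi)) =
   (ip (X t - X s) (derive1 psi) - (t - s) * ip (Y s) (derive1 psi)) -
   (ip (X t - X s) (derive1 psi - phi) - (t - s) * ip (Y s) (derive1 psi - phi)).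
  by move: (ip _ _) (ip _ _) (ip _ _) (ip _ _) => p q r v; ring.
apply: le_trans (ler_normB _ _) _.
have B2 := ler_normB (ip (X t - X s) (derive1 psi - phi)) ((t - s) * ip (Y s) (derive1 psi - phi)).
rewrite normrM in B2.
have D2 : `|t - s| * `|ip (Y s) (derive1 psi - phi)| <= `|t - s| * (nn (Y s) * nn (derive1 psi - phi)).
  by rewrite ler_wpM2l.
have D3 : eta * `|t - s| * nn (derive1 psi) <= eta * `|t - s| * (nn phi + nn (derive1 psi - phi)).
  by rewrite ler_wpM2l// mulr_ge0// ltW.
have D4 : A * nn (derive1 psi - phi) <= k.
  move: n; rewrite ler_pdivlMr ?ltr_wpDl//; apply: le_trans.
  by rewrite mulrC ler_wpM2l ?nn_ge0// lerDl.
move: Mp B2 C1 D2 D3 D4; rewrite /A.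
move: (`|ip _ _ - _|) (`|ip _ _ - _|) (`|ip (X t - X s) _|) (`|ip (Y s) _|) => p q r v.
move: (nn (X t - X s)) (nn (Y s)) (nn (derive1 psi - phi)) (nn (derive1 psi)) (nn phi) => n1 n2 n3 n4 n5.
by lra.
Qed.

Lemma dtest_is_derive phi (s : R) : 0 < s -> dtest phi -> is_derive s 1 (fun t : R => ip (X t) phi) (ip (Y s) phi).
Proof.
move=> s0 Dphi; apply: is_derive_eps => eta eta0.
have n0 : 0 < nn phi + 1 by rewrite ltr_wpDl ?nn_ge0.
have [|d d0 H] := dtest_increment s0 (eta := eta / (nn phi + 1)); first by rewrite divr_gt0.
exists d => // t /H[t0 /(_ _ Dphi)].
rewrite (ipBl (sX (ltW t0)) (sX (ltW s0)) Dphi.1).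
move/le_trans; apply.
rewrite mulrAC ler_wpM2r// mulrAC ler_pdivrMr// ler_wpM2l ?lerDl// ltW//.
Qed.

(** The uniform weak estimate is applied to the error itself, and one factor of its norm cancels. *)
Lemma dtest_strong_derive (s eta : R) : 0 < s -> 0 < eta ->
  (forall t : R, 0 < t -> dtest (X t - X s - (fun x => (t - s) * Y s x))) ->
  exists2 d : R, 0 < d & forall t, `|t - s| < d ->
  0 < t /\ nn (X t - X s - (fun x => (t - s) * Y s x)) <= eta * `|t - s|.
Proof.
move=> s0 eta0 D; have [d d0 H] := dtest_increment s0 eta0.
exists d => // t /H[t0 K]; split => //.
have Dt := D _ t0; have := K _ Dt.
have sYs := sY (ltW s0); have sXX : sqi (X t - X s) by apply: sqiB; apply: sX; exact: ltW.
have sg : sqi (X t - X s - (fun x => (t - s) * Y s x)) by case: Dt.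
rewrite -ipZl// -ipBl//; last exact: sqiZ.
set g := X t - X s - _ in sg *.
rewrite -[ip g g]nn_sqr ger0_norm ?sqr_ge0// expr2.
have [->|n0] := eqVneq (nn g) 0; first by rewrite mulr_ge0// ltW.
by rewrite ler_pM2r// lt_def n0 nn_ge0.
Qed.

End time_derivative.

Section ip_algebra.
Variables (R : realType) (a b : R).
Implicit Types f g h : R -> R.

Lemma ip_diff_sqr f g : sqi a b f -> sqi a b g ->
  ip a b (f - g) (f + g) = ip a b f f - ip a b g g.
Proof.
move=> sf sg; have sfg := sqiD sf sg.
rewrite ipBl// !ipDr// [ip a b g f]ipC.
by move: (ip _ _ _ _) (ip _ _ _ _) (ip _ _ _ _) => *; ring.
Qed.

Lemma ip_comb_diff (tau : R) f f' g g' : sqi a b f -> sqi a b f' -> sqi a b g -> sqi a b g' ->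
  ip a b ((fun x => tau * f x + g x) - (fun x => tau * f' x + g' x)) (f + f') =
  tau * (ip a b f f - ip a b f' f') + ip a b (g - g') (f + f').
Proof.
move=> sf sf' sg sg'; have sff := sqiB sf sf'; have sgg := sqiB sg sg'; have sh := sqiD sf sf'.
rewrite -ip_diff_sqr// -ipZl// -ipDl//; last exact: sqiZ.
by congr ip; apply: funext => x; rewrite !fctE; ring.
Qed.

Lemma eq_ipr f g h : (forall x, x \in `[a, b] -> f x = g x) -> ip a b h f = ip a b h g.
Proof. by move=> E; rewrite ipC [RHS]ipC; exact: eq_ipl. Qed.

Lemma eq_nn f g : (forall x, x \in `[a, b] -> f x = g x) -> nn a b f = nn a b g.
Proof. by move=> E; rewrite /nn /ip; congr Num.sqrt; apply: eq_Iab => x xab; rewrite !fctE E. Qed.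

End ip_algebra.

Opaque ip nn Iab prim.

(** * First-order expansion of an energy increment *)

Section energy_estimate.
Variables (R : realType) (a b : R).
Local Notation sqi := (sqi a b).
Local Notation nn := (nn a b).
Local Notation ip := (ip a b).

(** The letters [u], [w], [f] stand for [ubar], [wbar], [flux] at times [t] and [s], [h] for [t - s]
    and [dx] for the increment of [Ux]. To first order [P] is [2 h <f, w>] and the pairing
    subtracted from it is [2 h (<w, w> + <w, f>)]: the flux cancels and [- 2 h <w, w>] is left. *)
Lemma energy_increment_estimate (k K h Et Es P rem : R) (ut us wt ws ft fs dx : R -> R) :
  sqi ut -> sqi us -> sqi wt -> sqi ws -> sqi ft -> sqi fs -> sqi dx -> 0 < k -> k <= 1 -> 0 <= K ->
  2 * (Et - Es) = P - ip (ut - us) ((wt + ws) + (ft + fs)) + rem ->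
  `|P - h * ip fs (wt + ws)| <= k * `|h| * nn (wt + ws) ->
  nn (ut - us - (fun x => h * ws x)) <= k * `|h| ->
  nn (wt - ws) <= k -> nn (ft - fs) <= k -> nn dx <= k ->
  `|rem| <= 2 * K * - ip (ut - us) dx ->
  `|Et - Es - h * - ip ws ws| <= `|h| * (k * (1 + 8 * nn ws + 4 * nn fs + 4 + 2 * K * (nn ws + 1))).
Proof.
move=> sut sus swt sws sft sfs sdx k0 k1 K0 EI R2 Q1 Q3 Q4 Q5 RK.
set A := nn ws; set B := nn fs.
have A0 : 0 <= A by exact: nn_ge0.
have B0 : 0 <= B by exact: nn_ge0.
set C := 1 + _ + _ + _ + _.
have C0 : 0 < C.
  have : 0 <= K * (A + 1) by rewrite mulr_ge0// addr_ge0.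
  by rewrite /C; lra.
set r := P - h * ip fs (wt + ws) in R2.
have E3 : P = r + h * ip fs (wt + ws) by rewrite subrK.
rewrite {}E3 in EI.
set du := ut - us in Q1 EI RK.
set q := du - (fun x => h * ws x) in Q1.
have sdu : sqi du by exact: sqiB.
have sq : sqi q by apply: sqiB => //; exact: sqiZ.
set dw := wt - ws in Q3; set df := ft - fs in Q4.
have sdw : sqi dw by exact: sqiB.
have sdf : sqi df by exact: sqiB.
have wtE : wt + ws = dw + (ws + ws) by rewrite /dw addrA subrK.
have ftE : ft + fs = df + (fs + fs) by rewrite /df addrA subrK.
have duE : du = q + (fun x => h * ws x) by rewrite /q subrK.
have sw2 := sqiD sws sws; have sf2 := sqiD sfs sfs.
have sw := sqiD sdw sw2; have sf := sqiD sdf sf2; have swf := sqiD sw sf.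
have szw := sqiZ h sws.
have N1 : nn (wt + ws) <= 2 * A + k.
  rewrite wtE; apply: le_trans (nnD sdw sw2) _; have := nnD sws sws; rewrite -/A => N; lra.
have N2 : nn (ft + fs) <= 2 * B + k.
  rewrite ftE; apply: le_trans (nnD sdf sf2) _; have := nnD sfs sfs; rewrite -/B => N; lra.
have N3 : nn ((wt + ws) + (ft + fs)) <= 2 * A + 2 * B + 2 * k.
  apply: le_trans (nnD _ _) _; [exact: sqiD|exact: sqiD|lra].
have N4 : nn du <= (A + 1) * `|h|.
  rewrite duE; apply: le_trans (nnD sq szw) _; rewrite nnZ// -/A.
  by have := ler_wpM2r (normr_ge0 h) k1; lra.
have E4 : ip du ((wt + ws) + (ft + fs)) =
  ip q ((wt + ws) + (ft + fs)) +
  h * (ip (ws) dw + 2 * ip (ws) (ws) + ip (ws) df + 2 * ip (ws) (fs)).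
  rewrite {1}duE (ipDl sq szw); last by apply: sqiD; exact: sqiD.
  rewrite ipZl//; last by apply: sqiD; exact: sqiD.
  congr (_ + _ * _); rewrite wtE ftE (ipDr sw sf sws) (ipDr sdw sw2 sws) (ipDr sdf sf2 sws).
  rewrite (ipDr sws sws sws) (ipDr sfs sfs sws).
  by move: (ip _ _) (ip _ _) (ip _ _) (ip _ _) => *; ring.
have E5 : ip (fs) (wt + ws) = ip (fs) dw + 2 * ip (ws) (fs).
  rewrite wtE (ipDr sdw sw2 sfs) (ipDr sws sws sfs) [ip (fs) (ws)]ipC.
  by move: (ip _ _) (ip _ _) => *; ring.
rewrite {}E4 {}E5 in EI.
have C1 := cauchy_schwarz sws sdw; have C2 := cauchy_schwarz sws sdf; have C3 := cauchy_schwarz sfs sdw.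
have C4 : `|ip q ((wt + ws) + (ft + fs))| <= (k * `|h|) * (2 * A + 2 * B + 2 * k).
  apply: le_trans (cauchy_schwarz sq _) _; first by apply: sqiD; exact: sqiD.
  by apply: ler_pM => //; exact: nn_ge0.
have C5 : - ip du dx <= (A + 1) * `|h| * k.
  have := cauchy_schwarz sdu sdx; rewrite ler_norml => /andP[L _].
  have : nn du * nn dx <= (A + 1) * `|h| * k by apply: ler_pM => //; exact: nn_ge0.
  by lra.
have C6 : `|r| <= k * `|h| * (2 * A + k).
  by apply: le_trans R2 _; rewrite ler_wpM2l// mulr_ge0// ltW.
have C1' : `|ip (ws) dw| <= A * k by apply: le_trans C1 _; rewrite ler_wpM2l.
have C2' : `|ip (ws) df| <= A * k by apply: le_trans C2 _; rewrite ler_wpM2l.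
have C3' : `|ip (fs) dw| <= B * k by apply: le_trans C3 _; rewrite ler_wpM2l.
have RK' : `|rem| <= 2 * K * ((A + 1) * `|h| * k).
  by apply: le_trans RK _; rewrite ler_wpM2l// mulr_ge0.
have h0 := normr_ge0 h.
have P1 : `|h * ip (fs) dw| <= `|h| * (B * k) by rewrite normrM ler_wpM2l.
have P2 : `|h * (ip (ws) dw + ip (ws) df)| <= `|h| * (A * k + A * k).
  by rewrite normrM ler_wpM2l//; apply: le_trans (ler_normD _ _) _; exact: lerD.
have kk : `|h| * k * k <= `|h| * k by rewrite ler_piMr// mulr_ge0// ltW.
suff : `|2 * (Et - Es - h * - ip ws ws)| <= `|h| * (k * C).
  rewrite normrM ger0_norm//; have : 0 <= `|h| * (k * C) by rewrite !mulr_ge0// ltW.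
  by lra.
have -> : 2 * (Et - Es - h * - ip (ws) (ws)) =
  r + h * ip (fs) dw - ip q ((wt + ws) + (ft + fs))
  - h * (ip (ws) dw + ip (ws) df) + rem.
  rewrite mulrBr EI.
  move: (ip q _) (ip (fs) dw) (ip (ws) dw) (ip (ws) df) (ip (ws) (ws)) (ip (ws) (fs)) (rem) => *.
  by ring.
move: C4 C6 P1 P2 RK'; rewrite /C.
move: (r) (h * _) (ip q _) (h * _) (rem) => x1 x4 x3 x2 x5 C4 C6 P1 P2 RK'.
apply: le_trans (ler_normD _ _) _.
have T1 := ler_normB (x1 + x2 - x3) x4; have T2 := ler_normB (x1 + x2) x3; have T3 := ler_normD x1 x2.
have AB : 0 <= `|h| * k by rewrite mulr_ge0// ltW.
have AB1 := mulr_ge0 AB A0; have AB2 := mulr_ge0 AB B0.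
move: T1 T2 T3 C4 C6 P1 P2 RK' kk AB AB1 AB2.
move: (`|x1 + x2 - x3 - x4|) (`|x1 + x2 - x3|) (`|x1 + x2|) (`|x1|) (`|x2|) (`|x3|) (`|x4|) (`|x5|) => y1 y2 y3 z1 z2 z3 z4 z5.
move: (`|h|) => hh *.
by lra.
Qed.

End energy_estimate.

(** * Cost of a transition *)

Section wells.
Variable R : realType.
Implicit Types (W Phi sigma u p M : R -> R).

Lemma is_derive_ge0_le (f df : R -> R) (a b : R) : {within `[a, b], continuous f} ->
  (forall x, x \in `]a, b[ -> is_derive x 1 f (df x)) -> (forall x, x \in `]a, b[ -> 0 <= df x) ->
  forall x y, a <= x -> x <= y -> y <= b -> f x <= f y.
Proof.
move=> cf d d0 x y ax xy yb.
have sub z : z \in `]x, y[ -> z \in `]a, b[.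
  by rewrite !in_itv/= => /andP[xz zy]; rewrite (le_lt_trans ax)//= (lt_le_trans zy).
have cxy : {within `[x, y], continuous f}.
  by apply: continuous_subspaceW cf; apply: subset_itv; rewrite bnd_simp.
move: xy; rewrite le_eqVlt => /predU1P[->//|xy].
have [z zxy E] := MVT xy (fun z h => d z (sub z h)) cxy.
by rewrite -subr_ge0 E mulr_ge0 ?d0 ?sub// subr_ge0 ltW.
Qed.

Lemma is_derive_neg_comp (f : R -> R) (x l : R) : is_derive (- x) 1 f l ->
  is_derive x 1 (fun z : R => f (- z)) (- l).
Proof.
move=> d; have := @is_derive1_comp R f (fun z => -1 * z + 0) x l (-1).
rewrite mulrN1; move=> H; have {H} := H _ (is_derive_affine (-1) 0 x).
rewrite mulN1r addr0 => /(_ d); congr is_derive.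
by apply: funext => z /=; rewrite mulN1r addr0.
Qed.

(* [Phi] is the distance to a zero of [W] for the weight [sqrt (2 W)]; below [kappa] it is
   dominated by [W], which makes the energy of a transition layer decay exponentially. *)
Definition well W (c kappa : R) Phi sigma := [/\
  forall s : R, is_derive s 1 Phi (sigma s),
  forall s, sigma s ^+ 2 <= 2 * W s,
  forall s, 0 <= Phi s &
  forall s, 0 < Phi s -> Phi s < kappa -> sigma s ^+ 2 = 2 * W s /\ c * Phi s <= W s].

Definition density W (e : R) u p (x : R) := e / 2 * p x ^+ 2 + W (u x) / e.

Lemma density_ge0 W (e : R) u p x : 0 < e -> (forall s, 0 <= W s) -> 0 <= density W e u p x.
Proof.
move=> e0 W0; have e0' := ltW e0; apply: addr_ge0; last exact: divr_ge0.
by rewrite mulr_ge0 ?sqr_ge0// divr_ge0.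
Qed.

(** Young's inequality by completing the square. With [s = sigma (u x)] it bounds the derivative of
    [Phi (u x)] by the energy density, as in the argument of Modica and Mortola. *)
Lemma sigma_le_density W (e : R) u p (s x : R) : 0 < e -> s ^+ 2 <= 2 * W (u x) -> s * p x <= density W e u p x.
Proof.
move=> e0 sW; rewrite /density.
have : s ^+ 2 / (2 * e) <= W (u x) / e.
  rewrite ler_pdivrMr ?mulr_gt0// (_ : W (u x) / e * (2 * e) = 2 * W (u x))//.
  by field; rewrite gt_eqF.
have : 0 <= e / 2 * (p x - s / e) ^+ 2 by rewrite mulr_ge0 ?sqr_ge0// divr_ge0// ltW.
rewrite (_ : e / 2 * (p x - s / e) ^+ 2 = e / 2 * p x ^+ 2 - s * p x + s ^+ 2 / (2 * e)); first by lra.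
by field; rewrite gt_eqF.
Qed.

Section profile.
Variables (W : R -> R) (e a b : R) (u p M : R -> R).
Hypotheses (e0 : 0 < e) (W0 : forall s, 0 <= W s).
Hypotheses (cu : {within `[a, b], continuous u}) (cM : {within `[a, b], continuous M}).
Hypothesis du : forall x, x \in `]a, b[ -> is_derive x 1 u (p x).
Hypothesis dM : forall x, x \in `]a, b[ -> is_derive x 1 M (density W e u p x).

Lemma energy_nondecreasing (x y : R) : a <= x -> x <= y -> y <= b -> M x <= M y.
Proof.
apply: (is_derive_ge0_le cM dM (fun z _ => _)).
by move=> z _; exact: density_ge0.
Qed.

Lemma Phi_comp_continuous c kappa Phi sigma : well W c kappa Phi sigma -> {within `[a, b], continuous (Phi \o u)}.
Proof.
case=> dP _ _ _; apply: continuous_comp_within cu => s.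
exact: is_derive_continuous (dP s).
Qed.

Lemma transition_cost c kappa Phi sigma (x y : R) : well W c kappa Phi sigma ->
  a <= x -> x <= y -> y <= b -> Phi (u x) - Phi (u y) <= M y - M x.
Proof.
move=> w ax xy yb; have [dP sW _ _] := w.
have cF : {within `[a, b], continuous (M + (Phi \o u))}.
  by move=> z; apply: cvgD; [exact: cM|exact: (Phi_comp_continuous w)].
have dF z : z \in `]a, b[ -> is_derive z 1 (M + (Phi \o u)) (density W e u p z + sigma (u z) * p z).
  by move=> zab; have D1 := dM zab; have D2 := is_derive1_comp (dP (u z)) (du zab); exact: is_deriveD.
have := is_derive_ge0_le cF dF _ ax xy yb; rewrite !fctE /= => H.
have : M x + Phi (u x) <= M y + Phi (u y).
  apply: H => z _; have := @sigma_le_density W e u p (- sigma (u z)) z e0.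
  by rewrite sqrrN => /(_ (sW _)); rewrite mulNr; lra.
by lra.
Qed.

Lemma transition_cost' c kappa Phi sigma (x y : R) : well W c kappa Phi sigma ->
  a <= x -> x <= y -> y <= b -> Phi (u y) - Phi (u x) <= M y - M x.
Proof.
move=> w ax xy yb; have [dP sW _ _] := w.
have cF : {within `[a, b], continuous (M - (Phi \o u))}.
  by move=> z; apply: cvgB; [exact: cM|exact: (Phi_comp_continuous w)].
have dF z : z \in `]a, b[ -> is_derive z 1 (M - (Phi \o u)) (density W e u p z - sigma (u z) * p z).
  by move=> zab; have D1 := dM zab; have D2 := is_derive1_comp (dP (u z)) (du zab); exact: is_deriveB.
have := is_derive_ge0_le cF dF _ ax xy yb; rewrite !fctE /= => H.
have : M x - Phi (u x) <= M y - Phi (u y).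
  by apply: H => z _; rewrite subr_ge0; exact: sigma_le_density.
by lra.
Qed.

End profile.

(* With [g = Phi (u x)] and [m] the energy remaining to the right of [x], completing the
   square in [p] gives the differential inequality
   [((g - m) / (g + m))' >= (2 c / e) (g - m) / (g + m)]. *)
Lemma remaining_energy_ineq (g m s p w c e : R) : 0 < e -> 0 < g -> 0 <= m -> m <= g ->
  s ^+ 2 = 2 * w -> c * g <= w ->
  c / e * (g ^+ 2 - m ^+ 2) <= s * p * m + g * (e / 2 * p ^+ 2 + w / e).
Proof.
move=> e0 g0 m0 mg sw cw.
have H1 : 0 <= e * g / 2 * (p + s * m / (e * g)) ^+ 2.
  by rewrite mulr_ge0 ?sqr_ge0// divr_ge0// mulr_ge0// ltW.
have E : e * g / 2 * (p + s * m / (e * g)) ^+ 2 = e * g / 2 * p ^+ 2 + s * p * m + s ^+ 2 * m ^+ 2 / (2 * e * g).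
  by field; rewrite !gt_eqF.
rewrite {}E sw in H1.
have H2 : 0 <= (w - c * g) * (g ^+ 2 - m ^+ 2) / (e * g).
  rewrite divr_ge0 ?mulr_ge0 ?subr_ge0 ?(ltW e0) ?(ltW g0)//.
  by rewrite lerXn2r// nnegrE// ltW.
have E2 : (w - c * g) * (g ^+ 2 - m ^+ 2) / (e * g) = w * g / e - w * m ^+ 2 / (e * g) - c / e * (g ^+ 2 - m ^+ 2).
  by field; rewrite !gt_eqF.
have E3 : 2 * w * m ^+ 2 / (2 * e * g) = w * m ^+ 2 / (e * g) by field; rewrite !gt_eqF.
rewrite {}E2 in H2; rewrite {}E3 in H1.
have -> : s * p * m + g * (e / 2 * p ^+ 2 + w / e) = e * g / 2 * p ^+ 2 + s * p * m + w * g / e by field; rewrite gt_eqF.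
move: H1 H2; move: (e * g / 2 * _) (s * p * m) (w * _ / (e * g)) (w * g / e) (c / e * _) => *.
by lra.
Qed.

(** If [Phi (u a)] exceeds the energy on [[a, b]], then [g = Phi (u x)] exceeds the remaining energy
    [m] at every [x] and stays in []0, kappa[], where [remaining_energy_ineq] applies. The ratio
    [(g - m) / (g + m)] grows at rate at least [2 c / e] and equals 1 at [b], so it is exponentially
    small at [a], where moreover [g + m < kappa]. *)
Lemma well_cost W c kappa Phi sigma (e a b : R) u p M : 0 < e -> 0 < c -> a < b -> (forall s, 0 <= W s) ->
  {within `[a, b], continuous u} -> {within `[a, b], continuous M} ->
  (forall x, x \in `]a, b[ -> is_derive x 1 u (p x)) ->
  (forall x, x \in `]a, b[ -> is_derive x 1 M (density W e u p x)) ->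
  well W c kappa Phi sigma -> Phi (u a) < kappa / 2 ->
  Phi (u a) - (M b - M a) <= kappa * expR (- (2 * c * (b - a) / e)).
Proof.
move=> e0 c0 ab W0 cu cM du dM w ua; have [dP sW P0 wl] := w.
have kappa0 : 0 < kappa by have := P0 (u a); lra.
set g0 := Phi (u a) in ua *; set m0 := M b - M a.
have [le0|k0] := leP (g0 - m0) 0; first by apply: (le_trans le0); rewrite mulr_ge0 ?expR_ge0// ltW.
pose g := Phi \o u; pose m := fun x => M b - M x.
have mono := energy_nondecreasing e0 W0 cM dM.
have cg := Phi_comp_continuous cu w.
have m_ge0 x : x \in `[a, b] -> 0 <= m x.
  by rewrite in_itv/= => /andP[ax xb]; rewrite subr_ge0 mono.
have gm x : x \in `[a, b] -> m x < g x.
  rewrite in_itv/= => /andP[ax xb].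
  have := transition_cost e0 cu cM du dM w (lexx a) ax xb; rewrite -/g0 /m /g /=.
  by move: k0; rewrite /m0; lra.
(* [Phi] can rise by at most the energy spent, which is less than [Phi (u a)]; hence the bound
   [kappa / 2] on the initial value. *)
have gk x : x \in `[a, b] -> g x < kappa.
  move=> xab; have mx := m_ge0 x xab; move: xab; rewrite in_itv/= => /andP[ax xb].
  have := transition_cost' e0 cu cM du dM w (lexx a) ax xb; rewrite -/g0 /g /=.
  by move: k0 ua mx; rewrite /m0 /m; lra.
(* The ratio times the integrating factor that makes it nondecreasing. *)
pose H := fun x => (g x - m x) * (g x + m x)^-1 * expR (- (2 * c / e) * x + 0).
pose q := fun x => density W e u p x.
have Hd x : x \in `]a, b[ -> exists2 l : R, 0 <= l & is_derive x 1 H l.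
  move=> xab; have xab' := subset_itv_oo_cc xab.
  have mx := m_ge0 x xab'; have gmx := gm x xab'; have gkx := gk x xab'.
  have gx0 : 0 < g x by apply: le_lt_trans gmx.
  have gm0 : g x + m x != 0 by rewrite gt_eqF// ltr_wpDr.
  have [sE cE] := wl _ gx0 gkx.
  have Dg : is_derive x 1 g (sigma (u x) * p x) := is_derive1_comp (dP (u x)) (du x xab).
  have Dm : is_derive x 1 m (- q x).
    have := is_deriveB (is_derive_cst (M b) x 1) (dM x xab).
    by rewrite sub0r; exact.
  have D1 : is_derive x 1 (fun x => g x - m x) (sigma (u x) * p x - - q x) := is_deriveB Dg Dm.
  have D2 : is_derive x 1 (fun x => g x + m x) (sigma (u x) * p x + - q x) := is_deriveD Dg Dm.
  have D3 : is_derive x 1 (fun x => expR (- (2 * c / e) * x + 0)) (expR (- (2 * c / e) * x + 0) * (- (2 * c / e))).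
    exact: (@is_derive1_comp R expR _ x _ _ (is_derive_expR _) (is_derive_affine (- (2 * c / e)) 0 x)).
  have D4 := @is_deriveV R (fun x => g x + m x) x _ 1 gm0 D2.
  have D := is_deriveM (is_deriveM D1 D4) D3.
  eexists; last exact: D.
  have K := remaining_energy_ineq (p x) e0 gx0 mx (ltW gmx) sE cE.
  rewrite /GRing.scale /=.
  have E0 := expR_gt0 (- (2 * c / e) * x + 0).
  move: (expR _) E0 => E E0.
  have -> : forall G m' s q' : R, G + m' != 0 ->
    (G - m') / (G + m') * (E * - (2 * c / e)) + E * ((G - m') * (- (G + m') ^- 2 * (s - q')) + (G + m')^-1 * (s - - q')) =
    2 * E * (s * m' + G * q' - c / e * (G ^+ 2 - m' ^+ 2)) / (G + m') ^+ 2.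
  - by move=> G m' s q' Gm; field; rewrite Gm gt_eqF.
  - by rewrite divr_ge0 ?sqr_ge0// mulr_ge0 ?subr_ge0// mulr_ge0// ltW.
  - by [].
have cH : {within `[a, b], continuous H}.
  have cm : {within `[a, b], continuous m}.
    by move=> z; apply: cvgB; [exact: cvg_cst|exact: cM].
  have cE : {within `[a, b], continuous (fun x : R => expR (- (2 * c / e) * x + 0))}.
    apply: continuous_subspaceT => z; apply: is_derive_continuous.
  apply/subspace_continuousP => z zab; have zab' : z \in `[a, b] by [].
  apply: cvgM; last by move/subspace_continuousP : cE; exact.
  apply: cvgM; first by apply: cvgB; [move/subspace_continuousP : cg; exact|move/subspace_continuousP : cm; exact].
  apply: cvgV; last by apply: cvgD; [move/subspace_continuousP : cg; exact|move/subspace_continuousP : cm; exact].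
  by rewrite gt_eqF// ltr_wpDr ?m_ge0// (le_lt_trans (m_ge0 z zab'))// gm.
have Hab : H a <= H b.
  have Hd' x : x \in `]a, b[ -> is_derive x 1 H (derive1 H x).
    by move=> /Hd[l _ [d _]]; rewrite derive1E; exact: derivableP.
  apply: (is_derive_ge0_le cH Hd') => //; last exact: ltW.
  by move=> x /Hd[l l0 [_ dl]]; rewrite derive1E dl.
have aab : a \in `[a, b] by rewrite in_itv/= lexx ltW.
have bab : b \in `[a, b] by rewrite in_itv/= lexx andbT ltW.
have gb0 : 0 < g b by apply: le_lt_trans (gm b bab); exact: m_ge0.
have mb : m b = 0 by rewrite /m subrr.
have Hb : H b = expR (- (2 * c / e) * b + 0) by rewrite /H mb subr0 addr0 divff ?mul1r// gt_eqF.
have m00 : 0 <= m0 by exact: (m_ge0 a aab).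
have g00 : 0 < g0 + m0 by lra.
move: Hab; rewrite Hb /H -[g a]/g0 -[m a]/m0 !addr0.
rewrite -ler_pdivlMr ?expR_gt0// -expRB ler_pdivrMr// => Hab.
have -> : - (2 * c * (b - a) / e) = - (2 * c / e) * b - - (2 * c / e) * a by field; rewrite gt_eqF.
apply: (le_trans Hab); rewrite mulrC ler_wpM2r ?expR_ge0//; lra.
Qed.

Lemma well_cost_left W c kappa Phi sigma (e a b : R) u p M : 0 < e -> 0 < c -> a < b -> (forall s, 0 <= W s) ->
  {within `[a, b], continuous u} -> {within `[a, b], continuous M} ->
  (forall x, x \in `]a, b[ -> is_derive x 1 u (p x)) ->
  (forall x, x \in `]a, b[ -> is_derive x 1 M (density W e u p x)) ->
  well W c kappa Phi sigma -> Phi (u b) < kappa / 2 ->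
  Phi (u b) - (M b - M a) <= kappa * expR (- (2 * c * (b - a) / e)).
Proof.
move=> e0 c0 ab W0 cu cM du dM w ub.
have ab' : - b < - a by rewrite ltrN2.
have cneg (f : R -> R) : {within `[a, b], continuous f} -> {within `[- b, - a], continuous (fun x => f (- x))}.
  move=> cf; apply/(continuous_within_itvP _ ab'); have [cin ca cb] := (continuous_within_itvP _ ab).1 cf.
  split.
  - move=> x; rewrite in_itv/= => /andP[bx xa].
    apply: (@continuous_comp _ _ _ (fun z : R => - z) f); first exact: opp_continuous.
    by apply: cin; rewrite in_itv/= ltrNr xa ltrNl bx.
  - by rewrite opprK; exact/cvg_at_leftNP.
  - by rewrite opprK; exact/cvg_at_rightNP.
have oo x : x \in `]- b, - a[ -> - x \in `]a, b[ by rewrite !in_itv/= ltrNr andbC ltrNl.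
have c1 := cneg _ cu.
have c2 : {within `[- b, - a], continuous (fun x => - M (- x))}.
  by move=> x; apply: cvgN; exact: (cneg _ cM).
have d1 x : x \in `]- b, - a[ -> is_derive x 1 (fun x => u (- x)) (- p (- x)).
  by move=> /oo xab; apply: is_derive_neg_comp; exact: du.
have d2 x : x \in `]- b, - a[ -> is_derive x 1 (fun x => - M (- x))
    (density W e (fun x => u (- x)) (fun x => - p (- x)) x).
  move=> /oo xab; have := is_deriveN (is_derive_neg_comp (dM _ xab)).
  by rewrite opprK /density sqrrN; exact.
have H := well_cost e0 c0 ab' W0 c1 c2 d1 d2 w.
rewrite !opprK in H.
by rewrite (addrC b) (addrC (M b)); exact: H.
Qed.

End wells.

(** * Weighted distances to the two wells *)

Section double_well.
Variables (R : realType).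
Implicit Types (W Phi : R -> R).

Definition clamp (s : R) := Num.max (-1) (Num.min 1 s).
(* Truncation at the wells makes the total transition cost equal to [c0] although [u] may leave
   [[-1, 1]]. *)
Definition speed W (s : R) := Num.sqrt (2 * W (clamp s)).

Lemma clamp_id (s : R) : -1 <= s <= 1 -> clamp s = s.
Proof. by move=> /andP[s1 s2]; rewrite /clamp min_r// max_r. Qed.

Lemma clamp_ge1 (s : R) : 1 <= s -> clamp s = 1.
Proof. by move=> s1; rewrite /clamp min_l// max_r//; lra. Qed.

Lemma clamp_leN1 (s : R) : s <= -1 -> clamp s = -1.
Proof. by move=> s1; rewrite /clamp min_r ?max_l//; lra. Qed.

Lemma clampN (s : R) : clamp (- s) = - clamp s.
Proof.
have [s1|s1] := leP 1 s; first by rewrite (clamp_ge1 s1) clamp_leN1//; lra.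
have [s2|s2] := leP s (-1); first by rewrite (clamp_leN1 s2) clamp_ge1//; lra.
by rewrite !clamp_id//; apply/andP; split; lra.
Qed.

Lemma speed_continuous W : continuous W -> continuous (speed W).
Proof.
move=> cW x; have cc : {for x, continuous clamp}.
  have c1 : {for x, continuous (fun s : R => Num.min 1 s)} by apply: continuous_min; [exact: cvg_cst|exact: cvg_id].
  by apply: continuous_max; [exact: cvg_cst|exact: c1].
have c2 : {for x, continuous (W \o clamp)} by apply: continuous_comp cc _; exact: cW.
have c3 : {for x, continuous (fun s => 2 * W (clamp s))} by apply: (@continuousM _ _ (cst 2)) => //; exact: cvg_cst.
exact: (continuous_comp c3 (@sqrt_continuous R _)).
Qed.

(** All comparisons are integrated backwards from [1], where the compared functions vanish. Near
    [1], [W'' >= c^2] and [W' <= 0] give first [2 c^2 W <= W'^2], that is [c sqrt (2 W) <= - W'],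
    and from this [c Phi <= W]. *)
Lemma well_at_1 W W1 W2 (c : R) Phi : 0 < c ->
  (forall s : R, is_derive s 1 W (W1 s)) -> (forall s : R, is_derive s 1 W1 (W2 s)) ->
  continuous W2 -> W 1 = 0 -> W (-1) = 0 -> W1 1 = 0 -> (forall s, 0 <= W s) -> (forall s, s != 1 -> s != -1 -> 0 < W s) ->
  c ^+ 2 < W2 1 ->
  (forall s : R, is_derive s 1 Phi (- speed W s)) -> (forall s, 1 <= s -> Phi s = 0) ->
  exists2 kappa, 0 < kappa & well W c kappa Phi (fun s => - speed W s) /\
    exists2 d, 0 < d & forall s, 1 - d < s -> Phi s < kappa / 2.
Proof.
move=> c0 dW dW1 cW2 W1e WN1e W11 W0 Wpos cW dP Pz.
have cont (f df : R -> R) (x y : R) : (forall s : R, is_derive s 1 f (df s)) -> {within `[x, y], continuous f}.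
  by move=> d; apply: continuous_subspaceT => z; exact: is_derive_continuous (d z).
have decr s t : s <= t -> Phi t <= Phi s.
  move=> st; rewrite -lerN2.
  have cN : {within `[s, t], continuous (- Phi)} by move=> z; apply: cvgN; exact: cont dP z.
  apply: (is_derive_ge0_le cN (fun z _ => is_deriveN (dP z))) => // z _.
  by rewrite opprK sqrtr_ge0.
have P0 s : 0 <= Phi s.
  have [s1|s1] := leP 1 s; first by rewrite Pz.
  by rewrite -(Pz 1)//; apply: decr; exact: ltW.
have sp2 s : speed W s ^+ 2 = 2 * W (clamp s) by rewrite sqr_sqrtr// mulr_ge0.
have [r r0 Hr] : exists2 r : R, 0 < r & r <= 1 /\ forall s, 1 - r <= s <= 1 -> c ^+ 2 <= W2 s.
  have : \forall s \near (1 : R), c ^+ 2 < W2 s by apply: (cvgr_gt _ (cW2 1)).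
  move=> [d /= d0 Hd]; exists (Num.min 1 (d / 2)); first by rewrite lt_min ltr01 divr_gt0.
  split; first by rewrite ge_min lexx.
  move=> s /andP[s1 s2]; apply: ltW; apply: Hd => /=.
  have : Num.min 1 (d / 2) <= d / 2 by rewrite ge_min lexx orbT.
  by rewrite ger0_norm ?subr_ge0//; lra.
have [r1 HW2] := Hr.
have W2pos s : 1 - r <= s <= 1 -> 0 <= W2 s by move=> /HW2; apply: le_trans; rewrite sqr_ge0.
have r10 : 1 - r <= 1 by lra.
have W1neg s : 1 - r <= s <= 1 -> W1 s <= 0.
  move=> /andP[s1 s2]; rewrite -W11.
  apply: (@is_derive_ge0_le R W1 W2 (1 - r) 1) => //; first exact: cont dW1.
  by move=> z; rewrite in_itv/= => /andP[z1 z2]; apply: W2pos; rewrite !ltW.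
have Z s : 1 - r <= s <= 1 -> 2 * c ^+ 2 * W s <= W1 s ^+ 2.
  move=> /andP[s1 s2].
  pose F := (fun s => 2 * c ^+ 2 * W s) - (fun s => W1 s * W1 s).
  have dF (z : R) : is_derive z 1 F (2 * c ^+ 2 * W1 z - (W1 z * W2 z + W1 z * W2 z)).
    have D1 := is_deriveZ (2 * c ^+ 2) (dW z); have D2 := is_deriveM (dW1 z) (dW1 z).
    exact: (is_deriveB D1 D2).
  have : F s <= F 1.
    apply: (@is_derive_ge0_le R F _ (1 - r) 1 (cont _ _ _ _ dF) (fun z _ => dF z)) => // z.
    rewrite in_itv/= => /andP[z1 z2].
    have zz : 1 - r <= z <= 1 by rewrite !ltW.
    have := mulr_le0_ge0 (W1neg z zz) (_ : 0 <= W2 z - c ^+ 2); rewrite subr_ge0 => /(_ (HW2 z zz)).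
    by lra.
  by rewrite /F !fctE /= W1e W11 !mulr0 subrr subr_le0 expr2.
have Q s : 1 - r <= s <= 1 -> c * Phi s <= W s.
  move=> /andP[s1 s2].
  pose F := (fun s => c * Phi s) - W.
  have dF (z : R) : is_derive z 1 F (c * - speed W z - W1 z).
    have D1 := is_deriveZ c (dP z); exact: (is_deriveB D1 (dW z)).
  have : F s <= F 1.
    apply: (@is_derive_ge0_le R F _ (1 - r) 1 (cont _ _ _ _ dF) (fun z _ => dF z)) => // z.
    rewrite in_itv/= => /andP[z1 z2].
    have zz : 1 - r <= z <= 1 by rewrite !ltW.
    have : c * speed W z <= - W1 z.
      have W1z := W1neg z zz.
      rewrite -(@ler_pXn2r _ 2)// ?nnegrE ?oppr_ge0 ?mulr_ge0 ?sqrtr_ge0 ?(ltW c0)//.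
      rewrite exprMn sp2 sqrrN clamp_id; last by apply/andP; split; lra.
      by have := Z z zz; lra.
    by lra.
  by rewrite /F !fctE /= (Pz 1)// W1e mulr0 subrr subr_le0.
have k0 : 0 < Phi (1 - r).
  have rr : 1 - r < 1 by lra.
  have [z zr E] := MVT rr (fun z _ => dP z) (cont _ _ _ _ dP).
  move: zr; rewrite in_itv/= => /andP[z1 z2].
  have zp : 0 < speed W z.
    rewrite sqrtr_gt0 mulr_gt0// clamp_id; last by apply/andP; split; lra.
    apply: Wpos; first by rewrite lt_eqF.
    by rewrite gt_eqF//; lra.
  by move: E; rewrite Pz//; nra.
(* [Phi] is nonincreasing, so [0 < Phi s < Phi (1 - r)] confines [s] to []1 - r, 1[], where the
   comparisons hold. *)
exists (Phi (1 - r)) => //.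
split.
  split => //.
  - move=> s; rewrite sqrrN sp2 ler_pM2l//.
    have [s1|s1] := leP 1 s; first by rewrite clamp_ge1// W1e.
    have [s2|s2] := leP s (-1); last by rewrite clamp_id// !ltW.
    by rewrite clamp_leN1// WN1e.
  - move=> s Ps Pk.
    have s1 : s < 1 by rewrite ltNge; apply/negP => /Pz E; rewrite E ltxx in Ps.
    have s2 : 1 - r < s by rewrite ltNge; apply/negP => /decr E; lra.
    rewrite sqrrN sp2 clamp_id; last by apply/andP; split; lra.
    by split => //; apply: Q; rewrite !ltW.
have c1 : {for 1, continuous Phi} := is_derive_continuous (dP 1).
have : \forall s \near (1 : R), Phi s < Phi (1 - r) / 2.
  by apply: (cvgr_lt _ c1); rewrite Pz// divr_gt0.
move=> [d /= d0 Hd]; exists d => // s s1.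
have [s2|s2] := leP 1 s; first by rewrite Pz// divr_gt0.
by apply: Hd => /=; rewrite ger0_norm; lra.
Qed.

Transparent prim.
(** The speed vanishes below [-1], so this is the weighted distance from [-1]. The base point [-2]
    makes [-1] an interior point, as differentiation there requires. *)
Definition transition W := @prim R (-2) (speed W).

Lemma transition_eq0 W (s : R) : W (-1) = 0 -> s <= -1 -> transition W s = 0.
Proof.
move=> WN1 s1; rewrite /transition /prim.
under eq_Rintegral => z.
  rewrite inE /= in_itv/= => /andP[_ zs].
  rewrite /speed clamp_leN1 ?(le_trans zs)// WN1 mulr0 sqrtr0.
  over.
by rewrite /Rintegral integral0.
Qed.

Lemma is_derive_transition W (s : R) : continuous W -> W (-1) = 0 -> is_derive s 1 (transition W) (speed W s).
Proof.
move=> cW WN1; have [s2|s2] := ltP (-2) s.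
  have s3 : -2 < s + 1 by lra.
  apply: (@prim_is_derive R (-2) (s + 1)).
  - by apply: continuous_intg; apply: continuous_subspaceT; exact: speed_continuous.
  - by rewrite in_itv/= s2; lra.
  - exact: speed_continuous.
have -> : speed W s = 0 by rewrite /speed clamp_leN1 ?WN1 ?mulr0 ?sqrtr0//; lra.
apply: (@near_eq_is_derive R R R (cst 0)).
near=> z; rewrite /= transition_eq0//; apply: ltW; near: z; apply: lt_nbhsl; lra.
Unshelve. all: by end_near. Qed.

Lemma transition_ge1 W (s : R) : continuous W -> W 1 = 0 -> W (-1) = 0 -> 1 <= s -> transition W s = transition W 1.
Proof.
move=> cW W1 WN1 s1; apply/eqP; rewrite -subr_eq0; apply/eqP.
have Is : @intg R (-2) s (speed W) by apply: continuous_intg; apply: continuous_subspaceT; exact: speed_continuous.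
have le1 : -2 <= 1 :> R by lra.
rewrite /transition (prim_diff Is le1 s1 (lexx _)).
under eq_Rintegral => z.
  rewrite inE /= in_itv/= => /andP[zs _].
  rewrite /speed clamp_ge1 ?(ltW zs)// W1 mulr0 sqrtr0.
  over.
by rewrite /Rintegral integral0.
Qed.

Lemma transition_total W : continuous W -> W 1 = 0 -> W (-1) = 0 ->
  transition W 1 = \int[@lebesgue_measure R]_(s in `[-1, 1]) Num.sqrt (2 * W s).
Proof.
move=> cW W1 WN1; rewrite -[LHS]subr0 -(@transition_eq0 W (-1))//.
have Is : @intg R (-2) 1 (speed W) by apply: continuous_intg; apply: continuous_subspaceT; exact: speed_continuous.
have le1 : -2 <= -1 :> R by lra.
have le2 : -1 <= 1 :> R by lra.
rewrite /transition (prim_diff Is le1 le2 (lexx _)).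
rewrite Rintegral_itv_obnd_cbnd//.
  apply: eq_Rintegral => z; rewrite inE /= in_itv/= => zz.
  by rewrite /speed clamp_id.
apply: integrableS Is => //; apply: subset_itvr; rewrite bnd_simp; lra.
Qed.

(** [Phi1] and [Phi2] are the weighted distances to the wells [1] and [-1]. Their sum [c0] is the
    cost of a full transition, and [rho] tells how near a well a value must be for [well_cost] to
    apply. *)
Record profiles W (c c0 kappa1 kappa2 rho : R) Phi1 sigma1 Phi2 sigma2 : Prop := Profiles {
  profiles_c : 0 < c;
  profiles_rho : 0 < rho < 1;
  profiles_kappa1 : 0 < kappa1;
  profiles_kappa2 : 0 < kappa2;
  profiles_well1 : well W c kappa1 Phi1 sigma1;
  profiles_well2 : well W c kappa2 Phi2 sigma2;
  profiles_sum : forall s, Phi1 s + Phi2 s = c0;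
  profiles_near1 : forall s, 1 - rho < s -> Phi1 s < kappa1 / 2;
  profiles_near2 : forall s, s < -1 + rho -> Phi2 s < kappa2 / 2 }.

Lemma double_well_profiles W W1 W2 (r A : R) :
  (forall s : R, is_derive s 1 W (W1 s)) -> (forall s : R, is_derive s 1 W1 (W2 s)) ->
  continuous W2 -> W 1 = 0 -> W (-1) = 0 -> W1 1 = 0 -> W1 (-1) = 0 ->
  (forall s, 0 <= W s) -> (forall s, s != 1 -> s != -1 -> 0 < W s) ->
  0 < W2 1 -> 0 < W2 (-1) -> 0 < r -> A < r * Num.sqrt (2 * Num.min (W2 1) (W2 (-1))) ->
  exists c kappa1 kappa2 rho Phi1 sigma1 Phi2 sigma2,
    A < 2 * c * r /\
    profiles W c (\int[@lebesgue_measure R]_(s in `[-1, 1]) Num.sqrt (2 * W s)) kappa1 kappa2 rho Phi1 sigma1 Phi2 sigma2.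
Proof.
move=> dW dW1 cW2 We WNe W1e W1Ne W0 Wpos W2e W2Ne r0; set lam := Num.min _ _ => Ar.
have lam0 : 0 < lam by rewrite lt_min W2e.
have l1 : lam <= W2 1 by rewrite ge_min lexx.
have l2 : lam <= W2 (-1) by rewrite ge_min lexx orbT.
have cW : continuous W by move=> z; exact: is_derive_continuous (dW z).
(* With this choice [2 c r] is exactly the bound assumed on [A], while [c^2] stays strictly below
   [W''] at both wells. *)
pose c := Num.sqrt (lam / 2).
have c0 : 0 < c by rewrite sqrtr_gt0 divr_gt0.
have c2 : c ^+ 2 = lam / 2 by rewrite sqr_sqrtr// ltW// divr_gt0.
have Ac : A < 2 * c * r.
  apply: (lt_le_trans Ar); rewrite mulrC ler_wpM2r ?(ltW r0)//.
  rewrite -(@ler_pXn2r _ 2)// ?nnegrE ?sqrtr_ge0 ?mulr_ge0 ?(ltW c0)//.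
  by rewrite exprMn c2 sqr_sqrtr ?mulr_ge0 ?(ltW lam0)//; lra.
pose Psi := transition W.
have dPsi (s : R) : is_derive s 1 Psi (speed W s) by exact: is_derive_transition.
pose Phi1 := fun s => Psi 1 - Psi s.
have dP1 (s : R) : is_derive s 1 Phi1 (- speed W s).
  by have := is_deriveB (is_derive_cst (Psi 1) s 1) (dPsi s); rewrite sub0r; exact.
have cl1 : c ^+ 2 < W2 1 by rewrite c2; lra.
have cl2 : c ^+ 2 < W2 (-1) by rewrite c2; lra.
have P1z (s : R) : 1 <= s -> Phi1 s = 0 by move=> s1; rewrite /Phi1 /Psi (@transition_ge1 _ s)// subrr.
have [k1 k10 [w1 [d1 d10 H1]]] := well_at_1 c0 dW dW1 cW2 We WNe W1e W0 Wpos cl1 dP1 P1z.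
(* The well at [-1] is the well at [1] of the reflected potential. *)
pose V := fun s : R => W (- s).
have dV (s : R) : is_derive s 1 V (- W1 (- s)) by apply: is_derive_neg_comp.
have dV1 (s : R) : is_derive s 1 (fun s => - W1 (- s)) (W2 (- s)).
  by have D := is_deriveN (is_derive_neg_comp (dW1 (- s))); rewrite opprK in D.
have cV2 : continuous (fun s : R => W2 (- s)).
  by move=> z; apply: (@continuous_comp _ _ _ (fun z : R => - z) W2); [exact: opp_continuous|exact: cW2].
have speedV (s : R) : speed V s = speed W (- s) by rewrite /speed /V clampN.
have dP2 (s : R) : is_derive s 1 (fun s => Psi (- s)) (- speed V s).
  by rewrite speedV; exact: is_derive_neg_comp.
have [k2 k20 [w2 [d2 d20 H2]]] : exists2 kappa, 0 < kappa & well V c kappa (fun s => Psi (- s)) (fun s => - speed V s) /\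
    exists2 d, 0 < d & forall s, 1 - d < s -> Psi (- s) < kappa / 2.
  apply: (well_at_1 c0 dV dV1 cV2) => //; rewrite /V ?opprK//.
  - by rewrite W1Ne oppr0.
  - by move=> s s1 s2; apply: Wpos; rewrite eqr_oppLR ?opprK.
  - by move=> s s1; rewrite /Psi transition_eq0//; lra.
have w2' : well W c k2 Psi (speed W).
  have [_ q1 q2 q3] := w2.
  split => // s; have sV := speedV (- s); rewrite opprK in sV.
  - by have := q1 (- s); rewrite sqrrN sV /V opprK.
  - by have := q2 (- s); rewrite opprK.
  - by have := q3 (- s); rewrite sqrrN sV /V opprK.
pose rho := Num.min (1 / 2) (Num.min d1 d2).
have rd1 : rho <= d1 by rewrite !ge_min lexx orbT.
have rd2 : rho <= d2 by rewrite !ge_min lexx !orbT.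
exists c, k1, k2, rho, Phi1, (fun s => - speed W s), Psi, (speed W); split => //; split => //.
- rewrite !lt_min d10 d20 divr_gt0//=.
  have : rho <= 1 / 2 by rewrite ge_min lexx.
  by lra.
- by move=> s; rewrite /Phi1 subrK; exact: transition_total.
- by move=> s s1; apply: H1; lra.
- by move=> s s1; rewrite -[s]opprK; apply: H2; lra.
Qed.
End double_well.
Opaque prim.

(** * Lower bound of the energy near the jumps *)

Section interface_energy.
Variable R : realType.
Local Notation mu := (@lebesgue_measure R).
Implicit Types (W Phi sigma u p M : R -> R).

Lemma prim_ge (a b : R) (f : R -> R) (k x y : R) : intg a b f -> a <= x -> x <= y -> y <= b ->
  (forall z, x < z -> z <= y -> k <= f z) -> k * (y - x) <= prim a f y - prim a f x.
Proof.
move=> If ax xy yb fk; rewrite (prim_diff If ax xy yb).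
have -> : k * (y - x) = \int[mu]_(z in `]x, y]) cst k z.
  rewrite Rintegral_cst//= lebesgue_measure_itv/= lte_fin.
  by have [//|] := ltP x y; move=> yx; rewrite (_ : y - x = 0) //; apply/eqP; rewrite subr_eq0 eq_le xy yx.
apply: le_Rintegral => //.
- by apply: integrableS (intg_cst x y k) => //; exact: subset_itv_oc_cc.
- by apply: integrableS If => //; apply: subset_itv; rewrite bnd_simp.
- by move=> z /=; rewrite in_itv/= => /andP[*]; exact: fk.
Qed.

(** Where [g >= rho], [bar g] increases at rate at least [rho]. According to its sign at the
    midpoint, it is at least [rho l / 8] in absolute value on a piece of length [l / 4] to the right
    or to the left, starting [l / 8] away from the midpoint. *)
Lemma bar_gap (a b : R) (ab : a < b) (g : R -> R) (rho al l : R) : intg a b g -> 0 <= rho -> 0 < l -> a <= al -> al + l <= b ->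
  (forall z, al < z -> z < al + l -> rho <= g z) ->
  (rho * l / 8) ^+ 2 * (l / 4) <= ip a b (bar a b g) (bar a b g).
Proof.
move=> Ig rho0 l0 aal alb gr.
set G := bar a b g.
have sG : sqi a b G by exact: bar_sqi.
have inc x y : al < x -> x <= y -> y < al + l -> rho * (y - x) <= G y - G x.
  move=> x1 xy y1; rewrite /G !barE; have -> : forall p q s : R, p - s - (q - s) = p - q by move=> *; ring.
  have ax : a <= x by lra.
  have yb : y <= b by lra.
  exact: (prim_ge Ig ax xy yb (fun z z1 z2 => gr z (lt_trans x1 z1) (le_lt_trans z2 y1))).
have main x : al < x -> x < al + l -> x + l / 4 < al + l -> (forall z, x < z -> z <= x + l / 4 -> (rho * l / 8) ^+ 2 <= G z ^+ 2) ->
    (rho * l / 8) ^+ 2 * (l / 4) <= ip a b G G.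
  move=> x1 x2 x3 H.
  have IG : intg a b (fun z => G z ^+ 2) by case: sG.
  have -> : ip a b G G = prim a (fun z => G z ^+ 2) b.
    by rewrite primE_b; apply: eq_Iab => z _; rewrite fctE expr2.
  have ax : a <= x by lra.
  have xb : x + l / 4 <= b by lra.
  have xx : x <= x + l / 4 by lra.
  have xxb : x <= b by lra.
  have axx : a <= x + l / 4 by lra.
  have sq0 z : 0 <= G z ^+ 2 by exact: sqr_ge0.
  have := prim_ge IG ax xx xb H.
  have := prim_ge IG (lexx a) ax xxb (fun z _ _ => sq0 z).
  have := prim_ge IG axx xb (lexx b) (fun z _ _ => sq0 z).
  rewrite (@primE_a R a) (_ : x + l / 4 - x = l / 4); last by ring.
  move: (_ * (l / 4)) (prim _ _ _) (prim _ _ _) (prim _ _ _) => *; lra.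
have rl0 : 0 <= rho * l / 8 by rewrite divr_ge0// mulr_ge0// ltW.
have [Gm|Gm] := leP 0 (G (al + l / 2)).
- apply: (main (al + 5 * l / 8)); try lra.
  move=> z z1 z2.
  have := inc (al + l / 2) z; move=> /(_ ltac:(lra) ltac:(lra) ltac:(lra)) H.
  have : rho * (l / 8) <= rho * (z - (al + l / 2)) by rewrite ler_wpM2l//; lra.
  move=> H2; rewrite lerXn2r// ?nnegrE//; lra.
- apply: (main (al + l / 8)); try lra.
  move=> z z1 z2; rewrite -[G z ^+ 2]sqrrN.
  have := inc z (al + l / 2); move=> /(_ ltac:(lra) ltac:(lra) ltac:(lra)) H.
  have : rho * (l / 8) <= rho * ((al + l / 2) - z) by rewrite ler_wpM2l//; lra.
  move=> H2; rewrite lerXn2r// ?nnegrE//; lra.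
Qed.


(** Between [y1] and [y2] the energy is at least [Pl (u y2) - Pl (u y1) = c0 - Pr (u y2) - Pl (u
    y1)]. The two missing terms are paid on the outer pieces. Being within [r - A / (2 c)] of [h],
    the points leave pieces longer than [A / (2 c)], for which [well_cost] gives the factor
    [exp (- A / e)]. *)
Lemma jump_cost W c c0 kl kr (e a b h r A y1 y2 : R) Pl sl Pr sr u p M : 0 < e -> 0 < c -> (forall s, 0 <= W s) ->
  0 < kl -> 0 < kr ->
  {within `[a, b], continuous u} -> {within `[a, b], continuous M} ->
  (forall x, x \in `]a, b[ -> is_derive x 1 u (p x)) ->
  (forall x, x \in `]a, b[ -> is_derive x 1 M (density W e u p x)) ->
  well W c kl Pl sl -> well W c kr Pr sr -> (forall s, Pl s + Pr s = c0) ->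
  a <= h - r -> h + r <= b -> A < 2 * c * r -> 0 < A ->
  h - (r - A / (2 * c)) < y1 -> y1 < h -> h < y2 -> y2 < h + (r - A / (2 * c)) ->
  Pl (u y1) < kl / 2 -> Pr (u y2) < kr / 2 ->
  c0 - (kl + kr) * expR (- (A / e)) <= M (h + r) - M (h - r).
Proof.
move=> e0 cpos W0 kl0 kr0 cu cM du dM wl wr PP ah hb Ac A0 hy1 y1h hy2 y2h Pl1 Pr2.
have Ac0 : 0 < A / (2 * c) by rewrite divr_gt0// mulr_gt0.
have sub x y : a <= x -> y <= b -> [/\ {within `[x, y], continuous u}, {within `[x, y], continuous M},
  (forall z, z \in `]x, y[ -> is_derive z 1 u (p z)) &
  (forall z, z \in `]x, y[ -> is_derive z 1 M (density W e u p z))].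
  move=> ax yb.
  have S : [set` `[x, y]] `<=` [set` `[a, b]] by apply: subset_itv; rewrite bnd_simp.
  have S' z : z \in `]x, y[ -> z \in `]a, b[.
    by rewrite !in_itv/= => /andP[xz zy]; rewrite (le_lt_trans ax)//= (lt_le_trans zy).
  split; [exact: continuous_subspaceW cu|exact: continuous_subspaceW cM|by move=> z /S' /du|by move=> z /S' /dM].
have expb (l : R) : A / (2 * c) <= l -> expR (- (2 * c * l / e)) <= expR (- (A / e)).
  move=> Al; rewrite ler_expR lerN2 ler_pM2r ?invr_gt0//.
  by rewrite -ler_pdivrMl ?mulr_gt0// mulrC.
have R1 : Pr (u y2) - (M (h + r) - M y2) <= kr * expR (- (A / e)).
  have ay2 : a <= y2 by lra.
  have [c1 c2 d1 d2] := sub y2 (h + r) ay2 hb.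
  have y2r : y2 < h + r by lra.
  apply: le_trans (well_cost e0 cpos y2r W0 c1 c2 d1 d2 wr Pr2) _.
  by rewrite ler_wpM2l ?(ltW kr0)// expb//; lra.
have R2 : Pl (u y1) - (M y1 - M (h - r)) <= kl * expR (- (A / e)).
  have y1b : y1 <= b by lra.
  have [c1 c2 d1 d2] := sub (h - r) y1 ah y1b.
  have y1r : h - r < y1 by lra.
  apply: le_trans (well_cost_left e0 cpos y1r W0 c1 c2 d1 d2 wl Pl1) _.
  by rewrite ler_wpM2l ?(ltW kl0)// expb//; lra.
have ay1 : a <= y1 by lra.
have y12 : y1 <= y2 by lra.
have y2b : y2 <= b by lra.
have := transition_cost' e0 cu cM du dM wl ay1 y12 y2b.
have := PP (u y2); rewrite mulrDl.
move: R1 R2; move: (_ * expR _) (_ * expR _) (Pl _) (Pl _) (Pr _) (M _) (M _) (M _) (M _) => *; lra.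
Qed.

(** Otherwise [v - u] or [u - v] would be at least [rho] on the whole interval, against
    [bar_gap]. *)
Lemma near_value (a b : R) (ab : a < b) u v (s rho al l : R) : intg a b u -> intg a b v -> 0 <= rho -> 0 < l ->
  a <= al -> al + l <= b -> (forall z, al < z -> z < al + l -> v z = s) ->
  ip a b (bar a b u - bar a b v) (bar a b u - bar a b v) < (rho * l / 8) ^+ 2 * (l / 4) ->
  (exists y, [/\ al < y, y < al + l & s - rho < u y]) /\ (exists y, [/\ al < y, y < al + l & u y < s + rho]).
Proof.
move=> Iu Iv rho0 l0 aal alb vs small; split.
- apply: contrapT => /forallNP H.
  suff : (rho * l / 8) ^+ 2 * (l / 4) <= ip a b (bar a b u - bar a b v) (bar a b u - bar a b v) by rewrite leNgt small.
  have -> : ip a b (bar a b u - bar a b v) (bar a b u - bar a b v) = ip a b (bar a b (v - u)) (bar a b (v - u)).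
    by apply: eq_Iab => x xab; rewrite !fctE (barB ab Iv Iu xab); move: (bar a b u x) (bar a b v x) => *; ring.
  apply: (@bar_gap _ _ ab _ rho al l) => //; first exact: intgB.
  move=> z z1 z2; rewrite !fctE vs//; rewrite leNgt; apply/negP => lt; apply: (H z); split => //; lra.
- apply: contrapT => /forallNP H.
  suff : (rho * l / 8) ^+ 2 * (l / 4) <= ip a b (bar a b u - bar a b v) (bar a b u - bar a b v) by rewrite leNgt small.
  have -> : ip a b (bar a b u - bar a b v) (bar a b u - bar a b v) = ip a b (bar a b (u - v)) (bar a b (u - v)).
    by apply: eq_Iab => x xab; rewrite !fctE (barB ab Iu Iv xab).
  apply: (@bar_gap _ _ ab _ rho al l) => //; first exact: intgB.
  move=> z z1 z2; rewrite !fctE vs//; rewrite leNgt; apply/negP => lt; apply: (H z); split => //; lra.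
Qed.

End interface_energy.

Section several_jumps.
Variable R : realType.
Implicit Types (W Phi sigma u v p M : R -> R).

Lemma jump_lower_bound W c c0 k1 k2 rho P1 s1 P2 s2 (e a b : R) u v p M (h r A s : R) :
  a < b -> profiles W c c0 k1 k2 rho P1 s1 P2 s2 -> 0 < e -> (forall s, 0 <= W s) -> 0 < A -> A < 2 * c * r ->
  {within `[a, b], continuous u} -> {within `[a, b], continuous M} ->
  (forall x, x \in `]a, b[ -> is_derive x 1 u (p x)) ->
  (forall x, x \in `]a, b[ -> is_derive x 1 M (density W e u p x)) ->
  intg a b v -> a <= h - r -> h + r <= b -> s = 1 \/ s = -1 ->
  (forall z, h - r < z -> z < h -> v z = s) -> (forall z, h < z -> z < h + r -> v z = - s) ->
  ip a b (bar a b u - bar a b v) (bar a b u - bar a b v) <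
    (rho * (r - A / (2 * c)) / 8) ^+ 2 * ((r - A / (2 * c)) / 4) ->
  c0 - (k1 + k2) * expR (- (A / e)) <= M (h + r) - M (h - r).
Proof.
move=> ab [cpos /andP[rho0 rho1] k10 k20 w1 w2 PP n1 n2] e0 W0 A0 Ac cu cM du dM Iv ah hb s_1 vl vr small.
have Iu : intg a b u by exact: continuous_intg.
have Ac0 : 0 < A / (2 * c) by rewrite divr_gt0// mulr_gt0.
have l0 : 0 < r - A / (2 * c) by rewrite subr_gt0 ltr_pdivrMr ?mulr_gt0// mulrC.
pose l := r - A / (2 * c); rewrite -/l in l0 small.
have lr : l < r by rewrite /l; lra.
have i1 : a <= h - l by lra.
have i2 : h - l + l <= b by lra.
have i3 : a <= h by lra.
have i4 : h + l <= b by lra.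
have vl' z : h - l < z -> z < h - l + l -> v z = s by move=> *; apply: vl; lra.
have vr' z : h < z -> z < h + l -> v z = - s by move=> *; apply: vr; lra.
have [L1 L2] := near_value ab Iu Iv (ltW rho0) l0 i1 i2 vl' small.
have [R1 R2] := near_value ab Iu Iv (ltW rho0) l0 i3 i4 vr' small.
case: s_1 => s_; subst s.
- have [y1 [y11 y12 y13]] := L1.
  have [y2 [y21 y22 y23]] := R2.
  have y1h : y1 < h by lra.
  exact: (jump_cost e0 cpos W0 k10 k20 cu cM du dM w1 w2 PP ah hb Ac A0 y11 y1h y21 y22 (n1 _ y13) (n2 _ y23)).
- have [y1 [y11 y12 y13]] := L2.
  have [y2 [y21 y22 y23]] := R1; rewrite opprK in y23.
  have y1h : y1 < h by lra.
  have PP' z : P2 z + P1 z = c0 by rewrite addrC.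
  rewrite (addrC k1).
  exact: (jump_cost e0 cpos W0 k20 k10 cu cM du dM w2 w1 PP' ah hb Ac A0 y11 y1h y21 y22 (n2 _ y13) (n1 _ y23)).
Qed.

Section partition.
Variables (a b r : R) (N : nat) (h : nat -> R) (v : R -> R).
Hypotheses (N0 : (0 < N)%N) (pw : pw_const_jumps a b N h v) (r0 : 0 < r).
Hypothesis disj : forall i j, (1 <= i <= N)%N -> (1 <= j <= N)%N -> i != j ->
  forall x, ~ (h i - r < x < h i + r /\ h j - r < x < h j + r).
Hypotheses (ah : a <= h 1%N - r) (hb : h N + r <= b).

Lemma jump_gap i : (1 <= i < N)%N -> h i + r <= h i.+1 - r.
Proof.
move=> iN; have /andP[i1 iN'] := iN; rewrite leNgt; apply/negP => lt.
have [[_ hh _] _ _ _] := pw; have hi := hh i iN.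
(* The midpoint of the overlap lies in both intervals. *)
apply: (@disj i i.+1 _ _ _ ((h i + r + (h i.+1 - r)) / 2)).
- by rewrite i1 ltnW.
- by rewrite iN'.
- by rewrite neq_ltn ltnSn.
- by split; apply/andP; split; lra.
Qed.

Lemma jump_left i : (1 <= i <= N)%N -> a <= h i - r.
Proof.
elim: i => // -[|i] IH; first by [].
move=> iN; have iN' : (1 <= i.+1 < N)%N by [].
have := IH (ltnW iN); have := jump_gap iN'; move: (h i.+1) (h i.+2) => x y; move: r0; lra.
Qed.

Lemma jump_right i : (1 <= i <= N)%N -> h i + r <= b.
Proof.
move=> /andP[i1 iN]; rewrite -(subKn iN); have : (N - i < N)%N by rewrite ltn_subrL i1 N0.
elim: (N - i)%N => [|k IH] kN; first by rewrite subn0.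
have := IH (ltnW kN); have := @jump_gap (N - k.+1); rewrite subnSK ?(ltnW kN)// subn_gt0 kN leq_subr => /(_ isT).
move: (h _) (h _) => x y; move: r0; lra.
Qed.

Lemma jump_values i : (1 <= i <= N)%N -> exists2 s : R, s = 1 \/ s = -1 &
  (forall z, h i - r < z -> z < h i -> v z = s) /\ (forall z, h i < z -> z < h i + r -> v z = - s).
Proof.
move=> iN; have /andP[i1 iN'] := iN; have [_ v1 vc vj] := pw; have rp := r0.
have al := jump_left iN; have br := jump_right iN.
have extl : ext_pts a b N h i.-1 <= h i - r.
  case: i i1 iN' iN al br => // -[|i] _ iN' iN al br /=; first exact: al.
  rewrite /ext_pts/= ltnW//.
  by have := @jump_gap i.+1; rewrite /= => /(_ iN'); move: r0; lra.
have exti : ext_pts a b N h i = h i by rewrite /ext_pts iN'; case: (i) i1.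
have extr : h i + r <= ext_pts a b N h i.+1.
  rewrite /ext_pts /=; case: ltnP => // iN2.
  by have := @jump_gap i; rewrite i1 iN2 => /(_ isT); move: r0; lra.
have pl z : h i - r < z -> z < h i -> ext_pts a b N h i.-1 < z < ext_pts a b N h i.
  by rewrite exti => z1 z2; apply/andP; split; lra.
have pr z : h i < z -> z < h i + r -> ext_pts a b N h i < z < ext_pts a b N h i.+1.
  by rewrite exti => z1 z2; apply/andP; split; lra.
have l1 : h i - r < h i - r / 2 by lra.
have l2 : h i - r / 2 < h i by lra.
have r1 : h i < h i + r / 2 by lra.
have r2 : h i + r / 2 < h i + r by lra.
exists (v (h i - r / 2)); first by apply: v1; apply/andP; split; lra.
have i11 : i.-1.+1 = i by rewrite prednK.
split => z z1 z2.
  by apply: (vc i.-1); rewrite ?i11 ?pl// (leq_trans (leq_pred _)).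
have -> : v z = v (h i + r / 2) by apply: (vc i) => //; exact: pr.
have ne := vj i iN _ _ _ _.
have {ne} : v (h i - r / 2) <> v (h i + r / 2).
  by apply: (vj i iN); [have := pl _ l1 l2; rewrite exti|have := pr _ r1 r2; rewrite exti].
have [->|->] : v (h i - r / 2) = 1 \/ v (h i - r / 2) = -1 by apply: v1; apply/andP; split; lra.
  by have [->|->] : v (h i + r / 2) = 1 \/ v (h i + r / 2) = -1 by apply: v1; apply/andP; split; lra.
have [->|->] : v (h i + r / 2) = 1 \/ v (h i + r / 2) = -1 by apply: v1; apply/andP; split; lra.
  by rewrite opprK.
by [].
Qed.

Lemma monotone_jumps (K : R) M : (forall x y, a <= x -> x <= y -> y <= b -> M x <= M y) ->
  (forall i, (1 <= i <= N)%N -> K <= M (h i + r) - M (h i - r)) ->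
  N%:R * K <= M b - M a.
Proof.
move=> mono MK; have rp := r0.
have H k : (1 <= k <= N)%N -> k%:R * K <= M (h k + r) - M a.
  elim: k => // -[|k] IH kN.
    have := MK 1%N kN; have := jump_left kN.
    have h1 : h 1%N - r <= b by have := jump_right kN; lra.
    by move=> /(mono _ _ (lexx a)) /(_ h1); rewrite mul1r; lra.
  have kN' : (1 <= k.+1 <= N)%N := ltnW kN.
  have g := @jump_gap k.+1 kN.
  have a1 : a <= h k.+1 + r by have := jump_left kN'; lra.
  have b1 : h k.+2 - r <= b by have := jump_right kN; lra.
  have := mono _ _ a1 g b1; have := IH kN'; have := MK _ kN.
  by rewrite [k.+2%:R]mulrS mulrDl mul1r; lra.
have NN : (1 <= N <= N)%N by rewrite N0 leqnn.
have a1 : a <= h N + r by have := jump_left NN; lra.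
by have := H N NN; have := mono _ _ a1 hb (lexx b); lra.
Qed.

End partition.

(** The weak derivative is replaced by its continuous representative [V], for which the primitive
    [M] of the density is differentiable, as the estimates at each jump require. *)
Lemma interface_energy W c c0 k1 k2 rho P1 s1 P2 s2 (e a b : R) u v ux uxx (h : nat -> R) (N : nat) (r A : R) :
  a < b -> profiles W c c0 k1 k2 rho P1 s1 P2 s2 -> 0 < e -> continuous W -> (forall s, 0 <= W s) -> 0 < A -> A < 2 * c * r ->
  {within `[a, b], continuous u} -> sqi a b ux -> sqi a b uxx -> wder a b u ux -> wder a b ux uxx ->
  intg a b v -> (0 < N)%N -> pw_const_jumps a b N h v -> 0 < r ->
  (forall i j, (1 <= i <= N)%N -> (1 <= j <= N)%N -> i != j ->
     forall x, ~ (h i - r < x < h i + r /\ h j - r < x < h j + r)) ->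
  a <= h 1%N - r -> h N + r <= b ->
  ip a b (bar a b u - bar a b v) (bar a b u - bar a b v) <
    (rho * (r - A / (2 * c)) / 8) ^+ 2 * ((r - A / (2 * c)) / 4) ->
  N%:R * (c0 - (k1 + k2) * expR (- (A / e))) <= e / 2 * ip a b ux ux + e^-1 * Iab a b (W \o u).
Proof.
move=> ab Pr e0 cW W0 A0 Ac cu sux suxx w1 w2 Iv N0 pw r0 disj ah hb small.
have [V cV [n0 du]] := slice_C1 ab cu sux suxx w1 w2.
have sV := continuous_sqi cV.
have cWu : {within `[a, b], continuous (W \o u)} by exact: continuous_comp_within.
have cd : {within `[a, b], continuous (density W e u V)}.
  move=> x; apply: cvgD; last by apply: cvgMl; exact: cWu.
  by apply: cvgMr; exact: (continuous_comp_within (@exprn_continuous R 2) cV).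
have Id := continuous_intg cd.
pose M := prim a (density W e u V).
have cM : {within `[a, b], continuous M} by exact: prim_continuous.
have dM x : x \in `]a, b[ -> is_derive x 1 M (density W e u V x).
  by move=> xab; apply: (prim_is_derive Id xab); exact: within_continuous_in cd xab.
have -> : e / 2 * ip a b ux ux + e^-1 * Iab a b (W \o u) = M b - M a.
  have E : ip a b ux ux = ip a b V V.
    by rewrite (ip_nn0 sux sV sux n0) ipC (ip_nn0 sux sV sV n0).
  rewrite E /M (@primE_a R a) subr0 primE_b.
  have -> : density W e u V = (fun x => e / 2 * (V * V) x) + (fun x => e^-1 * (W \o u) x).
    by apply: funext => x; rewrite /density !fctE /= (mulrC e^-1) expr2.
  have IWu := continuous_intg cWu; have IVV := intgM sV sV.
  by rewrite IabD; [rewrite !IabZ|exact: intgZ..].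
apply: (monotone_jumps N0 pw r0 disj ah hb).
  by move=> x y; exact: (energy_nondecreasing e0 W0 cM dM).
move=> i iN; have [s s_1 [vl vr]] := jump_values N0 pw r0 disj ah hb iN.
have al := jump_left pw r0 disj ah iN.
have br := jump_right N0 pw r0 disj hb iN.
exact: (jump_lower_bound ab Pr e0 W0 A0 Ac cu cM du dM Iv al br s_1 vl vr small).
Qed.
End several_jumps.

(** * Energy dissipation along the flow *)

Lemma continuous_bounded_on (R : realType) (G : R -> R) (M : R) : continuous G ->
  exists2 K : R, 0 <= K & forall x : R, `|x| <= M -> `|G x| <= K.
Proof.
move=> cG; have [M0|M0] := leP 0 M; last first.
  by exists 0 => // x xM; have := normr_ge0 x; lra.
have cn : {within `[- M, M], continuous (fun x => `|G x|)}.
  apply: continuous_subspaceT => x.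
  by apply: (@continuous_comp _ _ _ G (fun z : R => `|z|)); [exact: cG|exact: norm_continuous].
have NM : - M <= M by lra.
have [c _ H] := EVT_max NM cn; exists `|G c| => // x.
by rewrite ler_norml => xM; apply: H; rewrite in_itv.
Qed.

Lemma lipschitz_on (R : realType) (F G : R -> R) (M : R) : (forall y : R, is_derive y 1 F (G y)) -> continuous G ->
  exists2 K : R, 0 <= K & forall x y : R, `|x| <= M -> `|y| <= M -> `|F x - F y| <= K * `|x - y|.
Proof.
move=> dF cG; have [K K0 H] := continuous_bounded_on M cG.
exists K => //; move=> x y.
wlog xy : x y / y <= x => [W xM yM|xM yM].
  have [yx|/ltW xy] := leP y x; first exact: W.
  by rewrite distrC (distrC x); exact: W.
have cF : {within `[y, x], continuous F}.
  by apply: continuous_subspaceT => z; exact: is_derive_continuous (dF z).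
have [z zxy ->] := MVT_segment xy (fun z _ => dF z) cF.
rewrite normrM ler_wpM2r// H//.
move: zxy xM yM; rewrite in_itv/= !ler_norml => /andP[z1 z2] /andP[x1 x2] /andP[y1 y2].
by rewrite (le_trans y1)//= (le_trans z2).
Qed.

Section flow.
Variables (R : realType) (a b tau e : R) (W W1 W2 W3 : R -> R) (alpha beta : R).
Hypotheses (ab : a < b) (tau0 : 0 < tau).
Hypothesis dW : forall y : R, is_derive y 1 W (W1 y).
Hypothesis dW1 : forall y : R, is_derive y 1 W1 (W2 y).
Hypothesis dW2 : forall y : R, is_derive y 1 W2 (W3 y).
Hypothesis cW3 : continuous W3.
Hypotheses (W1a : W1 alpha = 0) (W1b : W1 beta = 0).
Variables (U Ux Uxx Uxxx Ut : R -> R -> R).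
Local Notation intg := (intg a b).
Local Notation sqi := (sqi a b).
Local Notation Iab := (Iab a b).
Local Notation nn := (nn a b).
Local Notation ip := (ip a b).
Local Notation prim := (prim a).
Local Notation wder := (wder a b).
Local Notation bar := (bar a b).
Local Notation dtest := (dtest a b).
Local Notation test_gen := (test_gen a b).
Local Notation time_cont := (time_cont a b).
Hypothesis sUx : forall t : R, 0 <= t -> sqi (Ux t).
Hypothesis sUxx : forall t : R, 0 <= t -> sqi (Uxx t).
Hypothesis sUxxx : forall t : R, 0 <= t -> sqi (Uxxx t).
Hypothesis sUt : forall t : R, 0 <= t -> sqi (Ut t).
Hypothesis wUx : forall t : R, 0 <= t -> wder (U t) (Ux t).
Hypothesis wUxx : forall t : R, 0 <= t -> wder (Ux t) (Uxx t).
Hypothesis wUxxx : forall t : R, 0 <= t -> wder (Uxx t) (Uxxx t).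
Hypothesis tUx : forall t : R, 0 <= t -> time_cont t Ux.
Hypothesis tUxxx : forall t : R, 0 <= t -> time_cont t Uxxx.
Hypothesis tUt : forall t : R, 0 <= t -> time_cont t Ut.
Hypothesis cU : forall t : R, 0 <= t -> {within `[a, b], continuous (U t)}.
Hypothesis Ua : forall t : R, 0 <= t -> U t a = alpha.
Hypothesis Ub : forall t : R, 0 <= t -> U t b = beta.
Hypothesis cUxx : forall t : R, 0 <= t -> {within `[a, b], continuous (Uxx t)}.
Hypothesis Uxxa : forall t : R, 0 <= t -> Uxx t a = 0.
Hypothesis Uxxb : forall t : R, 0 <= t -> Uxx t b = 0.
Hypothesis dU : forall psi, test_gen psi -> forall t : R, 0 < t ->
  is_derive t 1 (fun s : R => ip (U s) psi) (ip (Ut t) psi).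
Hypothesis dUt : forall psi, test_gen psi -> forall t : R, 0 < t ->
  exists D, is_derive t 1 (fun s : R => ip (Ut s) psi) D /\
    tau * D + ip (Ut t) psi =
    ip (fun x => - (e ^+ 2) * Uxx t x + W1 (U t x)) (derive1 (derive1 psi)).

Definition ubar (t : R) := bar (U t).
Definition wbar (t : R) := bar (Ut t).
(** The equation integrated once in [x] says that this combination has time derivative [flux], the
    [x]-derivative of [chem]. *)
Definition momentum (t x : R) := tau * wbar t x + ubar t x.
Definition flux (t : R) := (fun x => - (e ^+ 2) * Uxxx t x) + (W2 \o U t) * Ux t.
Definition chem (t x : R) := - (e ^+ 2) * Uxx t x + W1 (U t x).

Let cW2 : continuous W2.
Proof. by move=> y; exact: is_derive_continuous (dW2 y). Qed.
Let cW1 : continuous W1.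
Proof. by move=> y; exact: is_derive_continuous (dW1 y). Qed.
Let cW : continuous W.
Proof. by move=> y; exact: is_derive_continuous (dW y). Qed.

Let sU (t : R) : 0 <= t -> sqi (U t). Proof. by move=> t0; apply: continuous_sqi; exact: cU. Qed.

Let aab : a \in `[a, b]. Proof. by rewrite in_itv/= lexx ltW. Qed.
Let bab : b \in `[a, b]. Proof. by rewrite in_itv/= lexx ltW. Qed.

Let W2U_bounded (t : R) : 0 <= t -> exists2 K : R, 0 <= K & forall x : R, x \in `[a, b] -> `|(W2 \o U t) x| <= K.
Proof.
move=> t0; have [K HK] := continuous_itv_bounded ab (continuous_comp_within cW2 (cU t0)).
by exists K => //; apply: le_trans (HK a aab).
Qed.

Let mW2U (t : R) : 0 <= t -> meas a b (W2 \o U t).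
Proof. by move=> t0; apply: intg_meas; apply: continuous_intg; apply: continuous_comp_within => //; exact: cU. Qed.

Let sW2Ux (t : R) : 0 <= t -> sqi ((W2 \o U t) * Ux t).
Proof.
by move=> t0; have [K _ HK] := W2U_bounded t0; apply: sqiMb HK _; [exact: mW2U|exact: sUx].
Qed.

Lemma flux_sqi (t : R) : 0 <= t -> sqi (flux t).
Proof. by move=> t0; apply: sqiD; [apply: sqiZ; exact: sUxxx|exact: sW2Ux]. Qed.

Lemma chem_prim (t x : R) : 0 <= t -> x \in `[a, b] -> chem t x = prim (flux t) x.
Proof.
move=> t0 xab; have xb : x <= b by rewrite (itvP xab).
rewrite /flux (primD (b := b))//; last 2 first.
- by apply: intgZ; apply: sqi_intg; exact: sUxxx.
- by apply: sqi_intg; exact: sW2Ux.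
rewrite (primZ (b := b))//; last by apply: sqi_intg; exact: sUxxx.
rewrite (prim_comp_derive ab dW1 cW2 (cU t0) (sUx t0) (sUxx t0) (wUx t0) (wUxx t0) xab).
rewrite Ua// W1a subr0 /chem; congr (_ * _ + _).
by rewrite (wder_continuous ab (cUxx t0) (sUxxx t0) (wUxxx t0) xab) Uxxa// add0r.
Qed.

(** The boundary conditions make [chem] vanish at both ends. Zero mean is what allows the flux to be
    paired with [ubar] without boundary terms. *)
Lemma Iab_flux (t : R) : 0 <= t -> Iab (flux t) = 0.
Proof. by move=> t0; rewrite -primE_b -chem_prim// /chem Uxxb// Ub// W1b mulr0 addr0. Qed.

Lemma U_prim (t x : R) : 0 <= t -> x \in `[a, b] -> U t x = alpha + prim (Ux t) x.
Proof.
by move=> t0 xab; rewrite (wder_continuous ab (cU t0) (sUx t0) (wUx t0) xab) Ua.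
Qed.

Lemma Iab_Ux (t : R) : 0 <= t -> Iab (Ux t) = beta - alpha.
Proof. by move=> t0; rewrite -primE_b; have := U_prim t0 bab; rewrite Ub// => ->; rewrite addrC addKr. Qed.

Lemma U_bound (t x : R) : 0 <= t -> x \in `[a, b] -> `|U t x| <= `|alpha| + Num.sqrt (b - a) * nn (Ux t).
Proof.
move=> t0 xab; have xb : x <= b by rewrite (itvP xab).
rewrite U_prim//; apply: le_trans (ler_normD _ _) _; rewrite lerD2l.
by apply: prim_nn_le => //; exact: sUx.
Qed.

Lemma U_diff (t s x : R) : 0 <= t -> 0 <= s -> x \in `[a, b] ->
  `|U t x - U s x| <= Num.sqrt (b - a) * nn (Ux t - Ux s).
Proof.
move=> t0 s0 xab; have xb : x <= b by rewrite (itvP xab).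
rewrite !U_prim// opprD addrACA subrr add0r -(primB (b := b))//; last 2 first.
- by apply: sqi_intg; exact: sUx.
- by apply: sqi_intg; exact: sUx.
by apply: prim_nn_le => //; apply: sqiB; exact: sUx.
Qed.

Let sqba0 : 0 <= Num.sqrt (b - a). Proof. exact: sqrtr_ge0. Qed.

(** For the product [W''(u) u_x]: times with [nn (Ux t - Ux s) <= 1] keep [u] in a fixed ball of
    radius [M], where continuity of the third derivative of [W] makes [W''] bounded and
    Lipschitz. *)
Lemma flux_time_cont (s : R) : 0 <= s -> time_cont s flux.
Proof.
move=> s0 eta eta0.
set q : R := Num.sqrt (b - a).
pose M : R := `|alpha| + q * (nn (Ux s) + 1).
have [K K0 HK] := continuous_bounded_on M cW2.
have [L L0 HL] := lipschitz_on M dW2 cW3.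
pose C := e ^+ 2 + K + L * q * nn (Ux s) + 1.
have C0 : 0 < C by rewrite ltr_wpDl// !addr_ge0 ?sqr_ge0// !mulr_ge0// ?nn_ge0.
pose k := Num.min 1 (eta / C).
have k0 : 0 < k by rewrite lt_min ltr01 divr_gt0.
have [d1 d10 H1] := tUx s0 k0; have [d2 d20 H2] := tUxxx s0 k0.
exists (Num.min d1 d2); first by rewrite lt_min d10.
move=> t t0; rewrite lt_min => /andP[td1 td2].
have N1 := H1 t t0 td1; have N2 := H2 t t0 td2.
have k1 : k <= 1 by rewrite ge_min lexx.
have kC : k * C <= eta by rewrite -ler_pdivlMr// ge_min lexx orbT.
have Us x : x \in `[a, b] -> `|U s x| <= M.
  by move=> xab; apply: le_trans (U_bound s0 xab) _; rewrite lerD2l ler_wpM2l// lerDl.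
have Utb x : x \in `[a, b] -> `|U t x| <= M.
  move=> xab; apply: le_trans (U_bound t0 xab) _; rewrite lerD2l ler_wpM2l//.
  by apply: le_trans (nn_le_add (sUx t0) (sUx s0)) _; rewrite lerD2l (le_trans N1).
have sx := sqiB (sUxxx t0) (sUxxx s0); have su := sqiB (sUx t0) (sUx s0).
have mD : meas a b ((W2 \o U t) - (W2 \o U s)) by apply: measB; exact: mW2U.
have HKt x : x \in `[a, b] -> `|(W2 \o U t) x| <= K by move=> xab; apply: HK; exact: Utb.
have HD x : x \in `[a, b] -> `|((W2 \o U t) - (W2 \o U s)) x| <= L * (q * k).
  move=> xab; apply: le_trans (HL _ _ (Utb _ xab) (Us _ xab)) _.
  by rewrite ler_wpM2l//; apply: le_trans (U_diff t0 s0 xab) _; rewrite ler_wpM2l.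
have Lqk0 : 0 <= L * (q * k) by rewrite !mulr_ge0// ltW.
have -> : flux t - flux s = (fun x => - (e ^+ 2) * (Uxxx t - Uxxx s) x) +
   ((W2 \o U t) * (Ux t - Ux s) + ((W2 \o U t) - (W2 \o U s)) * Ux s).
  by apply: funext => x; rewrite /flux !fctE; ring.
have s1 : sqi ((W2 \o U t) * (Ux t - Ux s)) by apply: sqiMb HKt su; exact: mW2U.
have s2 : sqi (((W2 \o U t) - (W2 \o U s)) * Ux s) by apply: sqiMb HD (sUx s0).
apply: le_trans (nnD (sqiZ _ sx) (sqiD s1 s2)) _.
have B1 := nnD s1 s2.
have B2 := nnMb K0 (mW2U t0) HKt su.
have B3 := nnMb Lqk0 mD HD (sUx s0).
rewrite nnZ// normrN ger0_norm ?sqr_ge0//.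
have B4 : e ^+ 2 * nn (Uxxx t - Uxxx s) <= e ^+ 2 * k by rewrite ler_wpM2l ?sqr_ge0.
have B5 : K * nn (Ux t - Ux s) <= K * k by rewrite ler_wpM2l.
move: B1 B2 B3 B4 B5 kC; rewrite /C.
move: (nn _) (nn _) (nn _) (nn (Ux t - Ux s)) (nn _) (nn (Ux s)) => n1 n2 n3 n4 n5 n6.
by nra.
Qed.

Lemma test_gen_derive1 psi : test_gen psi -> test_gen (derive1 psi).
Proof.
move=> [S [c [d [ac cd db H]]]]; split; first exact: smooth_gen_derive1.
exists c, d; split => // x xcd; rewrite derive1E.
have [_ ->//] : is_derive x 1 psi 0.
apply: (@near_eq_is_derive R R R (cst 0)).
case: xcd => [xc|dx].
- by near=> z; rewrite H//; left; near: z; exact: lt_nbhsl.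
- by near=> z; rewrite H//; right; near: z; exact: lt_nbhsr.
Unshelve. all: by end_near. Qed.

Lemma ubar_sqi (t : R) : 0 <= t -> sqi (ubar t).
Proof. by move=> t0; apply: bar_sqi => //; apply: sqi_intg; exact: sU. Qed.

Lemma wbar_sqi (t : R) : 0 <= t -> sqi (wbar t).
Proof. by move=> t0; apply: bar_sqi => //; apply: sqi_intg; exact: sUt. Qed.

Lemma momentum_sqi (t : R) : 0 <= t -> sqi (momentum t).
Proof. by move=> t0; apply: sqiD; [apply: sqiZ; exact: wbar_sqi|exact: ubar_sqi]. Qed.

Lemma ubar_test_derive psi : test_gen psi -> forall t : R, 0 < t ->
  is_derive t 1 (fun s : R => ip (ubar s) (derive1 psi)) (ip (wbar t) (derive1 psi)).
Proof.
move=> T t t0.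
have := is_deriveN (dU T t0).
rewrite (test_gen_ibp_bar ab (sUt (ltW t0)) T) opprK.
apply: near_eq_is_derive; near=> s.
rewrite fctE (test_gen_ibp_bar ab _ T) ?opprK//; apply: sU; apply: ltW.
by near: s; exact: lt_nbhsr.
Unshelve. all: by end_near. Qed.

Lemma momentum_test_derive psi : test_gen psi -> forall t : R, 0 < t ->
  is_derive t 1 (fun s : R => ip (momentum s) (derive1 psi)) (ip (flux t) (derive1 psi)).
Proof.
move=> T t t0; have [D [dD E]] := dUt T t0.
have sd := test_gen_sqi T.
have H := is_deriveN (is_deriveD (is_deriveZ tau dD) (dU T t0)).
have E2 : - (tau *: D + ip (Ut t) psi) = ip (flux t) (derive1 psi).
  rewrite /GRing.scale /= E (test_gen_ibp ab (flux_sqi (ltW t0)) (test_gen_derive1 T)).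
  by congr (- _); apply: eq_ipl => x xab; apply: chem_prim => //; exact: ltW.
rewrite E2 in H; apply: (near_eq_is_derive _ H); near=> s.
have s0 : 0 <= s by apply: ltW; near: s; exact: lt_nbhsr.
rewrite !fctE /GRing.scale /=.
rewrite (test_gen_ibp_bar ab (sU s0) T) (test_gen_ibp_bar ab (sUt s0) T).
have -> : ip (momentum s) (derive1 psi) = tau * ip (wbar s) (derive1 psi) + ip (ubar s) (derive1 psi).
  by rewrite -(ipZl tau (wbar_sqi s0) sd); exact: ipDl (sqiZ tau (wbar_sqi s0)) (ubar_sqi s0) sd.
by rewrite -[_ *: _]/(tau * _) mulrN opprD !opprK.
Unshelve. all: by end_near. Qed.

Lemma bar_nn_le g : sqi g -> nn (bar g) <= 2 * (b - a) * nn g.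
Proof.
move=> sg; have Ig := sqi_intg sg.
have A0 : 0 <= 2 * Iab (fun y => `|g y|) by rewrite mulr_ge0// Iab_ge0.
have := nn_bounded (ltW ab) A0 (bar_sqi ab Ig).1 (fun x xab => norm_bar_le ab Ig xab).
move/le_trans; apply; have := Iab_norm_le (ltW ab) sg.
have : Num.sqrt (b - a) ^+ 2 = b - a by rewrite sqr_sqrtr// subr_ge0 ltW.
move: sqba0; move: (Num.sqrt _) => q q0 <- H.
by rewrite -!mulrA ler_wpM2l// mulrC ler_wpM2l.
Qed.

Lemma wbar_time_cont (s : R) : 0 <= s -> time_cont s wbar.
Proof.
move=> s0 eta eta0.
have C0 : 0 < 2 * (b - a) by rewrite mulr_gt0// subr_gt0.
have [|d d0 H] := tUt s0 (eta := eta / (2 * (b - a))); first by rewrite divr_gt0.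
exists d => // t t0 td; have := H t t0 td; rewrite ler_pdivlMr// mulrC.
apply: le_trans; have sB := sqiB (sUt t0) (sUt s0); apply: le_trans (bar_nn_le sB).
rewrite (@eq_nn R a b (wbar t - wbar s) (bar (Ut t - Ut s)))// => x xab.
by rewrite barB//; apply: sqi_intg; exact: sUt.
Qed.

(** By the mean value theorem a Lipschitz constant of [W'] suffices. A quadratic error is enough,
    because the square of [nn (U t - U s)] turns out to be [o(|t - s|)]. *)
Lemma trapezoid_error (K M x y : R) : 0 <= K ->
  (forall x y : R, `|x| <= M -> `|y| <= M -> `|W1 x - W1 y| <= K * `|x - y|) ->
  `|x| <= M -> `|y| <= M ->
  `|2 * (W y - W x) - (y - x) * (W1 y + W1 x)| <= 2 * K * (y - x) ^+ 2.
Proof.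
move=> K0 HK.
wlog xy : x y / x <= y => [H xM yM|xM yM].
  have [xy|/ltW yx] := leP x y; first exact: H.
  rewrite -normrN [X in `|X|](_ : _ = 2 * (W x - W y) - (x - y) * (W1 x + W1 y)); last by ring.
  by rewrite -(sqrrN (y - x)) opprB; exact: H.
have cWxy : {within `[x, y], continuous W} by exact: continuous_subspaceT.
have [z] := MVT_segment xy (fun z _ => dW z) cWxy.
rewrite in_itv/= => /andP[xz zy] ->.
have zM : `|z| <= M.
  by move: xM yM; rewrite !ler_norml => /andP[x1 x2] /andP[y1 y2]; rewrite (le_trans x1)//= (le_trans zy).
have H1 := HK z y zM yM; have H2 := HK z x zM xM.
rewrite [X in `|X|](_ : _ = (y - x) * ((W1 z - W1 y) + (W1 z - W1 x))); last by ring.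
rewrite normrM ger0_norm ?subr_ge0//.
have -> : 2 * K * (y - x) ^+ 2 = (y - x) * (2 * K * (y - x)) by ring.
rewrite ler_wpM2l ?subr_ge0//; apply: le_trans (ler_normD _ _) _.
have E1 : `|z - y| <= y - x by rewrite ler_norml; apply/andP; split; lra.
have E2 : `|z - x| <= y - x by rewrite ler_norml; apply/andP; split; lra.
by have := ler_wpM2l K0 E1; have := ler_wpM2l K0 E2; lra.
Qed.

(* [energy_e] is [e] times the energy of the solution. *)
Definition energy_e (t : R) : R :=
  tau / 2 * ip (wbar t) (wbar t) + e ^+ 2 / 2 * ip (Ux t) (Ux t) + Iab (W \o U t).

Let ubarB (t s x : R) : 0 <= t -> 0 <= s -> x \in `[a, b] -> (ubar t - ubar s) x = bar (U t - U s) x.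
Proof. by move=> t0 s0 xab; rewrite barB//; apply: sqi_intg; exact: sU. Qed.

Let UB_prim (t s x : R) : 0 <= t -> 0 <= s -> x \in `[a, b] -> (U t - U s) x = prim (Ux t - Ux s) x.
Proof.
move=> t0 s0 xab; have xb : x <= b by rewrite (itvP xab).
rewrite (primB (b := b))//; [|by apply: sqi_intg; exact: sUx..].
by rewrite -[LHS]/(U t x - U s x) !U_prim// opprD addrACA subrr add0r.
Qed.

Let Iab_UxB (t s : R) : 0 <= t -> 0 <= s -> Iab (Ux t - Ux s) = 0.
Proof.
move=> t0 s0; rewrite IabB; [|by apply: sqi_intg; exact: sUx..].
by rewrite !Iab_Ux// subrr.
Qed.

Let wderD f fx g gx : sqi f -> sqi fx -> sqi g -> sqi gx -> wder f fx -> wder g gx -> wder (f + g) (fx + gx).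
Proof.
move=> sf sfx sg sgx Wf Wg psi T; have sp := smooth_gen_sqi a b T.1.
have sd := test_gen_sqi T.
by rewrite !ipDl// Wf// Wg// opprD.
Qed.

Let sWc (F : R -> R) (t : R) : continuous F -> 0 <= t -> sqi (F \o U t).
Proof. by move=> cF t0; apply: continuous_sqi; apply: continuous_comp_within => //; exact: cU. Qed.

(** Fixed boundary values give [Ux t - Ux s] zero mean, so nothing is left at the ends. As [ubar] is
    differentiable in time and [Ux] continuous, the right-hand side is [o(|t - s|)], which also
    disposes of [W_remainder] in the derivative of the energy. *)
Lemma ip_UB_sqr (t s : R) : 0 <= t -> 0 <= s ->
  ip (U t - U s) (U t - U s) = - ip (ubar t - ubar s) (Ux t - Ux s).
Proof.
move=> t0 s0.
have sD : sqi (U t - U s) by apply: sqiB; exact: sU.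
have sd : sqi (Ux t - Ux s) by apply: sqiB; exact: sUx.
have E := ip_prim0_bar ab sD sd (Iab_UxB t0 s0).
rewrite (eq_ipl (f := ubar t - ubar s) (g := bar (U t - U s))); last by move=> x; exact: ubarB.
rewrite -E [RHS]ipC.
rewrite (@eq_ipl R a b (U t - U s) (prim (Ux t - Ux s)) (U t - U s))// => x.
exact: UB_prim.
Qed.

Definition W_remainder (t s : R) : R := 2 * Iab (W \o U t) - 2 * Iab (W \o U s) - ip (U t - U s) ((W1 \o U t) + (W1 \o U s)).

(* Exact form of the energy balance: pairing increments with sums of the values at both times
   leaves only the trapezoidal error of [W] as remainder. *)
Lemma energy_identity (t s : R) : 0 <= t -> 0 <= s ->
  2 * (energy_e t - energy_e s) =
  ip (momentum t - momentum s) (wbar t + wbar s)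
  - ip (ubar t - ubar s) ((wbar t + wbar s) + (flux t + flux s)) + W_remainder t s.
Proof.
move=> t0 s0.
have swt := wbar_sqi t0; have sws := wbar_sqi s0.
have sut := ubar_sqi t0; have sus := ubar_sqi s0.
have sft := flux_sqi t0; have sfs := flux_sqi s0.
have sxt := sUx t0; have sxs := sUx s0.
have sxxt := sUxx t0; have sxxs := sUxx s0.
have sDu := sqiB sut sus; have sw := sqiD swt sws; have sf := sqiD sft sfs.
have sD : sqi (U t - U s) by apply: sqiB; exact: sU.
have sd := sqiB sxt sxs; have sm := sqiD sxt sxs.
have sDw := sqiB swt sws.
have A1 : ip (momentum t - momentum s) (wbar t + wbar s) =
  tau * (ip (wbar t) (wbar t) - ip (wbar s) (wbar s)) + ip (ubar t - ubar s) (wbar t + wbar s).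
  by have H1 := ip_comb_diff tau swt sws sut sus; exact: H1.
have A2 : ip (Ux t) (Ux t) - ip (Ux s) (Ux s) = - ip (U t - U s) (Uxx t + Uxx s).
  have -> : ip (Ux t) (Ux t) - ip (Ux s) (Ux s) = ip (Ux t - Ux s) (Ux t + Ux s).
    by have H1 := ip_diff_sqr sxt sxs; rewrite H1.
  have sxx := sqiD sxxt sxxs.
  have WD := wderD sxt sxxt sxs sxxs (wUxx t0) (wUxx s0).
  rewrite (wder_ibp0 ab sd sm sxx (Iab_UxB t0 s0) WD); congr (- _).
  by apply: eq_ipl => x xab; rewrite UB_prim.
(* [chem t + chem s] is the primitive of the zero-mean function [flux t + flux s]; moving the
   primitive to the other factor turns [U] into [ubar]. *)
have A3 : ip (U t - U s) (fun x => - (e ^+ 2) * (Uxx t + Uxx s) x + ((W1 \o U t) + (W1 \o U s)) x) =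
   - ip (ubar t - ubar s) (flux t + flux s).
  have F0 : Iab (flux t + flux s) = 0.
    by rewrite IabD ?Iab_flux ?addr0//; apply: sqi_intg; exact: flux_sqi.
  rewrite (@eq_ipl R a b (ubar t - ubar s) (bar (U t - U s)) (flux t + flux s)); last by move=> x; exact: ubarB.
  rewrite -(ip_prim0_bar ab sD sf F0); apply: eq_ipr => x xab.
  have xb : x <= b by rewrite (itvP xab).
  rewrite (primD (sqi_intg sft) (sqi_intg sfs) xb) -!chem_prim// /chem !fctE /=; ring.
have sxx := sqiD sxxt sxxs.
have sW1 : sqi ((W1 \o U t) + (W1 \o U s)) by apply: sqiD; exact: sWc.
have A3' := ipDr (sqiZ (- (e ^+ 2)) sxx) sW1 sD.
rewrite (ipZr _ sD sxx) in A3'.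
rewrite A1 (ipDr sw sf sDu) /W_remainder /energy_e.
move: (etrans (esym A3') A3) A2.
move: (ip (wbar t) _) (ip (wbar s) _) (ip (Ux t) _) (ip (Ux s) _) (ip (U t - U s) (Uxx t + Uxx s)).
move: (ip (U t - U s) _) (ip (ubar t - ubar s) _) (ip (ubar t - ubar s) _) (Iab _) (Iab _).
move=> r1 r2 r3 r4 r5 r6 r7 r8 r9 r10 B1 B2.
have -> : r8 = r9 - r10 by rewrite -B2 addrC subrK.
have -> : r3 = e ^+ 2 * r10 - r1 by rewrite -[r3]opprK -B1; ring.
by field.
Qed.

Let cW2_bd (M : R) : exists2 K : R, 0 <= K & forall x y : R, `|x| <= M -> `|y| <= M -> `|W1 x - W1 y| <= K * `|x - y|.
Proof. exact: lipschitz_on dW1 cW2. Qed.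

Lemma W_remainder_le (s : R) : 0 <= s -> exists2 K : R, 0 <= K & forall t, 0 <= t -> nn (Ux t - Ux s) <= 1 ->
  `|W_remainder t s| <= 2 * K * ip (U t - U s) (U t - U s).
Proof.
move=> s0; set q := Num.sqrt (b - a); pose M := `|alpha| + q * (nn (Ux s) + 1).
have [K K0 HK] := cW2_bd M; exists K => // t t0 n1.
have Us x : x \in `[a, b] -> `|U s x| <= M.
  by move=> xab; apply: le_trans (U_bound s0 xab) _; rewrite lerD2l ler_wpM2l// lerDl.
have Utb x : x \in `[a, b] -> `|U t x| <= M.
  move=> xab; apply: le_trans (U_bound t0 xab) _; rewrite lerD2l ler_wpM2l//.
  by apply: le_trans (nn_le_add (sUx t0) (sUx s0)) _; rewrite lerD2l.
have sD : sqi (U t - U s) by apply: sqiB; exact: sU.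
have sW1 : sqi ((W1 \o U t) + (W1 \o U s)) by apply: sqiD; exact: sWc.
have I1 : intg (W \o U t) by apply: sqi_intg; exact: sWc.
have I2 : intg (W \o U s) by apply: sqi_intg; exact: sWc.
have I3 := intgM sD sW1; have I4 := intgM sD sD.
have -> : W_remainder t s = Iab ((fun x => 2 * ((W \o U t) - (W \o U s)) x) - (U t - U s) * ((W1 \o U t) + (W1 \o U s))).
  rewrite IabB//; last by apply: intgZ; exact: intgB.
  by rewrite IabZ ?IabB// ?mulrBr//; exact: intgB.
have I5 : intg ((fun x => 2 * ((W \o U t) - (W \o U s)) x) - (U t - U s) * ((W1 \o U t) + (W1 \o U s))).
  by apply: intgB => //; apply: intgZ; exact: intgB.
apply: le_trans (norm_Iab I5) _.
have -> : 2 * K * ip (U t - U s) (U t - U s) = Iab (fun x => 2 * K * ((U t - U s) * (U t - U s)) x).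
  by rewrite IabZ.
apply: le_Iab; [exact: intg_norm|exact: intgZ|] => x xab.
have := trapezoid_error K0 HK (Us x xab) (Utb x xab).
by rewrite expr2.
Qed.

Lemma ubar_increment (s eta : R) : 0 < s -> 0 < eta -> exists2 d : R, 0 < d & forall t, `|t - s| < d ->
  0 < t /\ nn (ubar t - ubar s - (fun x => (t - s) * wbar s x)) <= eta * `|t - s|.
Proof.
move=> s0 eta0; apply: (@dtest_strong_derive R a b ubar wbar) => //.
- exact: ubar_sqi.
- exact: wbar_sqi.
- by move=> t t0; apply: wbar_time_cont; exact: ltW.
- exact: ubar_test_derive.
- move=> t t0.
  have D1 : dtest (ubar t) by apply: dtest_bar => //; apply: sU; exact: ltW.
  have D2 : dtest (ubar s) by apply: dtest_bar => //; apply: sU; exact: ltW.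
  have D3 : dtest (wbar s) by apply: dtest_bar => //; apply: sUt; exact: ltW.
  have := dtestD (dtestD D1 (dtestZ (-1) D2)) (dtestZ (- (t - s)) D3).
  congr dtest; apply: funext => x.
  rewrite -[LHS]/(ubar t x + (-1) * ubar s x + (- (t - s)) * wbar s x).
  rewrite -[RHS]/(ubar t x - ubar s x - (t - s) * wbar s x).
  by move: (ubar t x) (ubar s x) (wbar s x) => *; ring.
Qed.

Lemma momentum_increment (s eta : R) : 0 < s -> 0 < eta -> exists2 d : R, 0 < d & forall t, `|t - s| < d ->
  0 < t /\ forall phi, dtest phi ->
    `|ip (momentum t - momentum s) phi - (t - s) * ip (flux s) phi| <= eta * `|t - s| * nn phi.
Proof.
move=> s0 eta0; apply: (@dtest_increment R a b momentum flux) => //.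
- exact: momentum_sqi.
- exact: flux_sqi.
- by move=> t t0; apply: flux_time_cont; exact: ltW.
- exact: momentum_test_derive.
Qed.

Lemma energy_derive (s : R) : 0 < s -> is_derive s 1 energy_e (- ip (wbar s) (wbar s)).
Proof.
move=> s0; have s0' := ltW s0; apply: is_derive_eps => eta eta0.
have [K K0 HK] := W_remainder_le s0'.
set A := nn (wbar s); set B := nn (flux s).
have A0 : 0 <= A by exact: nn_ge0.
have B0 : 0 <= B by exact: nn_ge0.
(* The constant of [energy_increment_estimate]; [k C <= eta] brings its error down to
   [eta |t - s|]. *)
pose C := 1 + 8 * A + 4 * B + 4 + 2 * K * (A + 1).
have C0 : 0 < C.
  have : 0 <= K * (A + 1) by rewrite mulr_ge0// addr_ge0.
  by rewrite /C; lra.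
pose k := Num.min 1 (eta / C).
have k0 : 0 < k by rewrite lt_min ltr01 divr_gt0.
have k1 : k <= 1 by rewrite ge_min lexx.
have kC : k * C <= eta by rewrite -ler_pdivlMr// ge_min lexx orbT.
have [d1 d10 H1] := ubar_increment s0 k0.
have [d2 d20 H2] := momentum_increment s0 k0.
have [d3 d30 H3] := wbar_time_cont s0' k0.
have [d4 d40 H4] := flux_time_cont s0' k0.
have [d5 d50 H5] := tUx s0' k0.
exists (Num.min d1 (Num.min d2 (Num.min d3 (Num.min d4 d5)))).
  by rewrite !lt_min d10 d20 d30 d40 d50.
move=> t; rewrite !lt_min => /and5P[td1 td2 td3 td4 td5].
have [t0 Q1] := H1 t td1; have [_ Q2] := H2 t td2; have t0' := ltW t0.
have Q3 := H3 t t0' td3; have Q4 := H4 t t0' td4; have Q5 := H5 t t0' td5.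
have swt := wbar_sqi t0'; have sws := wbar_sqi s0'.
have sut := ubar_sqi t0'; have sus := ubar_sqi s0'.
have sft := flux_sqi t0'; have sfs := flux_sqi s0'.
have sxt := sUx t0'; have sxs := sUx s0'.
have Dw : dtest (wbar t + wbar s).
  by apply: dtestD => //; apply: dtest_bar => //; apply: sUt.
have R2 := Q2 _ Dw.
have RK := HK t t0' (le_trans Q5 k1).
rewrite (ip_UB_sqr t0' s0') in RK.
have F := energy_increment_estimate sut sus swt sws sft sfs (sqiB sxt sxs) k0 k1 K0 (energy_identity t0' s0') R2 Q1 Q3 Q4 Q5 RK.
by apply: (le_trans F); rewrite (mulrC eta) ler_wpM2l.
Qed.

Let displacement_aux (t p q n E1 E0 : R) : 0 < t ->
  p + (t / 2 * E1 + - (n / (2 * t)) * t) <= q + t / 2 * E0 -> p - q = n -> n <= t * (E0 - E1).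
Proof.
move=> t0; rewrite (_ : - (n / (2 * t)) * t = - (n / 2)); first by lra.
by field; rewrite gt_eqF.
Qed.

Let displacement_aux2 (p q n k u : R) : p + - (k * n) * u <= q -> p - q = n ^+ 2 -> n ^+ 2 <= u * k * n.
Proof. by move=> H1 <-; lra. Qed.

Let is_derive_scale (c s l : R) (f : R -> R) : is_derive s 1 f l -> is_derive s 1 (fun x : R => c * f x) (c * l).
Proof. by move=> d; have := is_deriveZ c d; exact. Qed.

Let is_derive_add (s l m : R) (f g : R -> R) : is_derive s 1 f l -> is_derive s 1 g m ->
  is_derive s 1 (fun x : R => f x + g x) (l + m).
Proof. by move=> d1 d2; have := is_deriveD d1 d2; exact. Qed.

Let nn_subrr f : sqi f -> nn (f - f) = 0.
Proof.
by move=> sf; apply/eqP; rewrite -sqrf_eq0 nn_sqr (ipBl sf sf (sqiB sf sf)) subrr.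
Qed.

Let ubar_nn_le (t s : R) : 0 <= t -> 0 <= s ->
  nn (ubar t - ubar s) <= 2 * (b - a) * (b - a) * nn (Ux t - Ux s).
Proof.
move=> t0 s0.
have sD : sqi (U t - U s) by apply: sqiB; exact: sU.
have ba : 0 <= b - a by rewrite subr_ge0 ltW.
rewrite (@eq_nn R a b _ (bar (U t - U s))); last by move=> x; exact: ubarB.
apply: le_trans (bar_nn_le sD) _; rewrite -[leRHS]mulrA ler_wpM2l ?mulr_ge0//.
have H := @nn_bounded R a b (U t - U s) (Num.sqrt (b - a) * nn (Ux t - Ux s)) (ltW ab).
apply: le_trans (H _ (sqi_meas sD) _) _.
- by rewrite mulr_ge0// nn_ge0.
- by move=> x xab; exact: U_diff.
- by rewrite mulrAC -expr2 sqr_sqrtr.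
Qed.

Lemma ubar_time_cont (s : R) : 0 <= s -> time_cont s ubar.
Proof.
move=> s0 eta eta0; set C := 2 * (b - a) * (b - a).
have C0 : 0 < C by rewrite !mulr_gt0// subr_gt0.
have eC : 0 < eta / C by rewrite divr_gt0.
have [d d0 H] := tUx s0 eC; exists d => // t t0 td.
apply: le_trans (ubar_nn_le t0 s0) _; rewrite -/C mulrC -ler_pdivlMr//.
exact: H.
Qed.

(** The equation is given for [t > 0] only; continuity from the right at [0] lets monotonicity in
    time start at the initial data. *)
Definition right_cont0 (f : R -> R) := forall eta : R, 0 < eta ->
  exists2 d : R, 0 < d & forall t, 0 <= t -> t < d -> `|f t - f 0| <= eta.

Lemma right_cont0D f g : right_cont0 f -> right_cont0 g -> right_cont0 (fun t => f t + g t).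
Proof.
move=> cf cg eta eta0; have e2 : 0 < eta / 2 by rewrite divr_gt0.
have [d1 d10 H1] := cf _ e2; have [d2 d20 H2] := cg _ e2.
exists (Num.min d1 d2); first by rewrite lt_min d10.
move=> t t0; rewrite lt_min => /andP[td1 td2].
have := H1 t t0 td1; have := H2 t t0 td2.
rewrite opprD addrACA => N2 N1; apply: le_trans (ler_normD _ _) _; lra.
Qed.

Lemma right_cont0Z c f : right_cont0 f -> right_cont0 (fun t => c * f t).
Proof.
move=> cf eta eta0; have e2 : 0 < eta / (`|c| + 1) by rewrite divr_gt0// ltr_wpDl.
have [d d0 H] := cf _ e2; exists d => // t t0 td.
have := H t t0 td; rewrite ler_pdivlMr ?ltr_wpDl// -mulrBr normrM => N.
apply: le_trans N; rewrite mulrC ler_wpM2l// lerDl//.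
Qed.

Lemma right_cont0_le (f df : R -> R) : right_cont0 f ->
  (forall t : R, 0 < t -> is_derive t 1 f (df t)) -> (forall t, 0 < t -> df t <= 0) ->
  forall t, 0 <= t -> f t <= f 0.
Proof.
move=> cf d dle t; rewrite le_eqVlt => /predU1P[<-//|t0].
have cc (z : R) : 0 < z -> {for z, continuous f}.
  by move=> z0; exact: is_derive_continuous (d z z0).
have c : {within `[0, t], continuous f}.
  apply/(continuous_within_itvP _ t0); split.
  - by move=> z; rewrite in_itv/= => /andP[z0 _]; exact: cc.
  - apply/cvgrPdist_le => eta eta0; have [dd d0 H] := cf _ eta0.
    near=> z; rewrite distrC; apply: H; first by apply: ltW.
    by near: z; exact: nbhs_right_lt.
  - by apply: cvg_at_left_filter; exact: cc.
have [z] := MVT t0 (fun z (h : z \in `]0, t[) => d z (andP (h : 0 < z < t)).1) c.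
rewrite in_itv/= => /andP[z0 zt] E; rewrite -subr_le0 E.
by rewrite mulr_le0_ge0 ?dle// subr0 ltW.
Unshelve. all: by end_near. Qed.

Lemma ip_right_cont0 (F : R -> R -> R) : (forall t : R, 0 <= t -> sqi (F t)) -> time_cont 0 F ->
  right_cont0 (fun t => ip (F t) (F t)).
Proof.
move=> sF cF eta eta0; set A := nn (F 0).
have A0 : 0 <= A by exact: nn_ge0.
pose k := Num.min 1 (eta / (2 * A + 1)).
have C0 : 0 < 2 * A + 1 by rewrite ltr_wpDl// mulr_ge0.
have k0 : 0 < k by rewrite lt_min ltr01 divr_gt0.
have kC : k * (2 * A + 1) <= eta by rewrite -ler_pdivlMr// ge_min lexx orbT.
have k1 : k <= 1 by rewrite ge_min lexx.
have [d d0 H] := cF _ k0; exists d => // t t0 td.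
have N := H t t0; rewrite subr0 ger0_norm// in N; have {}N := N td.
have sFt := sF t t0; have sF0 := sF 0 (lexx _).
rewrite -ip_diff_sqr//.
apply: le_trans (cauchy_schwarz (sqiB sFt sF0) (sqiD sFt sF0)) _.
apply: le_trans kC; apply: ler_pM => //; [exact: nn_ge0|exact: nn_ge0|].
apply: le_trans (nnD sFt sF0) _; have := nn_le_add sFt sF0; rewrite -/A; lra.
Qed.

Lemma energy_right_cont0 : right_cont0 energy_e.
Proof.
apply: right_cont0D; first apply: right_cont0D.
- by apply: right_cont0Z; apply: ip_right_cont0; [exact: wbar_sqi|exact: wbar_time_cont].
- by apply: right_cont0Z; apply: ip_right_cont0; [exact: sUx|exact: tUx].
move=> eta eta0; set q := Num.sqrt (b - a); pose M := `|alpha| + q * (nn (Ux 0) + 1).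
have [K K0 HK] := lipschitz_on M dW cW1.
have C0 : 0 < K * q * (b - a) + 1 by rewrite ltr_wpDl// !mulr_ge0// subr_ge0 ltW.
pose k := Num.min 1 (eta / (K * q * (b - a) + 1)).
have k0 : 0 < k by rewrite lt_min ltr01 divr_gt0.
have kC : k * (K * q * (b - a) + 1) <= eta by rewrite -ler_pdivlMr// ge_min lexx orbT.
have k1 : k <= 1 by rewrite ge_min lexx.
have [d d0 H] := tUx (lexx 0) k0; exists d => // t t0 td.
have N := H t t0; rewrite subr0 ger0_norm// in N; have {}N := N td.
have Us x : x \in `[a, b] -> `|U 0 x| <= M.
  by move=> xab; apply: le_trans (U_bound (lexx 0) xab) _; rewrite lerD2l ler_wpM2l// lerDl.
have Utb x : x \in `[a, b] -> `|U t x| <= M.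
  move=> xab; apply: le_trans (U_bound t0 xab) _; rewrite lerD2l ler_wpM2l//.
  by apply: le_trans (nn_le_add (sUx t0) (sUx (lexx 0))) _; rewrite lerD2l (le_trans N).
have I1 : intg (W \o U t) by apply: sqi_intg; exact: sWc.
have I2 : intg (W \o U 0) by apply: sqi_intg; exact: sWc.
rewrite -IabB//; apply: le_trans (norm_Iab (intgB I1 I2)) _.
apply: (@le_trans _ _ (Iab (cst (K * (q * k))))).
  apply: le_Iab; [apply: intg_norm; exact: intgB|exact: intg_cst|] => x xab.
  apply: le_trans (HK _ _ (Utb x xab) (Us x xab)) _; rewrite ler_wpM2l//.
  by apply: le_trans (U_diff t0 (lexx 0) xab) _; rewrite ler_wpM2l.
rewrite Iab_cst ?(ltW ab)//; apply: le_trans kC.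
have -> : K * (q * k) * (b - a) = k * (K * q * (b - a)) by ring.
by rewrite ler_wpM2l ?(ltW k0)// lerDl.
Qed.

Lemma energy_decreasing (t : R) : 0 <= t -> energy_e t <= energy_e 0.
Proof.
apply: (right_cont0_le (df := fun t => - ip (wbar t) (wbar t))).
- exact: energy_right_cont0.
- exact: energy_derive.
- by move=> s s0; rewrite oppr_le0 ip_ge0.
Qed.

Let dtest_ubarB (t : R) : 0 <= t -> dtest (ubar t - ubar 0).
Proof.
move=> t0.
have D1 : dtest (ubar t) by apply: dtest_bar => //; exact: sU.
have D2 : dtest (ubar 0) by apply: dtest_bar => //; exact: sU.
have := dtestD D1 (dtestZ (-1) D2); congr dtest; apply: funext => x.
by rewrite !fctE mulN1r.
Qed.

Let ubar_ip_derive phi (t : R) : 0 < t -> dtest phi ->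
  is_derive t 1 (fun s : R => ip (ubar s) phi) (ip (wbar t) phi).
Proof.
move=> t0 D; apply: (@dtest_is_derive R a b ubar wbar) => //.
- exact: ubar_sqi.
- exact: wbar_sqi.
- by move=> s s0; apply: wbar_time_cont; exact: ltW.
- exact: ubar_test_derive.
Qed.

Let ubar_ip_cont0 phi : sqi phi -> right_cont0 (fun s => ip (ubar s) phi).
Proof.
move=> sp eta eta0.
have C0 : 0 < nn phi + 1 by rewrite ltr_wpDl ?nn_ge0.
have eC : 0 < eta / (nn phi + 1) by rewrite divr_gt0.
have [d d0 H] := ubar_time_cont (lexx 0) eC; exists d => // t t0 td.
have N := H t t0; rewrite subr0 ger0_norm// in N; have {}N := N td.
have s1 := ubar_sqi t0; have s2 := ubar_sqi (lexx 0).
rewrite -ipBl//; apply: le_trans (cauchy_schwarz (sqiB s1 s2) sp) _.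
move: N; rewrite ler_pdivlMr//; apply: le_trans.
by rewrite ler_wpM2l ?nn_ge0// lerDl.
Qed.

(** Formally, the squared norm of the integral of [w] is at most [t] times the integral of its
    squared norm. Instead of integrating L2-valued functions, the final displacement [phi] is fixed;
    by Young's inequality [F s = <ubar s, phi> + (t / 2) E(s) - s |phi|^2 / (2 t)] is nonincreasing,
    and [F t <= F 0] is the claim. *)
Lemma ubar_displacement_energy (t : R) : 0 <= t ->
  nn (ubar t - ubar 0) ^+ 2 <= t * (energy_e 0 - energy_e t).
Proof.
rewrite le_eqVlt => /predU1P[<-|t0]; first by rewrite mul0r nn_subrr ?expr0n//; exact: ubar_sqi.
have t0' := ltW t0.
set phi := ubar t - ubar 0; have D := dtest_ubarB t0'; rewrite -/phi in D.
have sp : sqi phi by case: D.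
pose F s := ip (ubar s) phi + (t / 2 * energy_e s + - (nn phi ^+ 2 / (2 * t)) * s).
pose dF s := ip (wbar s) phi + (t / 2 * - ip (wbar s) (wbar s) + - (nn phi ^+ 2 / (2 * t)) * 1).
have c : right_cont0 F.
  apply: right_cont0D; first exact: ubar_ip_cont0.
  apply: right_cont0D; first by apply: right_cont0Z; exact: energy_right_cont0.
  apply: right_cont0Z => eta eta0; exists eta => // s s0 se; rewrite subr0 ger0_norm//.
  exact: ltW.
have d (s : R) : 0 < s -> is_derive s 1 F (dF s).
  move=> s0; apply: is_derive_add; first exact: ubar_ip_derive.
  apply: is_derive_add; apply: is_derive_scale; exact: energy_derive.
have neg (s : R) : 0 < s -> dF s <= 0.
  move=> s0; have sw := wbar_sqi (ltW s0); have := ip_le sw sp.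
  rewrite /dF -nn_sqr; move: (ip _ _) (nn _) (nn _) => p y x pxy.
  have : 0 <= (t * x - y) ^+ 2 / (2 * t) by rewrite divr_ge0 ?sqr_ge0// mulr_ge0.
  rewrite (_ : (t * x - y) ^+ 2 / (2 * t) = t / 2 * x ^+ 2 - x * y + y ^+ 2 / (2 * t)); first by lra.
  by field; rewrite gt_eqF.
have H := right_cont0_le c d neg t0'.
have F0 : F 0 = ip (ubar 0) phi + t / 2 * energy_e 0.
  by rewrite /F; move: (ip _ _) (energy_e 0) (nn phi ^+ 2 / _) => *; ring.
have Ft : F t = ip (ubar t) phi + (t / 2 * energy_e t + - (nn phi ^+ 2 / (2 * t)) * t) by [].
rewrite {}F0 {}Ft in H.
have E : ip (ubar t) phi - ip (ubar 0) phi = nn phi ^+ 2.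
  by rewrite nn_sqr -(ipBl (ubar_sqi t0') (ubar_sqi (lexx 0)) sp).
exact: displacement_aux t0 H E.
Qed.

Hypothesis W_ge0 : forall y, 0 <= W y.

Let Iab_W_ge0 (t : R) : 0 <= Iab (W \o U t).
Proof. by apply: Iab_ge0 => x _; exact: W_ge0. Qed.

Lemma wbar_energy_le (t : R) : 0 <= t -> nn (wbar t) <= Num.sqrt (2 * energy_e 0 / tau).
Proof.
move=> t0; rewrite -[leLHS]ger0_norm ?nn_ge0// -sqrtr_sqr ler_wsqrtr// nn_sqr.
rewrite ler_pdivlMr//; have := energy_decreasing t0; rewrite {1}/energy_e.
have : 0 <= e ^+ 2 / 2 * ip (Ux t) (Ux t) by rewrite mulr_ge0 ?ip_ge0// divr_ge0 ?sqr_ge0.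
have := Iab_W_ge0 t; move: (ip _ _) (ip _ _) (Iab _) (energy_e 0) => *; lra.
Qed.

(** The initial energy bounds the velocity [w] at all times. This cruder estimate serves very short
    time intervals. *)
Lemma ubar_displacement_time (t : R) : 0 <= t ->
  nn (ubar t - ubar 0) <= t * Num.sqrt (2 * energy_e 0 / tau).
Proof.
rewrite le_eqVlt => /predU1P[<-|t0].
  by rewrite mul0r nn_subrr//; exact: ubar_sqi.
have t0' := ltW t0.
set phi := ubar t - ubar 0; have D := dtest_ubarB t0'; rewrite -/phi in D.
have sp : sqi phi by case: D.
set Q := Num.sqrt _; have Q0 : 0 <= Q by exact: sqrtr_ge0.
pose F s := ip (ubar s) phi + - (Q * nn phi) * s.
pose dF s := ip (wbar s) phi + - (Q * nn phi) * 1.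
have c : right_cont0 F.
  apply: right_cont0D; first exact: ubar_ip_cont0.
  apply: right_cont0Z => eta eta0; exists eta => // s s0 se; rewrite subr0 ger0_norm//.
  exact: ltW.
have d (s : R) : 0 < s -> is_derive s 1 F (dF s).
  move=> s0; apply: is_derive_add; exact: ubar_ip_derive.
have neg (s : R) : 0 < s -> dF s <= 0.
  move=> s0; have sw := wbar_sqi (ltW s0); have := ip_le sw sp.
  rewrite /dF mulr1 subr_le0 => /le_trans; apply; rewrite ler_wpM2r ?nn_ge0//.
  by apply: wbar_energy_le; exact: ltW.
have H := right_cont0_le c d neg t0'.
have F0 : F 0 = ip (ubar 0) phi by rewrite /F; move: (ip _ _) (nn phi) => *; ring.
have Ft : F t = ip (ubar t) phi + - (Q * nn phi) * t by [].
rewrite {}F0 {}Ft in H.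
have E : ip (ubar t) phi - ip (ubar 0) phi = nn phi ^+ 2.
  by rewrite nn_sqr -(ipBl (ubar_sqi t0') (ubar_sqi (lexx 0)) sp).
have := displacement_aux2 H E.
have [->|n0] := eqVneq (nn phi) 0; first by rewrite mulr_ge0.
by rewrite expr2 ler_pM2r// lt_def n0 nn_ge0.
Qed.

Hypothesis e0 : 0 < e.

Lemma Ux_energy_le (t : R) : 0 <= t -> nn (Ux t) <= Num.sqrt (2 * energy_e 0) / e.
Proof.
move=> t0; rewrite ler_pdivlMr// -[leLHS]ger0_norm ?mulr_ge0 ?nn_ge0 ?(ltW e0)// -sqrtr_sqr ler_wsqrtr//.
rewrite exprMn nn_sqr; have := energy_decreasing t0; rewrite {1}/energy_e.
have : 0 <= tau / 2 * ip (wbar t) (wbar t) by rewrite mulr_ge0 ?ip_ge0// divr_ge0// ltW.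
have := Iab_W_ge0 t; move: (ip _ _) (ip _ _) (Iab _) (energy_e 0) => *; lra.
Qed.

Lemma U_displacement (t : R) : 0 <= t ->
  nn (U t - U 0) ^+ 2 <= nn (ubar t - ubar 0) * (2 * Num.sqrt (2 * energy_e 0) / e).
Proof.
move=> t0; rewrite nn_sqr ip_UB_sqr//.
have sD : sqi (ubar t - ubar 0) by apply: sqiB; exact: ubar_sqi.
have sx := sUx t0; have sx0 := sUx (lexx 0); have sX := sqiB sx sx0.
have := cauchy_schwarz sD sX; rewrite ler_norml => /andP[L _].
have : nn (ubar t - ubar 0) * nn (Ux t - Ux 0) <= nn (ubar t - ubar 0) * (2 * Num.sqrt (2 * energy_e 0) / e).
  rewrite ler_wpM2l ?nn_ge0//; apply: le_trans (nnB sx sx0) _.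
  by have := Ux_energy_le t0; have := Ux_energy_le (lexx 0); lra.
by move: L; move: (ip _ _) (nn _ * _) => *; lra.
Qed.


End flow.

(** * Continuation argument *)

Section bootstrap.
Variables (R : realType) (a b e : R).
Hypothesis e0 : 0 < e.
Implicit Types (f g h : R -> R).
Local Notation sqi := (sqi a b).
Local Notation nn := (nn a b).

(** To exceed [q], a continuous function starting at most at [q] would have to take a value strictly
    between [q] and [d], which the last hypothesis excludes. *)
Lemma continuation (g : R -> R) (q d t : R) : 0 <= t -> {within `[0, t], continuous g} -> g 0 <= q -> q < d ->
  (forall s, 0 <= s -> s <= t -> g s < d -> g s <= q) -> g t <= q.
Proof.
move=> t0 cg g0 qd H; rewrite leNgt; apply/negP => lt.
pose q' := Num.min (g t) ((q + d) / 2).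
have q'1 : q < q' by rewrite lt_min lt; lra.
have q'2 : q' <= g t by rewrite ge_min lexx.
have q'3 : q' < d by apply: (@le_lt_trans _ _ ((q + d) / 2)); [rewrite ge_min lexx orbT|lra].
have [|s] := @IVT R g 0 t q' t0 cg.
  by rewrite ge_min le_max (le_trans g0 (ltW q'1))/= q'2 orbT.
rewrite in_itv/= => /andP[s0 st] E.
by have := H s s0 st; rewrite E => /(_ q'3); lra.
Qed.

Lemma nn_dist f g h : sqi f -> sqi g -> sqi h -> `|nn (f - h) - nn (g - h)| <= nn (g - f).
Proof.
move=> sf sg sh.
have E : nn (f - g) = nn (g - f) by apply: nnBC.
have := nnD (sqiB sf sg) (sqiB sg sh); rewrite addrA subrK E.
have := nnD (sqiB sg sf) (sqiB sf sh); rewrite addrA subrK.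
move: (nn (g - f)) (nn (f - h)) (nn (g - h)) => x y z h1 h2.
by rewrite ler_norml; apply/andP; split; lra.
Qed.

Variables (X : R -> R -> R) (Y : R -> R) (E : R -> R) (delta L G : R).
Hypothesis sX : forall t : R, 0 <= t -> sqi (X t).
Hypothesis cX : forall t : R, 0 <= t -> time_cont a b t X.
Hypothesis sY : sqi Y.
Hypothesis XE : forall t : R, 0 <= t -> nn (X t - X 0) ^+ 2 <= t * (E 0 - E t).
Hypothesis lower_bound : forall t : R, 0 <= t -> nn (X t - Y) < delta -> e * L <= E t.
Hypothesis initial : E 0 <= e * (L + G).

Let dist_cont (T : R) : {within `[0, T], continuous (fun t => nn (X t - X 0))}.
Proof.
apply/subspace_continuousP => s; rewrite /= in_itv/= => /andP[s0 sT].
apply/cvgrPdist_le => /= eta eta0.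
have [d d0 H] := cX s0 eta0.
exists d => // t /= td; rewrite in_itv/= => /andP[t0 _].
have td' : `|t - s| < d by rewrite distrC.
have := H t t0 td'; apply: le_trans.
exact: (nn_dist (sX s0) (sX t0) (sX (lexx 0))).
Qed.

Let displacement_near (t : R) : 0 <= t -> nn (X t - Y) < delta -> nn (X t - X 0) ^+ 2 <= e * (t * G).
Proof.
move=> t0 /(lower_bound t0) LE; apply: le_trans (XE t0) _; rewrite mulrCA ler_wpM2l//.
by move: initial LE; move: (E 0) (E t) => *; lra.
Qed.

Let near_of_displacement (q t : R) : nn (X 0 - Y) + q < delta -> 0 <= t -> nn (X t - X 0) <= q ->
  nn (X t - Y) < delta.
Proof.
move=> Dq t0 tq.
have := nnD (sqiB (sX t0) (sX (lexx 0))) (sqiB (sX (lexx 0)) sY); rewrite addrA subrK.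
by move: Dq tq; move: (nn _) (nn _) (nn _) => x y z Dq zq; lra.
Qed.

Lemma slow_displacement (T q t : R) : 0 <= G -> 0 <= q -> nn (X 0 - Y) + q < delta ->
  e * (T * G) <= q ^+ 2 -> 0 <= t -> t <= T -> nn (X t - X 0) ^+ 2 <= e * (t * G).
Proof.
move=> G0 q0 Dq TG t0 tT; apply: displacement_near => //.
apply: (near_of_displacement Dq t0).
(* The strict inequality leaves room for some [d > q]: a displacement below [d] still keeps [X]
   within [delta] of [Y], and is therefore at most [q]. *)
have [d qd Dd] : exists2 d : R, q < d & nn (X 0 - Y) + d < delta.
  by exists ((q + (delta - nn (X 0 - Y))) / 2); lra.
apply: (continuation t0 (@dist_cont t) _ qd).
  by have := XE (lexx 0); rewrite mul0r exprn_even_le0//= => /eqP ->.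
move=> s s0 st sd; have H := displacement_near s0 (near_of_displacement Dd s0 (ltW sd)).
rewrite -(@ler_pXn2r _ 2)// ?nnegrE ?nn_ge0//; apply: (le_trans H); apply: le_trans TG.
by rewrite ler_pM2l// ler_wpM2r// (le_trans st).
Qed.

End bootstrap.

(* From the hypotheses of the theorem to the L2 calculus *)
Transparent Iab.
Lemma cvge0_lt (R : realType) (T : Type) (F : set_system T) (FF : Filter F) (g : T -> \bar R) (eta : R) :
  g @ F --> 0%:E -> 0 < eta -> \forall x \near F, (`|g x| < eta%:E)%E.
Proof.
move=> /fine_cvgP[gfin /cvgrPdist_lt/(_ eta)] H eta0; have {}H := H eta0.
near=> x; have fx : g x \is a fin_num by near: x; exact: gfin.
have : `|0 - (fine \o g) x| < eta by near: x; exact: H.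
by rewrite sub0r normrN /= -(fineK fx) abse_EFin lte_fin.
Unshelve. all: by end_near. Qed.

Lemma near_le_cvge0 (R : realType) (T : Type) (F : set_system T) (FF : Filter F) (g : T -> \bar R) :
  (\forall x \near F, (0 <= g x)%E) -> (forall eta : R, 0 < eta -> \forall x \near F, (g x <= eta%:E)%E) ->
  g @ F --> 0%:E.
Proof.
move=> g0 H; apply/fine_cvgP; split.
  near=> x; rewrite ge0_fin_numE; last by near: x.
  by apply: (@le_lt_trans _ _ 1%:E); [near: x; exact: H|rewrite ltry].
apply/cvgrPdist_le => /= eta eta0; near=> x.
have gx0 : (0 <= g x)%E by near: x.
have gx : (g x <= eta%:E)%E by near: x; exact: H.
rewrite sub0r normrN ger0_norm ?fine_ge0//.
by rewrite -lee_fin fineK// ge0_fin_numE// (le_lt_trans gx)// ltry.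
Unshelve. all: by end_near. Qed.

Section conversion.
Variables (R : realType) (a b : R).
Hypothesis ab : a < b.
Local Notation mu := (@lebesgue_measure R).
Implicit Types (f g h psi : R -> R) (F : R -> R -> R).

Lemma intg_oo f : measurable_fun `]a, b[ f -> mu.-integrable `]a, b[ (EFin \o f) -> intg a b f.
Proof.
move=> mf /integrableP[_ fi]; have mf' : measurable_fun `[a, b] f by exact: measurable_fun_itv_cc mf.
apply/integrableP; split; first exact/measurable_EFinP.
rewrite integral_itv_bndoo//; apply: measurableT_comp => //; exact/measurable_EFinP.
Qed.

Lemma L2_sqi f : L2 a b f -> sqi a b f.
Proof.
move=> [mf fi]; split; first exact: measurable_fun_itv_cc mf.
by apply: intg_oo fi; apply: measurable_funX.
Qed.

Lemma integral_oo_EFin f : intg a b f -> (\int[mu]_(x in `]a, b[) (f x)%:E)%E = (Iab a b f)%:E.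
Proof.
move=> If; rewrite /Iab /Rintegral fineK; last exact: integrable_fin_num.
by rewrite [RHS]integral_itv_bndoo//; apply/measurable_EFinP; apply: meas_oo; exact: intg_meas If.
Qed.

Lemma ip_sqr f : ip a b f f = Iab a b (fun x => f x ^+ 2).
Proof. by apply: eq_Iab => x _; rewrite fctE expr2. Qed.

Lemma L2_cont_time_cont F (s : R) : (forall T : R, 0 < T -> L2_cont a b T F) ->
  (forall t : R, 0 <= t -> sqi a b (F t)) -> 0 <= s -> time_cont a b s F.
Proof.
move=> LF sF s0 eta eta0.
have s1 : 0 < s + 1 by rewrite ltr_wpDl.
have ss1 : 0 <= s <= s + 1 by rewrite s0 lerDl ler01.
have eta2 : 0 < eta ^+ 2 by rewrite exprn_gt0.
have [d /= d0 H] := cvge0_lt _ (LF _ s1 s ss1) eta2.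
(* The cap [1] keeps [t] in the interval [[0, s + 1]] on which continuity is used. *)
exists (Num.min d 1); first by rewrite lt_min d0 ltr01.
move=> t t0; rewrite lt_min => /andP[td t1].
have {}H := H t; rewrite /= in H.
have {H} : (`|\int[mu]_(x in `]a, b[) ((F t x - F s x) ^+ 2)%:E| < (eta ^+ 2)%:E)%E.
  apply: H; first by rewrite distrC.
  by rewrite in_itv/= t0; move: t1; rewrite ltr_distl => /andP[_ /ltW].
have sD := sqiB (sF t t0) (sF s s0); have [_ ID] := sD.
rewrite (integral_oo_EFin ID) abse_EFin lte_fin => H.
rewrite -(@ler_pXn2r _ 2)// ?nnegrE ?nn_ge0 ?(ltW eta0)// nn_sqr ip_sqr.
by apply: le_trans (ltW H); exact: ler_norm.
Qed.

Lemma ip_oo f g : sqi a b f -> sqi a b g -> \int[mu]_(x in `]a, b[) (f x * g x) = ip a b f g.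
Proof. by move=> sf sg; rewrite Iab_oo//; apply: intg_meas; exact: intgM. Qed.

Lemma weak_deriv_wder f g : sqi a b f -> sqi a b g -> weak_deriv a b f g -> wder a b f g.
Proof.
move=> sf sg W psi tg; have := W psi (test_gen_fn tg).
have sp : sqi a b psi by apply: smooth_gen_sqi; exact: tg.1.
have sp' := test_gen_sqi tg.
by rewrite !ip_oo.
Qed.

Lemma test_derive_conv F psi (t D : R) : (forall s : R, 0 <= s -> sqi a b (F s)) -> sqi a b psi -> 0 < t ->
  is_derive t 1 (fun s : R => \int[mu]_(x in `]a, b[) (F s x * psi x)) D ->
  is_derive t 1 (fun s : R => ip a b (F s) psi) D.
Proof.
move=> sF sp t0; apply: near_eq_is_derive.
by near=> s; rewrite ip_oo//; apply: sF; apply: ltW; near: s; exact: lt_nbhsr.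
Unshelve. all: by end_near. Qed.

End conversion.
Opaque Iab.

Lemma C3_derivatives (R : realType) (W : R -> R) : C3 W ->
  [/\ forall y : R, is_derive y 1 W (derive1 W y),
      forall y : R, is_derive y 1 (derive1 W) (derive1n 2 W y),
      forall y : R, is_derive y 1 (derive1n 2 W) (derive1n 3 W y) & continuous (derive1n 3 W)].
Proof.
have H (f : R -> R) (y : R) : derivable f y 1 -> is_derive y 1 f (derive1 f y).
  by move=> d; rewrite derive1E; exact: derivableP.
move=> [d0 d1 d2 c3]; split; [|exact: (fun y => H _ _ (d1 y))|exact: (fun y => H _ _ (d2 y))|exact: c3].
exact: (fun y => H _ _ (d0 y)).
Qed.

(** All that the limit of small [e] has to know about a solution; [E] is [e] times its energy. *)
Record flow_estimates (R : realType) (a b tau e : R) (W : R -> R) (U Ux Uxx : R -> R -> R) (E : R -> R) : Prop := FlowEstimates {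
  flow_sqi : forall t : R, 0 <= t -> [/\ sqi a b (U t), sqi a b (Ux t) & sqi a b (Uxx t)];
  flow_wder : forall t : R, 0 <= t -> wder a b (U t) (Ux t) /\ wder a b (Ux t) (Uxx t);
  flow_continuous : forall t : R, 0 <= t -> {within `[a, b], continuous (U t)};
  flow_time_cont : forall t : R, 0 <= t -> time_cont a b t (fun s => bar a b (U s));
  flow_energy_displacement : forall t : R, 0 <= t ->
    nn a b (bar a b (U t) - bar a b (U 0)) ^+ 2 <= t * (E 0 - E t);
  flow_time_displacement : forall t : R, 0 <= t ->
    nn a b (bar a b (U t) - bar a b (U 0)) <= t * Num.sqrt (2 * E 0 / tau);
  flow_displacement : forall t : R, 0 <= t ->
    nn a b (U t - U 0) ^+ 2 <= nn a b (bar a b (U t) - bar a b (U 0)) * (2 * Num.sqrt (2 * E 0) / e);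
  flow_potential_le : forall t : R, 0 <= t ->
    e * (e / 2 * ip a b (Ux t) (Ux t) + e^-1 * Iab a b (W \o U t)) <= E t;
  flow_energy_ge0 : 0 <= E 0 }.

Lemma solution_estimates (R : realType) (a b tau e : R) (W : R -> R) (alpha beta : R) (U Ux Uxx Uxxx Ut Utx : R -> R -> R) :
  a < b -> 0 < tau -> 0 < e -> C3 W -> derive1 W alpha = 0 -> derive1 W beta = 0 -> (forall y, 0 <= W y) ->
  (forall T : R, 0 < T -> reg_H3H1 a b T U Ux Uxx Uxxx Ut Utx) ->
  (forall t : R, 0 <= t ->
    [/\ {within `[a, b], continuous (U t)}, U t a = alpha, U t b = beta,
        {within `[a, b], continuous (Uxx t)} & Uxx t a = 0 /\ Uxx t b = 0]) ->
  (forall psi, test_fn a b psi -> forall t : R, 0 < t ->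
    is_derive t 1 (fun s : R => \int[lebesgue_measure]_(x in `]a, b[) (U s x * psi x))
      (\int[lebesgue_measure]_(x in `]a, b[) (Ut t x * psi x))) ->
  (forall psi, test_fn a b psi -> forall t : R, 0 < t ->
    exists D : R,
      is_derive t 1 (fun s : R => \int[lebesgue_measure]_(x in `]a, b[) (Ut s x * psi x)) D /\
      tau * D + \int[lebesgue_measure]_(x in `]a, b[) (Ut t x * psi x) =
      \int[lebesgue_measure]_(x in `]a, b[)
        ((- (e ^+ 2) * Uxx t x + derive1 W (U t x)) * derive1n 2 psi x)) ->
  exists2 E : R -> R, flow_estimates a b tau e W U Ux Uxx E &
    energy tau e W a b (U 0) (Ux 0) (bar a b (Ut 0)) = (E 0 / e)%:E.
Proof.
move=> ab tau0 e0 /C3_derivatives[dW dW1 dW2 cW3] W1a W1b W0 reg bd eqU eqUt.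
have reg1 (t : R) : 0 <= t -> reg_H3H1 a b (t + 1) U Ux Uxx Uxxx Ut Utx.
  by move=> t0; apply: reg; rewrite ltr_wpDl.
have tt (t : R) : 0 <= t -> 0 <= t <= t + 1 by move=> ->; rewrite lerDl ler01.
have sq (t : R) : 0 <= t -> [/\ sqi a b (Ux t), sqi a b (Uxx t), sqi a b (Uxxx t) & sqi a b (Ut t)].
  move=> t0; have [H _ _] := reg1 t t0; have [_ h1 h2 h3 [h4 _]] := H t (tt t t0).
  by split; exact: L2_sqi.
have sUx (t : R) : 0 <= t -> sqi a b (Ux t) by move=> /sq[].
have sUxx (t : R) : 0 <= t -> sqi a b (Uxx t) by move=> /sq[].
have sUxxx (t : R) : 0 <= t -> sqi a b (Uxxx t) by move=> /sq[].
have sUt (t : R) : 0 <= t -> sqi a b (Ut t) by move=> /sq[].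
have cU (t : R) : 0 <= t -> {within `[a, b], continuous (U t)} by move=> /bd[].
have sU (t : R) : 0 <= t -> sqi a b (U t) by move=> /cU; exact: continuous_sqi.
have cUxx (t : R) : 0 <= t -> {within `[a, b], continuous (Uxx t)} by move=> /bd[].
have wd (t : R) : 0 <= t -> [/\ wder a b (U t) (Ux t), wder a b (Ux t) (Uxx t) & wder a b (Uxx t) (Uxxx t)].
  move=> t0; have [_ H _] := reg1 t t0; have [h1 h2 h3 _] := H t (tt t t0).
  by split; apply: weak_deriv_wder => //; [exact: sU|exact: sUx|exact: sUx|exact: sUxx|exact: sUxx|exact: sUxxx].
have wUx (t : R) : 0 <= t -> wder a b (U t) (Ux t) by move=> /wd[].
have wUxx (t : R) : 0 <= t -> wder a b (Ux t) (Uxx t) by move=> /wd[].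
have wUxxx (t : R) : 0 <= t -> wder a b (Uxx t) (Uxxx t) by move=> /wd[].
have tUx (t : R) : 0 <= t -> time_cont a b t Ux.
  by apply: L2_cont_time_cont => // T /reg[_ _ []].
have tUxxx (t : R) : 0 <= t -> time_cont a b t Uxxx.
  by apply: L2_cont_time_cont => // T /reg[_ _ []].
have tUt (t : R) : 0 <= t -> time_cont a b t Ut.
  by apply: L2_cont_time_cont => // T /reg[_ _ [? ? ? ? []]].
have Ua (t : R) : 0 <= t -> U t a = alpha by move=> /bd[].
have Ub (t : R) : 0 <= t -> U t b = beta by move=> /bd[].
have Uxxa (t : R) : 0 <= t -> Uxx t a = 0 by move=> /bd[_ _ _ _ []].
have Uxxb (t : R) : 0 <= t -> Uxx t b = 0 by move=> /bd[_ _ _ _ []].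
have cW1 : continuous (derive1 W) by move=> y; exact: is_derive_continuous (dW1 y).
have cW : continuous W by move=> y; exact: is_derive_continuous (dW y).
have dU psi : test_gen a b psi -> forall t : R, 0 < t ->
    is_derive t 1 (fun s : R => ip a b (U s) psi) (ip a b (Ut t) psi).
  move=> tg t t0; have sp : sqi a b psi by apply: smooth_gen_sqi; exact: tg.1.
  have := eqU psi (test_gen_fn tg) t t0; rewrite (ip_oo (sUt t (ltW t0)) sp).
  exact: test_derive_conv.
have dUt psi : test_gen a b psi -> forall t : R, 0 < t ->
    exists D : R, is_derive t 1 (fun s : R => ip a b (Ut s) psi) D /\
    tau * D + ip a b (Ut t) psi =
    ip a b (fun x => - (e ^+ 2) * Uxx t x + derive1 W (U t x)) (derive1 (derive1 psi)).
  move=> tg t t0; have sp : sqi a b psi by apply: smooth_gen_sqi; exact: tg.1.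
  have sp2 := test_gen_sqi (test_gen_derive1 tg).
  have t0' := ltW t0.
  have smu : sqi a b (fun x => - (e ^+ 2) * Uxx t x + derive1 W (U t x)).
    apply: (@sqiD _ _ _ (fun x => - (e ^+ 2) * Uxx t x) (derive1 W \o U t)); first by apply: sqiZ; exact: sUxx.
    by apply: continuous_sqi; apply: continuous_comp_within => //; exact: cU.
  have [D [dD E]] := eqUt psi (test_gen_fn tg) t t0; exists D; split.
    exact: test_derive_conv dD.
  by move: E; rewrite (ip_oo (sUt t t0') sp) -(ip_oo smu sp2).
exists (energy_e a b tau e W U Ux Ut); first split.
- by move=> t t0; split; [exact: sU|exact: sUx|exact: sUxx].
- by move=> t t0; split; [exact: wUx|exact: wUxx].
- exact: cU.
- exact: (ubar_time_cont ab sUx wUx tUx cU Ua).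
- exact: (ubar_displacement_energy ab dW dW1 dW2 cW3 W1a W1b sUx sUxx sUxxx sUt wUx wUxx wUxxx tUx tUxxx tUt cU Ua Ub cUxx Uxxa Uxxb dU dUt).
- exact: (ubar_displacement_time ab tau0 dW dW1 dW2 cW3 W1a W1b sUx sUxx sUxxx sUt wUx wUxx wUxxx tUx tUxxx tUt cU Ua Ub cUxx Uxxa Uxxb dU dUt W0).
- exact: (U_displacement ab tau0 dW dW1 dW2 cW3 W1a W1b sUx sUxx sUxxx sUt wUx wUxx wUxxx tUx tUxxx tUt cU Ua Ub cUxx Uxxa Uxxb dU dUt W0 e0).
- move=> t t0; rewrite mulrDr mulrA (mulrA e e^-1) divff ?gt_eqF// mul1r mulrA -expr2 /energy_e.
  by rewrite -[leRHS]addrA lerDr mulr_ge0 ?ip_ge0// divr_ge0// ltW.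
- rewrite /energy_e addr_ge0// ?addr_ge0 ?mulr_ge0 ?ip_ge0 ?divr_ge0 ?sqr_ge0 ?(ltW tau0) ?(ltW e0)//.
  by apply: Iab_ge0 => x _; exact: W0.
have z0 := lexx (0 : R).
have sw : sqi a b (bar a b (Ut 0)) by apply: (bar_sqi ab); apply: sqi_intg; exact: sUt.
have [_ Iw] := sw; have [_ Ix] := sUx 0 z0.
have IW : intg a b (W \o U 0) by apply: continuous_intg; apply: continuous_comp_within => //; exact: cU.
rewrite /energy (integral_oo_EFin Iw).
have Id : intg a b (fun x => e / 2 * Ux 0 x ^+ 2 + W (U 0 x) / e).
  apply: (@intgD _ _ _ (fun x => e / 2 * Ux 0 x ^+ 2) (fun x => W (U 0 x) / e)); first exact: intgZ.
  by have := intgZ e^-1 IW; congr intg; apply: funext => x; rewrite mulrC.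
rewrite (integral_oo_EFin Id) -EFinM -EFinD; congr EFin.
have -> : Iab a b (fun x => e / 2 * Ux 0 x ^+ 2 + W (U 0 x) / e) =
    e / 2 * ip a b (Ux 0) (Ux 0) + e^-1 * Iab a b (W \o U 0).
  rewrite ip_sqr -IabZ// -(IabZ _ IW) -IabD; [|exact: intgZ..].
  by apply: eq_Iab => x _; rewrite !fctE /= (mulrC e^-1).
rewrite -ip_sqr /energy_e -/(wbar a b Ut 0).
by move: (ip _ _ _ _) (ip _ _ _ _) (Iab _ _ _) => x y z; field; rewrite gt_eqF.
Qed.

Lemma pw_const_intg (R : realType) (a b : R) (N : nat) (h : nat -> R) (v : R -> R) : a < b ->
  pw_const_jumps a b N h v -> (0 < N)%N -> intg a b v.
Proof.
move=> ab [[ah hh hb] v1 vc _] N0.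
have hmono i : (1 <= i)%N -> (i <= N)%N -> a < h i.
  elim: i => // -[_ _ _|i IH _ iN]; first exact: ah.
  by apply: lt_trans (IH isT (ltnW iN)) (hh i.+1 _); rewrite /= iN.
have hle i : (i <= N)%N -> ext_pts a b N h i <= ext_pts a b N h i.+1.
  rewrite /ext_pts /=; case: i => [|i] iN /=; first by rewrite N0 ltW.
  rewrite iN; case: ltnP => iN'; first by rewrite ltW// hh.
  by rewrite (_ : i.+1 = N) ?ltW//; apply/eqP; rewrite eqn_leq iN iN'.
have ea i : (i <= N.+1)%N -> a <= ext_pts a b N h i.
  elim: i => [|i IH] iN; first by rewrite /ext_pts.
  exact: le_trans (IH (ltnW iN)) (hle i iN).
have piece i : (i <= N)%N -> measurable_fun `[ext_pts a b N h i, ext_pts a b N h i.+1] v.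
  move=> iN; apply: (@measurable_fun_itv_cc _ _ _ false true).
  set x := ext_pts _ _ _ _ i; set y := ext_pts _ _ _ _ i.+1.
  have m : measurable_fun `]x, y[ (cst (v ((x + y) / 2))) by exact: measurable_cst.
  apply: eq_measurable_fun m => z; rewrite inE /= in_itv/= => /andP[xz zy].
  by apply: (vc i iN); rewrite -/x -/y; apply/andP; split; lra.
have M i : (i <= N.+1)%N -> measurable_fun `[a, ext_pts a b N h i] v.
  elim: i => [|i IH] iN.
    by rewrite /ext_pts/= set_itv1; exact: measurable_fun_set1.
  rewrite (_ : `[a, ext_pts a b N h i.+1]%classic = `[a, ext_pts a b N h i] `|` `[ext_pts a b N h i, ext_pts a b N h i.+1]).
    by apply/measurable_funU => //; split; [exact: IH (ltnW iN)|exact: piece].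
  apply/seteqP; split => z /=; rewrite !in_itv/=.
    by move=> /andP[az zi]; have [zle|zge] := leP z (ext_pts a b N h i); [left; rewrite az|right; rewrite (ltW zge)].
  have h1 := ea i (ltnW iN); have h2 := hle i iN.
  by case=> /andP[z1 z2]; apply/andP; split; lra.
have mv : meas a b v by have := M N.+1 (leqnn _); rewrite /ext_pts/= ltnn.
apply: (@le_intg _ _ _ v (cst 1)) => //; last exact: intg_cst.
by move=> x; rewrite in_itv/= => /v1[|] ->; rewrite ?normrN normr1.
Qed.

(** Squaring the interpolation inequality turns the root of [E0] into [E0], so that the product
    [d ^+ 2 * E0] can be estimated as a whole. *)
Lemma fourth_power_bound (R : realType) (X d E0 e P : R) : 0 < e -> 0 <= d -> 0 <= E0 ->
  X ^+ 2 <= d * (2 * Num.sqrt (2 * E0) / e) -> d ^+ 2 * E0 <= P * e ^+ 2 -> X ^+ 4 <= 8 * P.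
Proof.
move=> e0 d0 E00 H HP.
have S2 : Num.sqrt (2 * E0) ^+ 2 = 2 * E0 by rewrite sqr_sqrtr// mulr_ge0.
have S0 : 0 <= Num.sqrt (2 * E0) by exact: sqrtr_ge0.
move: (Num.sqrt _) S2 S0 H => S S2 S0 H.
have : X ^+ 4 <= (d * (2 * S / e)) ^+ 2.
  rewrite (_ : X ^+ 4 = (X ^+ 2) ^+ 2); last by ring.
  by rewrite lerXn2r// nnegrE ?sqr_ge0// mulr_ge0// divr_ge0 ?mulr_ge0// ltW.
move=> /le_trans; apply.
rewrite (_ : (d * (2 * S / e)) ^+ 2 = 4 * d ^+ 2 * S ^+ 2 / e ^+ 2); last by field; rewrite gt_eqF.
rewrite S2 ler_pdivrMr ?exprn_gt0//; lra.
Qed.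

(** * Slow motion for a fixed small parameter *)

Section slow_motion.
Variables (R : realType) (a b tau e : R) (W : R -> R) (U Ux Uxx : R -> R -> R) (E : R -> R).
Variables (v : R -> R) (delta B C A f : R).
Hypotheses (ab : a < b) (tau0 : 0 < tau) (e0 : 0 < e) (B0 : 0 <= B) (C0 : 0 <= C) (f0 : 0 < f).
Hypothesis fl : flow_estimates a b tau e W U Ux Uxx E.
Hypothesis Iv : intg a b v.
Hypothesis lower_bound : forall t : R, 0 <= t -> nn a b (bar a b (U t) - bar a b v) < delta ->
  B - C * expR (- (A / e)) <= e / 2 * ip a b (Ux t) (Ux t) + e^-1 * Iab a b (W \o U t).
Hypothesis initial : E 0 <= e * (B + f^-1).
Hypothesis close : nn a b (bar a b (U 0) - bar a b v) + Num.sqrt (e * (1 + C)) < delta.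

Let T := Num.min f (expR (A / e)).
(** [e G] bounds what can be dissipated as long as [bar u] is near [bar v]. *)
Let G := C * expR (- (A / e)) + f^-1.

Let G0 : 0 <= G. Proof. by rewrite addr_ge0 ?mulr_ge0 ?expR_ge0// invr_ge0 ltW. Qed.

(** Each entry of the minimum [T] absorbs one term of [G]: [f] the initial excess [1 / f], the
    exponential the defect of the lower bound. *)
Let TG : T * G <= 1 + C.
Proof.
rewrite /G mulrDr addrC lerD//.
  by rewrite ler_pdivrMr// mul1r ge_min lexx.
rewrite mulrCA -[leRHS]mulr1 ler_wpM2l// expRN ler_pdivrMr ?expR_gt0// mul1r.
by rewrite ge_min lexx orbT.
Qed.

Let displacement (t : R) : 0 <= t -> t <= T ->
  nn a b (bar a b (U t) - bar a b (U 0)) ^+ 2 <= e * (t * G).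
Proof.
move=> t0 tT.
apply: (@slow_displacement R a b e e0 (fun s => bar a b (U s)) (bar a b v) E delta
  (B - C * expR (- (A / e))) G _ _ _ _ _ _ T (Num.sqrt (e * (1 + C)))) => //.
- by move=> s s0; apply: (bar_sqi ab); apply: sqi_intg; have [] := flow_sqi fl s0.
- exact: flow_time_cont fl.
- exact: (bar_sqi ab).
- exact: flow_energy_displacement fl.
- move=> s s0 /(lower_bound s0) H; apply: le_trans (flow_potential_le fl s0).
  by rewrite ler_pM2l.
- apply: le_trans initial _; rewrite ler_pM2l// /G.
  by rewrite addrA subrK.
- by rewrite sqr_sqrtr ?mulr_ge0 ?addr_ge0 ?(ltW e0)// ler_pM2l.
Qed.

Lemma bar_displacement_le (t : R) : 0 <= t -> t <= T ->
  nn a b (bar a b (U t) - bar a b (U 0)) ^+ 2 <= e * (1 + C).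
Proof.
move=> t0 tT; apply: le_trans (displacement t0 tT) _; rewrite ler_pM2l//.
by apply: le_trans TG; rewrite ler_wpM2r.
Qed.

(* For [f < 1] the energy may be as large as [1 / f], but then the time interval is so short
   that the bound on the velocity is enough. *)
Lemma displacement_le (t s : R) : 0 <= s -> s <= 1 -> 0 <= t -> t <= s * T ->
  nn a b (U t - U 0) ^+ 4 <= 8 * ((1 + C) * (B + 1) + 2 * (B + 1) ^+ 2 / tau) * s.
Proof.
move=> s0 s1 t0 tsT.
have T0 : 0 <= T by rewrite le_min (ltW f0) expR_ge0.
have tT : t <= T by apply: le_trans tsT _; rewrite -[leRHS]mul1r ler_wpM2r.
rewrite -mulrA; apply: (fourth_power_bound e0 (nn_ge0 _ _ _) (flow_energy_ge0 fl) (flow_displacement fl t0)).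
have E0 := flow_energy_ge0 fl.
have [f1|f1] := leP 1 f.
- have H := displacement t0 tT.
  have H1 : e * (t * G) <= e * (s * (1 + C)).
    rewrite ler_pM2l//; apply: (@le_trans _ _ (s * T * G)); first by rewrite ler_wpM2r.
    by rewrite -mulrA ler_wpM2l.
  have H2 : E 0 <= e * (B + 1).
    apply: le_trans initial _; rewrite ler_pM2l// lerD2l invf_le1//.
  apply: (@le_trans _ _ (e * (s * (1 + C)) * (e * (B + 1)))).
    by apply: ler_pM; rewrite ?sqr_ge0//; exact: le_trans H H1.
  rewrite (_ : _ * (e * _) = (1 + C) * (B + 1) * s * e ^+ 2); last by ring.
  by rewrite ler_wpM2r ?sqr_ge0// ler_wpM2r// lerDl divr_ge0 ?(ltW tau0)// mulr_ge0// sqr_ge0.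
- have H := flow_time_displacement fl t0.
  have H1 : nn a b (bar a b (U t) - bar a b (U 0)) ^+ 2 <= t ^+ 2 * (2 * E 0 / tau).
    rewrite -[X in _ * X]sqr_sqrtr ?divr_ge0 ?mulr_ge0 ?(ltW tau0)// -exprMn lerXn2r// ?nnegrE ?nn_ge0//.
    by rewrite mulr_ge0// sqrtr_ge0.
  have tf : t <= s * f by apply: le_trans tsT _; rewrite ler_wpM2l// ge_min lexx.
  (* The large energy and the short time compensate: [f (B + 1 / f) = f B + 1 <= B + 1]. *)
  have H2 : t * E 0 <= s * (e * (B + 1)).
    apply: (@le_trans _ _ (s * f * (e * (B + f^-1)))); first exact: ler_pM.
    rewrite -mulrA ler_wpM2l// mulrCA ler_pM2l// mulrDr divff ?gt_eqF// lerD2r.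
    by rewrite -[leRHS]mul1r ler_wpM2r// ltW.
  apply: (@le_trans _ _ (2 / tau * (t * E 0) ^+ 2)).
    apply: (@le_trans _ _ (t ^+ 2 * (2 * E 0 / tau) * E 0)); first by rewrite ler_wpM2r.
    by rewrite (_ : t ^+ 2 * _ * _ = 2 / tau * (t * E 0) ^+ 2)//; ring.
  apply: (@le_trans _ _ (2 / tau * (s * (e * (B + 1))) ^+ 2)).
    rewrite ler_wpM2l ?divr_ge0 ?(ltW tau0)// lerXn2r// nnegrE mulr_ge0//.
    by rewrite mulr_ge0 ?(ltW e0)// addr_ge0.
  rewrite (_ : 2 / tau * _ = 2 * (B + 1) ^+ 2 / tau * s ^+ 2 * e ^+ 2); last by ring.
  rewrite ler_wpM2r ?sqr_ge0//.
  have P0 : 0 <= 2 * (B + 1) ^+ 2 / tau by rewrite divr_ge0 ?(ltW tau0)// mulr_ge0// sqr_ge0.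
  apply: (@le_trans _ _ (2 * (B + 1) ^+ 2 / tau * s)).
    by rewrite ler_wpM2l// expr2 -[leRHS]mul1r ler_wpM2r.
  by rewrite ler_wpM2r// lerDr mulr_ge0// addr_ge0.
Qed.

End slow_motion.

(** * L1 distances and conclusion *)

Section L1_distance.
Variables (R : realType) (a b : R).
Hypothesis ab : a < b.
Implicit Types (f g h : R -> R).

Lemma L1dist_Iab f g : intg a b f -> intg a b g -> L1dist a b f g = (Iab a b (fun x => `|f x - g x|))%:E.
Proof. by move=> If Ig; rewrite /L1dist integral_oo_EFin//; apply: intg_norm; exact: intgB. Qed.

Lemma L1dist_le f g h : sqi a b f -> sqi a b g -> intg a b h ->
  Iab a b (fun x => `|f x - h x|) <= Iab a b (fun x => `|g x - h x|) + Num.sqrt (b - a) * nn a b (f - g).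
Proof.
move=> sf sg Ih; have If := sqi_intg sf; have Ig := sqi_intg sg.
apply: (@le_trans _ _ (Iab a b ((fun x => `|g x - h x|) + (fun x => `|f x - g x|)))).
  apply: le_Iab; [by apply: intg_norm; exact: intgB| |].
    by apply: intgD; apply: intg_norm; exact: intgB.
  by move=> x _; rewrite fctE addrC -[f x - h x](subrKA (g x)) ler_normD.
rewrite IabD; [|by apply: intg_norm; exact: intgB..].
by rewrite lerD2l; apply: Iab_norm_le; [exact: ltW|exact: sqiB].
Qed.

Lemma L1dist_bar_le f g : intg a b f -> intg a b g ->
  Iab a b (fun x => `|bar a b f x - bar a b g x|) <= 2 * (b - a) * Iab a b (fun x => `|f x - g x|).
Proof.
move=> If Ig; have I := intgB If Ig.
have -> : 2 * (b - a) * Iab a b (fun x => `|f x - g x|) = Iab a b (cst (2 * Iab a b (fun x => `|f x - g x|))).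
  by rewrite Iab_cst ?(ltW ab)//; ring.
apply: le_Iab; [apply: intg_norm; apply: intgB; apply: sqi_intg; exact: (bar_sqi ab)|exact: intg_cst|].
by move=> x xab; rewrite -(barB ab If Ig xab); exact: (norm_bar_le ab I).
Qed.

Lemma nn_bar_le f g : intg a b f -> intg a b g ->
  nn a b (bar a b f - bar a b g) <= Num.sqrt (b - a) * (2 * Iab a b (fun x => `|f x - g x|)).
Proof.
move=> If Ig; have I := intgB If Ig.
rewrite mulrC; apply: nn_bounded; [exact: ltW|by rewrite mulr_ge0// Iab_ge0| |].
  by apply: measB; apply: sqi_meas; exact: (bar_sqi ab).
by move=> x xab; rewrite !fctE -(barB ab If Ig xab); exact: (norm_bar_le ab I).
Qed.

(** The supremum of an empty set would be [-oo]; [T >= 0] provides the time [t = 0]. *)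
Lemma sup_L1dist_ge0 (F : R -> R -> R) g (T : R) : 0 <= T ->
  (0 <= ereal_sup [set L1dist a b (F t) g | t in `[0%R, T]])%E.
Proof.
move=> T0; apply: (@le_trans _ _ (L1dist a b (F 0) g)).
  by apply: integral_ge0 => x _; rewrite lee_fin.
by apply: ereal_sup_ubound; exists 0 => //=; rewrite in_itv/= lexx.
Qed.

End L1_distance.

(* u e t x = u^eps(x,t); ux, uxx, uxxx are its weak x-derivatives,
   ut e t x = u^eps_t(x,t) and utx its weak x-derivative.
   alpha, beta in {-1,+1} are the fixed boundary values at a and b. *)
Theorem theorem2p5 (R : realType) (a b tau : R) (W : R -> R)
    (alpha beta : R) (N : nat) (h : nat -> R) (v : R -> R) (r A : R)
    (f : R -> R) (u ux uxx uxxx ut utx : R -> R -> R -> R) :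
  a < b -> 0 < tau ->
  C3 W ->
  W 1 = 0 -> W (-1) = 0 -> derive1 W 1 = 0 -> derive1 W (-1) = 0 ->
  0 < derive1n 2 W 1 -> 0 < derive1n 2 W (-1) ->
  (forall s, s != 1 -> s != -1 -> 0 < W s) ->
  (alpha = 1 \/ alpha = -1) -> (beta = 1 \/ beta = -1) ->
  (0 < N)%N ->
  pw_const_jumps a b N h v ->
  0 < r ->
  (forall i j, (1 <= i <= N)%N -> (1 <= j <= N)%N -> i != j ->
     forall x, ~ (h i - r < x < h i + r /\ h j - r < x < h j + r)) ->
  a <= h 1%N - r -> h N + r <= b ->
  0 < A -> A < r * Num.sqrt (2 * Num.min (derive1n 2 W 1) (derive1n 2 W (-1))) ->
  (forall e : R, 0 < e -> 0 < f e) ->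
  (* u^eps solves the problem, for every eps > 0 *)
  (forall e : R, 0 < e ->
     [/\ (forall T : R, 0 < T ->
            reg_H3H1 a b T (u e) (ux e) (uxx e) (uxxx e) (ut e) (utx e)),
         (forall t : R, 0 <= t ->
            [/\ {within `[a, b], continuous (u e t)}, u e t a = alpha,
                u e t b = beta, {within `[a, b], continuous (uxx e t)} &
                uxx e t a = 0 /\ uxx e t b = 0]),
         (forall psi, test_fn a b psi -> forall t : R, 0 < t ->
            is_derive t 1
              (fun s : R => \int[lebesgue_measure]_(x in `]a, b[) (u e s x * psi x))
              (\int[lebesgue_measure]_(x in `]a, b[) (ut e t x * psi x))) &
         (forall psi, test_fn a b psi -> forall t : R, 0 < t ->
            exists D : R,
              is_derive t 1
                (fun s : R => \int[lebesgue_measure]_(x in `]a, b[) (ut e s x * psi x)) D /\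
              tau * D + \int[lebesgue_measure]_(x in `]a, b[) (ut e t x * psi x) =
              \int[lebesgue_measure]_(x in `]a, b[)
                 ((- (e ^+ 2) * uxx e t x + derive1 W (u e t x)) * derive1n 2 psi x))]) ->
  (* initial data *)
  (fun e : R => L1dist a b (u e 0) v) @ 0^'+ --> 0%:E ->
  (\forall e \near 0^'+,
     (energy tau e W a b (u e 0%R) (ux e 0%R) (bar a b (ut e 0%R))
      <= (N%:R * \int[lebesgue_measure]_(s in `[-1, 1]) Num.sqrt ((2 * W s))%R
          + (f e)^-1)%R%:E)%E) ->
  (fun e : R => ereal_sup [set L1dist a b (bar a b (u e t)) (bar a b v)
                        | t in `[0, Num.min (f e) (expR (A / e))]])
     @ 0^'+ --> 0%:E
  /\
  (forall eta : R, 0 < eta < 1 ->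
     (fun e : R => ereal_sup [set L1dist a b (u e t) v
                        | t in `[0, e `^ eta * Num.min (f e) (expR (A / e))]])
       @ 0^'+ --> 0%:E).
Proof.
move=> ab tau0 C3W We WNe W1e W1Ne W2e W2Ne Wpos alpha1 beta1 N0 pw r0 disj ah hb A0 Ar f0 sol init ener.
have W0 (s : R) : 0 <= W s.
  have [->|s1] := eqVneq s 1; first by rewrite We.
  by have [->|s2] := eqVneq s (-1); [rewrite WNe|rewrite ltW// Wpos].
have [dW dW1 dW2 cW3] := C3_derivatives C3W.
have cW : continuous W by move=> y; exact: is_derive_continuous (dW y).
have cW2 : continuous (derive1n 2 W) by move=> y; exact: is_derive_continuous (dW2 y).
have W1a : derive1 W alpha = 0 by case: alpha1 => ->.
have W1b : derive1 W beta = 0 by case: beta1 => ->.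
have [c [k1 [k2 [rho [P1 [s1 [P2 [s2 [Ac Pr]]]]]]]]] :=
  double_well_profiles dW dW1 cW2 We WNe W1e W1Ne W0 Wpos W2e W2Ne r0 Ar.
pose c0 := \int[lebesgue_measure]_(s in `[-1, 1]) Num.sqrt (2 * W s).
have [cpos /andP[rho0 _] k10 k20 _ _ _ _ _] := Pr.
have Iv : intg a b v := pw_const_intg ab pw N0.
have l0 : 0 < r - A / (2 * c) by rewrite subr_gt0 ltr_pdivrMr ?mulr_gt0// mulrC.
(* The bound on the squared distance under which [interface_energy] applies; its root [delta] does
   not depend on [e]. *)
pose thr := (rho * (r - A / (2 * c)) / 8) ^+ 2 * ((r - A / (2 * c)) / 4).
have thr0 : 0 < thr by rewrite mulr_gt0 ?divr_gt0// exprn_gt0// divr_gt0// mulr_gt0.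
pose delta := Num.sqrt thr.
have delta0 : 0 < delta by rewrite sqrtr_gt0.
pose C := N%:R * (k1 + k2); pose B := N%:R * c0.
have C0 : 0 <= C by rewrite mulr_ge0// addr_ge0// ltW.
have B0 : 0 <= B by rewrite mulr_ge0// Rintegral_ge0// => x _; exact: sqrtr_ge0.
have C1 : 0 < 1 + C by rewrite ltr_wpDr.
have ba0 : 0 < b - a by rewrite subr_gt0.
have sba0 : 0 < Num.sqrt (b - a) by rewrite sqrtr_gt0.
pose ell e := Iab a b (fun x => `|u e 0 x - v x|).
have su0 (e : R) : 0 < e -> intg a b (u e 0).
  by move=> /sol[_ /(_ 0 (lexx 0))[cu _ _ _ _] _ _]; exact: continuous_intg.
have near0 : \forall e \near 0^'+, (0 : R) < e by exact: nbhs_right_gt.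
have near_ell (k : R) : 0 < k -> \forall e \near 0^'+, ell e <= k.
  move=> kpos; have H : \forall e \near 0^'+, (`|L1dist a b (u e 0%R) v| < k%:E)%E := cvge0_lt _ init kpos.
  near=> e.
  have e0 : 0 < e by near: e.
  have : (`|L1dist a b (u e 0%R) v| < k%:E)%E by near: e; exact: H.
  rewrite L1dist_Iab ?su0// abse_EFin lte_fin => /ltW; apply: le_trans; exact: ler_norm.
(* What holds for all small [e]. One half of [delta] is reserved for the initial distance from
   [bar u] to [bar v], the other for the displacement. *)
pose ready e := [/\ 0 < e, ell e * (2 * Num.sqrt (b - a)) <= delta / 2,
    Num.sqrt (e * (1 + C)) < delta / 2 &
    exists2 E, flow_estimates a b tau e W (u e) (ux e) (uxx e) E & E 0 <= e * (B + (f e)^-1)].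
have good : \forall e \near 0^'+, ready e.
  near=> e; have e0 : 0 < e by near: e.
  split => //.
  - rewrite -ler_pdivlMr ?mulr_gt0//; near: e; apply: near_ell; by rewrite !divr_gt0// mulr_gt0.
  - have d2 : 0 < delta / 2 by rewrite divr_gt0.
    rewrite -[ltRHS]gtr0_norm// -sqrtr_sqr ltr_sqrt ?exprn_gt0// -ltr_pdivlMr//.
    by near: e; apply: nbhs_right_lt; rewrite divr_gt0// exprn_gt0// divr_gt0.
  - have [reg bd eq1 eq2] := sol e e0.
    have [E fl EE] := solution_estimates ab tau0 e0 C3W W1a W1b W0 reg bd eq1 eq2.
    exists E => //.
    have : (energy tau e W a b (u e 0%R) (ux e 0%R) (bar a b (ut e 0%R)) <= (N%:R * c0 + (f e)^-1)%:E)%E by near: e.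
    by rewrite EE lee_fin ler_pdivrMr// mulrC.
have motion (e : R) : ready e ->
    [/\ forall t : R, 0 <= t -> sqi a b (u e t),
     forall t : R, 0 <= t -> t <= Num.min (f e) (expR (A / e)) ->
       nn a b (bar a b (u e t) - bar a b (u e 0)) ^+ 2 <= e * (1 + C) &
     forall t s : R, 0 <= s -> s <= 1 -> 0 <= t -> t <= s * Num.min (f e) (expR (A / e)) ->
       nn a b (u e t - u e 0) ^+ 4 <= 8 * ((1 + C) * (B + 1) + 2 * (B + 1) ^+ 2 / tau) * s].
  move=> [e0 cl1 cl2 [E fl E0]].
  have lb (t : R) : 0 <= t -> nn a b (bar a b (u e t) - bar a b v) < delta ->
      B - C * expR (- (A / e)) <= e / 2 * ip a b (ux e t) (ux e t) + e^-1 * Iab a b (W \o u e t).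
    move=> t0 close; have [_ sx sxx] := flow_sqi fl t0; have [w1 w2] := flow_wder fl t0.
    have small : ip a b (bar a b (u e t) - bar a b v) (bar a b (u e t) - bar a b v) < thr.
      by rewrite -nn_sqr -[ltRHS]sqr_sqrtr ?(ltW thr0)// ltrXn2r// ?nnegrE ?nn_ge0 ?sqrtr_ge0.
    rewrite /B /C -mulrA -mulrBr.
    exact: (interface_energy ab Pr e0 cW W0 A0 Ac (flow_continuous fl t0) sx sxx w1 w2 Iv N0 pw r0 disj ah hb small).
  have close : nn a b (bar a b (u e 0) - bar a b v) + Num.sqrt (e * (1 + C)) < delta.
    rewrite [ltRHS]splitr ler_ltD//; apply: le_trans cl1.
    by apply: le_trans (nn_bar_le ab (su0 e e0) Iv) _; rewrite mulrC (mulrC 2) -mulrA.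
  split.
  - by move=> t /(flow_sqi fl)[].
  - exact: (bar_displacement_le ab e0 C0 (f0 e e0) fl Iv lb E0 close).
  - exact: (displacement_le ab tau0 e0 B0 C0 (f0 e e0) fl Iv lb E0 close).
have T_ge0 (e : R) : 0 < e -> 0 <= Num.min (f e) (expR (A / e)).
  by move=> e0; rewrite le_min expR_ge0 ltW// f0.
split.
  apply: near_le_cvge0.
    by near=> e; apply: sup_L1dist_ge0; apply: T_ge0; near: e.
  move=> eta eta0; near=> e.
  have ge : ready e by near: e.
  have e0 : 0 < e by case: ge.
  have [su bd _] := motion e ge.
  apply: ge_ereal_sup => _ [t /= + <-]; rewrite in_itv/= => /andP[t0 tT].
  have sb (s : R) : 0 <= s -> sqi a b (bar a b (u e s)).
    by move=> s0; apply: (bar_sqi ab); apply: sqi_intg; exact: su.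
  have Ibv : intg a b (bar a b v) by apply: sqi_intg; exact: (bar_sqi ab).
  rewrite (L1dist_Iab (sqi_intg (sb t t0)) Ibv) lee_fin; apply: le_trans (L1dist_le ab (sb t t0) (sb 0 (lexx 0)) Ibv) _.
  rewrite [leRHS]splitr lerD//.
    apply: le_trans (L1dist_bar_le ab (su0 e e0) Iv) _; rewrite mulrC -ler_pdivlMr ?mulr_gt0//.
    by near: e; apply: near_ell; rewrite !divr_gt0// mulr_gt0.
  rewrite -(@ler_pXn2r _ 2)// ?nnegrE ?divr_ge0 ?mulr_ge0 ?nn_ge0 ?sqrtr_ge0 ?(ltW eta0)//.
  rewrite exprMn sqr_sqrtr ?(ltW ba0)//.
  apply: (@le_trans _ _ ((b - a) * (e * (1 + C)))); first by rewrite ler_pM2l// bd.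
  rewrite mulrCA -ler_pdivlMr ?mulr_gt0//.
  by near: e; apply: nbhs_right_le; rewrite divr_gt0 ?mulr_gt0// exprn_gt0// divr_gt0.
move=> eta /andP[eta0 _]; apply: near_le_cvge0.
  by near=> e; apply: sup_L1dist_ge0; rewrite mulr_ge0 ?powR_ge0 ?T_ge0//; near: e.
move=> k kpos.
(* The constant of [displacement_le] is independent of [e]; with [s = e^eta] the fourth power of the
   displacement of [u] is at most [K e^eta], which tends to 0. *)
set K := 8 * ((1 + C) * (B + 1) + 2 * (B + 1) ^+ 2 / tau).
have K0 : 0 < K.
  have Bp : 0 < B + 1 by rewrite ltr_wpDl.
  by rewrite mulr_gt0// ltr_pwDl ?mulr_gt0// divr_ge0 ?(ltW tau0)// mulr_ge0// sqr_ge0.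
have bK0 : 0 < Num.sqrt (b - a) ^+ 4 * K by rewrite pmulr_lgt0// exprn_gt0.
have powR_small (m : R) : 0 < m -> \forall e \near 0^'+, e `^ eta <= m.
  by move=> m0; apply: (cvgr_le _ (powR_cvg0 eta0)).
near=> e.
have ge : ready e by near: e.
have e0 : 0 < e by case: ge.
have [su _ bd] := motion e ge.
apply: ge_ereal_sup => _ [t /= + <-]; rewrite in_itv/= => /andP[t0 tT].
rewrite (L1dist_Iab (sqi_intg (su t t0)) Iv) lee_fin; apply: le_trans (L1dist_le ab (su t t0) (su 0 (lexx 0)) Iv) _.
rewrite [leRHS]splitr lerD//.
  by near: e; apply: near_ell; rewrite divr_gt0.
rewrite -(@ler_pXn2r _ 4)// ?nnegrE ?divr_ge0 ?mulr_ge0 ?nn_ge0 ?sqrtr_ge0 ?(ltW kpos)//.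
have se1 : e `^ eta <= 1 by near: e; exact: powR_small.
rewrite exprMn; apply: (@le_trans _ _ (Num.sqrt (b - a) ^+ 4 * (K * e `^ eta))).
  by rewrite ler_pM2l ?exprn_gt0// bd// powR_ge0.
rewrite mulrA mulrC -ler_pdivlMr//.
by near: e; apply: powR_small; rewrite divr_gt0// exprn_gt0// divr_gt0.
Unshelve. all: by end_near. Qed.
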